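(* Assume the following. - $\mathrm{Lip}(F)<\lambda_1$. - $G$ is twice Fréchet differentiable with bounded first and second derivatives. Let $\mu^{\Delta t}$ denote the unique invariant distribution of the explicit Euler scheme $Y_{n+1}=Y_n+\Delta t\,G(Y_n)+\Delta W_n^Q$, for $\Delta t\in(0,1]$. Let $\varphi:H\to\mathbb R$ be twice Fréchet differentiable with $\sup_y|D\varphi(y)|+\sup_y\|D^2\varphi(y)\|_{\mathcal L(H)}\le1$. Then there exists $C>0$ such that for all $\Delta t\in(0,1]$, $$\Big|\int\varphi\,d\mu^{\Delta t}-\int\varphi\,d\mu_\star\Big|\le C\Delta t.$$
   Context: $H$ is a real separable infinite-dimensional Hilbert space with norm $|\cdot|$, and $(e_k)$ is an orthonormal basis. The sequence $(q_k)$ is non-increasing, with $q_k>0$ and $\sum_kq_k<\infty$. Set $\lambda_k=q_k^{-1}$, $Qx=\sum_kq_k\langle x,e_k\rangle e_k$ and $\nu=\mathcal N(0,\tfrac12Q)$. $V:H\to\mathbb R$ is $C^2$ with bounded second derivative, $F=-DV$, $G(x)=-x+QF(x)$, and $\mu_\star(dx)=Z^{-1}e^{-2V(x)}\nu(dx)$ with $Z=\int e^{-2V}d\nu$. $W^Q(t)=\sum_k\sqrt{q_k}\beta_k(t)e_k$, where the $\beta_k$ are independent standard real Brownian motions, and $\Delta W^Q_n=W^Q((n+1)\Delta t)-W^Q(n\Delta t)$. It is known that under $\mathrm{Lip}(F)<\lambda_1$ this Markov chain is ergodic for $\Delta t\in(0,1]$ with a unique invariant distribution $\mu^{\Delta t}$,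 and that $\mu_\star$ is the invariant distribution of $dY=G(Y)dt+dW^Q$. *)

(* Defs.v *)
From HB Require Import structures.
From mathcomp Require Import all_boot all_order all_algebra.
From mathcomp Require Import all_classical all_reals all_analysis.
Set Implicit Arguments. Unset Strict Implicit. Unset Printing Implicit Defensive.
Import Order.TTheory GRing.Theory Num.Theory.
Import numFieldNormedType.Exports.
Local Open Scope classical_set_scope.
Local Open Scope ring_scope.

Section Defs.
Context {R : realType} {H : completeNormedModType R}.

(** [ip] is a real inner product on [H] inducing its norm
    (so [H], being complete, is a real Hilbert space). *)
Definition is_inner_product (ip : H -> H -> R) : Prop :=
  [/\ forall a x y z, ip (a *: x + y) z = a * ip x z + ip y z,
      forall x y, ip x y = ip y x &
      forall x, ip x x = `|x| ^+ 2].

Definition is_onb (ip : H -> H -> R) (e : nat -> H) : Prop :=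
  (forall i j, ip (e i) (e j) = (if i == j then 1 else 0)) /\
  (forall x, series (fun k => ip x (e k) *: e k) @ \oo --> x).

Definition Qop (ip : H -> H -> R) (e : nat -> H) (q : nat -> R) (x : H) : H :=
  limn (series (fun k => (q k * ip x (e k)) *: e k)).

Definition Qform (ip : H -> H -> R) (e : nat -> H) (q : nat -> R) (h : H) : R :=
  ip (Qop ip e q h) h.

Definition BH := g_sigma_algebraType (@open H).

(** [g] is the centred Gaussian measure N(0, c Q) on H: every linear
    functional <h,.> has law N(0, c <Qh,h>) (a Dirac mass at 0 if the
    variance vanishes). *)
Definition gaussian_cov (ip : H -> H -> R) (e : nat -> H) (q : nat -> R)
    (c : R) (g : probability BH R) : Prop :=
  forall (h : H) (A : set R), measurable A ->
    g [set x : BH | A (ip h x)] =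
    (if c * Qform ip e q h == 0 then \d_(0 : R) A
     else normal_prob 0 (Num.sqrt (c * Qform ip e q h)) A).

(** [D2] is the second Frechet derivative of [f : H -> W]:
    f is Frechet differentiable everywhere, D2 x is a bounded bilinear map,
    and x |-> Df(x) is Frechet differentiable in operator norm with derivative
    D2 x, i.e. Df(y) h - Df(x) h - D2 x (y - x) h = o(|y - x|) |h|
    uniformly in h. *)
Definition is_second_deriv {W : normedModType R} (f : H -> W)
    (D2 : H -> H -> H -> W) : Prop :=
  [/\ forall x, differentiable f x,
      forall x a u v k, D2 x (a *: u + v) k = a *: D2 x u k + D2 x v k,
      forall x h a u v, D2 x h (a *: u + v) = a *: D2 x h u + D2 x h v,
      forall x, exists M : R, forall h k, `|D2 x h k| <= M * `|h| * `|k| &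
      forall x (eps : R), 0 < eps -> exists2 del : R, 0 < del &
        forall y, `|y - x| < del -> forall h,
          `|'d f y h - 'd f x h - D2 x (y - x) h| <= eps * `|y - x| * `|h|].

Definition D2_continuous {W : normedModType R} (D2 : H -> H -> H -> W) : Prop :=
  forall x (eps : R), 0 < eps -> exists2 del : R, 0 < del &
    forall y, `|y - x| < del -> forall h k,
      `|D2 y h k - D2 x h k| <= eps * `|h| * `|k|.

Definition drift (ip : H -> H -> R) (e : nat -> H) (q : nat -> R)
    (F : H -> H) (x : H) : H :=
  - x + Qop ip e q (F x).

(** [mu] is invariant for the Euler chain Y_{n+1} = Y_n + dt G(Y_n) + dW_n,
    where dW_n has law [g]:  mu(A) = int mu(dy) P(y, A), with
    P(y, A) = g [set z | y + dt G y + z \in A]. *)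
Definition euler_invariant (G : H -> H) (dt : R) (g : probability BH R)
    (mu : probability BH R) : Prop :=
  forall A : set BH, measurable A ->
    mu A = (\int[mu]_(y in setT) g [set z : BH | A ((y : H) + dt *: G y + (z : H))%R])%E.

Definition int_mu_star (nu : probability BH R) (V : H -> R) (phi : H -> R) : R :=
  Rintegral nu setT (fun x : BH => phi x * expR (- 2 * V x))
  / Rintegral nu setT (fun x : BH => expR (- 2 * V x)).

End Defs.

(* Main.v *)
(** Let P be the transition operator of the Euler chain. It maps functions that are Lipschitz
    with a Lipschitz differential to functions of the same class, and multiplies the Lipschitz
    constant by 1 - kappa * dt with kappa = 1 - q_1 Lip(F) > 0. As mu^dt is P-invariant, it is
    therefore enough to show that mu_star (P psi) - mu_star (psi) = O(dt ^ 2) on this class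
    and to sum a geometric series; the diffusion itself and its generator are not needed.

    For the one-step estimate write rho = exp (- 2 V), and let T_c psi (x) be the mean of
    psi (c x + s y) in y under nu, where c ^ 2 + s ^ 2 = 1 (the Ornstein-Uhlenbeck semigroup).
    The product of nu with itself is invariant under rotations, which gives

      int rho (psi - T_c psi) dnu = (1 - c) int rho Dpsi (Q F) dnu + O((1 - c) ^ (3 / 2)).

    Since T_c is the square of T_(sqrt c), replacing c by its square root again and again
    improves 3 / 2 to 2. With c = 1 - dt, P psi differs from T_c psi by a shift of the argument
    by dt Q F, and the terms of first order cancel. All integrals converge because
    rho <= K exp (A |x| ^ 2) for some A < 1 / q_1, so that nu integrates a larger Gaussian. *)

Require Import Defs.
From HB Require Import structures.
From mathcomp Require Import all_boot all_order all_algebra.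
From mathcomp Require Import all_classical all_reals all_analysis.
From mathcomp Require Import measurable_realfun ring lra.
Import Order.TTheory GRing.Theory Num.Theory.
Import numFieldNormedType.Exports.
Set Implicit Arguments. Unset Strict Implicit. Unset Printing Implicit Defensive.
Local Open Scope classical_set_scope.
Local Open Scope ring_scope.

(** * Expectations *)

(** The obstacle is regularity. Along the chain only the Lipschitz constant of the differential
    stays under control, so the Taylor remainder of a test function under a displacement of size
    sqrt (1 - c) is of order 1 - c, as large as the main term. The map (x, y) |-> (u, v) with u = c
    x + s y and v = s x - c y is an involution that preserves the product of nu with itself;
    therefore int rho (psi - T_c psi) dnu is half the mean of (rho u - rho x) (psi u - psi x), a
    product of two small increments, and the remainder becomes cubic in sqrt (1 - c). Passing from c
    to sqrt c replaces it by two remainders with 1 - c about halved; as 2 * 2 ^ (- 3 / 2) < 1,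
    repetition contracts it away, and what each passage adds is of order (1 - c) ^ 2. The Euler
    noise also differs from that of T_c, in amplitude by O(dt ^ (3 / 2)); its first-order effect is
    odd in the noise and has mean zero. Gaussian laws are given by one-dimensional marginals only,
    so the rotation invariance itself rests on the uniqueness of a law with prescribed trigonometric
    integrals. *)

Section Expectation.
Context d (T : measurableType d) (R : realType) (P : {measure set T -> \bar R}).
Implicit Types f g : T -> R.

Definition itg (f : T -> R) := P.-integrable setT (EFin \o f).

Lemma itg_measurable f : itg f -> measurable_fun setT f.
Proof. by move=> /measurable_int/measurable_EFinP. Qed.

Lemma itg_dom f g : measurable_fun setT f -> (forall x, `|f x| <= g x) ->
  itg g -> itg f.
Proof.
move=> mf fg ig; apply: le_integrable ig => //; first exact/measurable_EFinP.
by move=> x _ /=; rewrite lee_fin (le_trans (fg x))// ler_norm.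
Qed.

Lemma itgD f g : itg f -> itg g -> itg (fun x => f x + g x).
Proof. by move=> fi gi; have := integrableD measurableT fi gi. Qed.

Lemma itgB f g : itg f -> itg g -> itg (fun x => f x - g x).
Proof. by move=> fi gi; have := integrableB measurableT fi gi. Qed.

Lemma itgZ k f : itg f -> itg (fun x => k * f x).
Proof. by move=> fi; have := integrableZl measurableT k fi. Qed.

Lemma eq_itg f g : f =1 g -> itg f -> itg g.
Proof. by move=> /funext ->. Qed.

Lemma itg_sum n (f : 'I_n -> T -> R) : (forall i, itg (f i)) ->
  itg (fun x => \sum_(i < n) f i x).
Proof.
move=> fi; have : P.-integrable setT
    (fun x => (\sum_(i <- index_enum 'I_n) (f i x)%:E)%E).
  by apply: integrable_sum => // i _; exact: fi.
by congr (is_true (integrable _ _ _)); apply/funext => x /=; rewrite sumEFin.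
Qed.

Lemma Rint_eq f g : f =1 g -> Rintegral P setT f = Rintegral P setT g.
Proof. by move=> /funext ->. Qed.

Lemma RintD f g : itg f -> itg g ->
  Rintegral P setT (fun x => f x + g x) = Rintegral P setT f + Rintegral P setT g.
Proof. by move=> fi gi; rewrite RintegralD. Qed.

Lemma RintB f g : itg f -> itg g ->
  Rintegral P setT (fun x => f x - g x) = Rintegral P setT f - Rintegral P setT g.
Proof. by move=> fi gi; rewrite RintegralB. Qed.

Lemma RintZ k f : itg f ->
  Rintegral P setT (fun x => k * f x) = k * Rintegral P setT f.
Proof. by move=> fi; rewrite RintegralZl. Qed.

Lemma Rint_le f g : itg f -> itg g -> (forall x, f x <= g x) ->
  Rintegral P setT f <= Rintegral P setT g.
Proof. by move=> fi gi fg; apply: le_Rintegral. Qed.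

Lemma Rint_abs_le f g : measurable_fun setT f -> itg g ->
  (forall x, `|f x| <= g x) -> `|Rintegral P setT f| <= Rintegral P setT g.
Proof.
move=> mf ig fg; have fi := itg_dom mf fg ig.
apply: (le_trans (le_normr_Rintegral measurableT fi)).
by apply: le_Rintegral => //; exact: integrable_norm.
Qed.

Lemma Rint_sum n (f : 'I_n -> T -> R) : (forall i, itg (f i)) ->
  Rintegral P setT (fun x => \sum_(i < n) f i x)
  = \sum_(i < n) Rintegral P setT (f i).
Proof.
elim: n f => [|n IH] f fi.
  rewrite big_ord0 (_ : (fun _ => _) = cst 0).
    by rewrite Rintegral_cst// mul0r.
  by apply/funext => x; rewrite big_ord0.
rewrite big_ord_recr/= -IH// -RintD//; first last.
  exact: itg_sum.
by apply: Rint_eq => x; rewrite big_ord_recr.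
Qed.

Lemma EFin_Rint f : itg f -> (Rintegral P setT f)%:E = (\int[P]_x (f x)%:E)%E.
Proof. by move=> fi; rewrite fineK// integrable_fin_num. Qed.

Lemma Rint_dct (f_ : nat -> T -> R) f g :
  (forall n, measurable_fun setT (f_ n)) -> itg g ->
  (forall n x, `|f_ n x| <= g x) -> (forall x, f_ ^~ x @ \oo --> f x) ->
  Rintegral P setT (f_ n) @[n --> \oo] --> Rintegral P setT f.
Proof.
move=> mf gi fg ff.
have mf' : measurable_fun setT f by apply: measurable_fun_cvg mf _ => x _; apply: ff.
have fle x : `|f x| <= g x.
  have h : `|f_ n x| @[n --> \oo] --> `|f x| by apply: cvg_norm; exact: ff.
  rewrite -(cvg_lim _ h)//; apply: limr_le; first exact: cvgP h.
  by near=> n; exact: fg.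
have fi := itg_dom mf' fle gi.
have fi_ n := itg_dom (mf n) (fg n) gi.
have : (\int[P]_x (f_ n x)%:E)%E @[n --> \oo] --> (\int[P]_x (f x)%:E)%E.
  have [] := @dominated_convergence _ _ _ P setT measurableT
    (fun n x => (f_ n x)%:E) (EFin \o f) (EFin \o g) _ _ _ gi _ => //.
  - by move=> n; exact/measurable_EFinP.
  - exact/measurable_EFinP.
  - apply/aeW => x _; apply: cvg_EFin; last exact: ff.
    by near=> n.
  - by apply/aeW => x n _ /=; rewrite lee_fin.
rewrite -EFin_Rint// => /fine_cvg; apply: cvg_trans.
by apply: near_eq_cvg; near=> n.
Unshelve. all: by end_near. Qed.

End Expectation.

Section ExpectationProbability.
Context d (T : measurableType d) (R : realType) (P : probability T R).

Lemma itg_cst (k : R) : itg P (fun=> k).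
Proof. exact: (finite_measure_integrable_cst P k measurableT). Qed.

Lemma itg_bounded (f : T -> R) k : measurable_fun setT f ->
  (forall x, `|f x| <= k) -> itg P f.
Proof. by move=> mf fk; apply: (itg_dom (g := cst k)) => //; exact: itg_cst. Qed.

Lemma Rint_cst (k : R) : Rintegral P setT (fun=> k) = k.
Proof.
rewrite Rintegral_cst; last exact: measurableT.
transitivity (k * 1); last exact: mulr1.
congr (_ * _); exact: (congr1 fine (@probability_setT _ _ _ P)).
Qed.

End ExpectationProbability.

Section ExpectationProduct.
Context d1 d2 (T1 : measurableType d1) (T2 : measurableType d2) (R : realType).
Context (P1 : probability T1 R) (P2 : probability T2 R).

(** Integrability is asked of every section, not of almost every one, so that the real-valued inner
    integral agrees with [fubini_F] at every point. *)
Lemma Rint_fubini (f : T1 * T2 -> R) : itg (P1 \x P2)%E f ->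
  (forall x, itg P2 (fun y => f (x, y))) ->
  itg P1 (fun x => Rintegral P2 setT (fun y => f (x, y))) /\
  Rintegral (P1 \x P2)%E setT f
  = Rintegral P1 setT (fun x => Rintegral P2 setT (fun y => f (x, y))).
Proof.
move=> fi fxi.
have H : (EFin \o (fun x => Rintegral P2 setT (fun y => f (x, y))))
    = fubini_F P2 (EFin \o f).
  by apply/funext => x; rewrite /fubini_F /= EFin_Rint.
split; first by rewrite /itg H; exact: integrable_fubini_F.
rewrite /Rintegral; congr fine.
by rewrite -(integral12_prod_meas1 fi) -H.
Qed.

Lemma itg_prod (f : T1 * T2 -> R) : measurable_fun setT f ->
  (\int[P1]_x \int[P2]_y (`|f (x, y)|)%:E < +oo)%E -> itg (P1 \x P2)%E f.
Proof.
move=> mf h; apply/integrable12ltyP => //; exact/measurable_EFinP.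
Qed.

Lemma itg_mul (f : T1 -> R) (g : T2 -> R) : itg P1 f -> itg P2 g ->
  itg (P1 \x P2)%E (fun z => f z.1 * g z.2).
Proof.
move=> fi gi; apply: itg_prod.
  apply: measurable_funM.
    exact: (measurableT_comp (itg_measurable fi) measurable_fst).
  exact: (measurableT_comp (itg_measurable gi) measurable_snd).
have -> : (\int[P1]_x \int[P2]_y (`|f x * g y|)%:E)%E
  = (\int[P1]_x (`|f x|%:E * (\int[P2]_y (`|g y|)%:E)))%E.
  apply: eq_integral => x _; rewrite -ge0_integralZl//.
  - by apply: eq_integral => y _; rewrite normrM EFinM.
  - by apply/measurable_EFinP/measurableT_comp => //; exact: itg_measurable gi.
rewrite ge0_integralZr//.
- apply: lte_mul_pinfty.
  + by apply: integral_ge0 => x _; rewrite lee_fin.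
  + by apply: integrable_fin_num => //; exact: integrable_norm.
  + by apply: integrable_lty => //; exact: integrable_norm.
- by apply/measurable_EFinP/measurableT_comp => //; exact: itg_measurable fi.
- by apply: integral_ge0 => y _; rewrite lee_fin.
Qed.

Lemma Rint_mul (f : T1 -> R) (g : T2 -> R) : itg P1 f -> itg P2 g ->
  Rintegral (P1 \x P2)%E setT (fun z => f z.1 * g z.2)
  = Rintegral P1 setT f * Rintegral P2 setT g.
Proof.
move=> fi gi; have [_ ->] := Rint_fubini (itg_mul fi gi) (fun x => itgZ (f x) gi).
rewrite /= mulrC -RintZ//; apply: Rint_eq => x.
by rewrite RintZ// mulrC.
Qed.

End ExpectationProduct.

Section Transfer.
Context d1 d2 (X : measurableType d1) (Y : measurableType d2) (R : realType).
Implicit Types f : Y -> R.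
Context (phi : X -> Y) (mphi : measurable_fun [set: X] phi).
Context (m : {measure set X -> \bar R}) (m' : {measure set Y -> \bar R}).
Hypothesis mm' : forall A, measurable A -> m' A = m (phi @^-1` A).

(** The image measure enters only through [mm']: the laws to be transferred are known by their
    values on measurable sets, not as a [pushforward]. *)
Lemma itg_transferV (f : Y -> R) : itg m' f -> itg m (f \o phi).
Proof.
move=> /integrableP[/measurable_EFinP mf foo]; apply/integrableP; split.
  by apply/measurable_EFinP; exact: measurableT_comp.
move: foo; rewrite (eq_measure_integral (pushforward m phi)); last first.
  by move=> A mA _; rewrite mm'.
rewrite ge0_integral_pushforward//.
by apply/measurableT_comp => //; exact/measurable_EFinP.
Qed.

Lemma Rint_transfer (f : Y -> R) : measurable_fun setT f ->
  itg m (f \o phi) -> Rintegral m' setT f = Rintegral m setT (f \o phi).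
Proof.
move=> mf fi; rewrite /Rintegral; congr fine.
rewrite (eq_measure_integral (pushforward m phi)); last first.
  by move=> A mA _; rewrite mm'.
by rewrite integral_pushforward//; exact/measurable_EFinP.
Qed.

End Transfer.

(** * Laws are determined by their trigonometric integrals *)

Section SignIteration.
Variable R : realType.
Implicit Types w : R.

(** An odd cubic with a repelling fixed point 0 and fixed points -1 and 1 where its derivative
    vanishes. Its iterates are polynomials that converge pointwise to the sign on [-1, 1]. *)
Definition sharpen w : R := (3 * w - w ^+ 3) / 2.

Lemma sharpen_bound w : `|w| <= 1 -> `|sharpen w| <= 1.
Proof.
rewrite /sharpen !ler_norml => /andP[w1 w2].
(* The two products are [2 * (1 - sharpen w)] and [2 * (1 + sharpen w)]. *)
have h1 : 0 <= (1 - w) ^+ 2 * (2 + w) by rewrite mulr_ge0 ?sqr_ge0//; lra.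
have h2 : 0 <= (1 + w) ^+ 2 * (2 - w) by rewrite mulr_ge0 ?sqr_ge0//; lra.
by apply/andP; split; lra.
Qed.

Lemma iter_sharpen_bound n w : `|w| <= 1 -> `|iter n sharpen w| <= 1.
Proof. by move=> w1; elim: n => //= n IH; exact: sharpen_bound. Qed.

Lemma iter_sharpenN n w : iter n sharpen (- w) = - iter n sharpen w.
Proof. by elim: n => //= n ->; rewrite /sharpen; field. Qed.

(** The iterates v increase, and one step multiplies 1 - v by (2 - v - v^2) / 2, which is at most 1
    - v / 2 and hence at most 1 - w / 2. *)
Lemma iter_sharpen_pos n w : 0 < w <= 1 ->
  w <= iter n sharpen w <= 1 /\ 1 - iter n sharpen w <= (1 - w / 2) ^+ n.
Proof.
move=> /andP[w0 w1]; elim: n => [|n [/andP[IH1 IH2] IH3]] /=.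
  by rewrite expr0 lexx w1; split => //; lra.
set v := iter n _ _ in IH1 IH2 IH3 *.
split.
  have h1 : 0 <= (1 - v) ^+ 2 * (2 + v) by rewrite mulr_ge0 ?sqr_ge0//; lra.
  have h2 : 0 <= v * (1 - v) * (1 + v) by rewrite !mulr_ge0//; lra.
  by apply/andP; split; rewrite /sharpen; lra.
have v2 : 0 <= v ^+ 2 by rewrite sqr_ge0.
have v3 : 0 <= (1 - v) * (1 + v) by rewrite mulr_ge0//; lra.
rewrite exprS.
have -> : 1 - sharpen v = (1 - v) * ((2 - v - v ^+ 2) / 2).
  by rewrite /sharpen; field.
rewrite mulrC; apply: ler_pM => //; lra.
Qed.

Lemma cvg_iter_sharpen w : `|w| <= 1 ->
  iter n sharpen w @[n --> \oo] --> Num.sg w.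
Proof.
have pos v : 0 < v <= 1 -> iter n sharpen v @[n --> \oo] --> (1 : R).
  move=> v01; have /andP[v0 v1] := v01.
  apply: (@squeeze_cvgr _ _ _ _ (fun n => 1 - (1 - v / 2) ^+ n) (fun=> 1)).
  - near=> n; have [/andP[? ->] ?] := iter_sharpen_pos n v01.
    by rewrite andbT lerBlDr addrC -lerBlDr.
  - rewrite -[X in _ --> X]subr0; apply: cvgB; first exact: cvg_cst.
    by apply: cvg_expr; rewrite ger0_norm; lra.
  - exact: cvg_cst.
rewrite ler_norml => /andP[wl wr]; have [w0|w0|->] := ltgtP w 0.
- rewrite ltr0_sg// -[w]opprK; under eq_fun do rewrite iter_sharpenN.
  by apply: cvgN; apply: pos; apply/andP; split; lra.
- by rewrite gtr0_sg//; apply: pos; rewrite w0.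
- rewrite sgr0 (_ : (fun n => _) = fun=> 0); first exact: cvg_cst.
  apply/funext; elim=> //= n ->; rewrite /sharpen; field.
Unshelve. all: by end_near. Qed.

(** Once [n.+1] exceeds |w| the argument lies in (-1, 1), where sin has the sign of its argument;
    the sequence is eventually constant. *)
Lemma cvg_sg_sin w : Num.sg (sin (n.+1%:R^-1 * w)) @[n --> \oo] --> Num.sg w.
Proof.
apply: cvg_near_cst; near=> n.
have n0 : 0 < n.+1%:R :> R by rewrite ltr0n.
have wn : `|w| < n.+1%:R.
  have : (Num.truncn `|w| <= n)%N by near: n; exact: nbhs_infty_ge.
  move=> h; apply: lt_le_trans (_ : (Num.truncn `|w|).+1%:R <= _).
    exact: truncnS_gt.
  by rewrite ler_nat.
have key v : 0 < v < n.+1%:R -> 0 < sin (n.+1%:R^-1 * v).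
  move=> /andP[v0 vn]; apply: sin2_gt0; apply/andP; split.
    by rewrite mulr_gt0 ?invr_gt0.
  rewrite mulrC ltr_pdivrMr//; lra.
have [w0|w0|->] := ltgtP w 0; last by rewrite mulr0 sin0.
- rewrite (ltr0_sg w0) ltr0_sg// -oppr_gt0 -sinN -mulrN; apply: key.
  by rewrite oppr_gt0 w0/= -(ltr0_norm w0).
- by rewrite (gtr0_sg w0) gtr0_sg//; apply: key; rewrite w0 -(gtr0_norm w0).
Unshelve. all: by end_near. Qed.

End SignIteration.

(* Multiplying a test function by [sin l] or [cos l] keeps the integrals against
   all [cos l'] and [sin l'] equal; polynomials in such factors then reach
   [sg (sin l)], and [sg (sin (t l))] tends to [sg l] as [t] goes to 0. *)
Section TrigonometricUniqueness.
Context d (T : measurableType d) (R : realType) (m1 m2 : probability T R).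
Variable L : (T -> R) -> Prop.
Hypothesis L0 : L (fun=> 0).
Hypothesis LD : forall a b l l', L l -> L l' -> L (fun x => a * l x + b * l' x).
Hypothesis Lm : forall l, L l -> measurable_fun setT l.
Hypothesis Lcos : forall l, L l ->
  Rintegral m1 setT (cos \o l) = Rintegral m2 setT (cos \o l).
Hypothesis Lsin : forall l, L l ->
  Rintegral m1 setT (sin \o l) = Rintegral m2 setT (sin \o l).

Let bmf (f : T -> R) := measurable_fun setT f /\ exists k : R, forall x, `|f x| <= k.

Let trig_eq (f : T -> R) := bmf f /\ forall l, L l ->
  Rintegral m1 setT (fun x => f x * cos (l x))
    = Rintegral m2 setT (fun x => f x * cos (l x)) /\
  Rintegral m1 setT (fun x => f x * sin (l x))
    = Rintegral m2 setT (fun x => f x * sin (l x)).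

(** Multipliers of [trig_eq] are closed under products by composition, which is not evident for
    [trig_eq] itself; this closure gives access to polynomials. *)
Let mult (u : T -> R) := bmf u /\ forall f, trig_eq f -> trig_eq (fun x => u x * f x).

Let bmfM f g : bmf f -> bmf g -> bmf (fun x => f x * g x).
Proof.
move=> [mf [k fk]] [mg [k' gk]]; split; first exact: measurable_funM.
by exists (k * k') => x; rewrite normrM ler_pM.
Qed.

Let bmfD f g : bmf f -> bmf g -> bmf (fun x => f x + g x).
Proof.
move=> [mf [k fk]] [mg [k' gk]]; split; first exact: measurable_funD.
by exists (k + k') => x; rewrite (le_trans (ler_normD _ _))// lerD.
Qed.

Let bmf_cst k : bmf (fun=> k).
Proof. by split => //; exists `|k|. Qed.

Let bmf_cos l : L l -> bmf (fun x => cos (l x)).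
Proof.
move=> Ll; split; last by exists 1 => x; exact: cos_max.
by apply: measurableT_comp (Lm Ll); apply: continuous_measurable_fun; exact: continuous_cos.
Qed.

Let bmf_sin l : L l -> bmf (fun x => sin (l x)).
Proof.
move=> Ll; split; last by exists 1 => x; exact: sin_max.
by apply: measurableT_comp (Lm Ll); apply: continuous_measurable_fun; exact: continuous_sin.
Qed.

Let bmf_itg (m : probability T R) f : bmf f -> itg m f.
Proof. by move=> [mf [k fk]]; exact: itg_bounded fk. Qed.

Let RintDZ (m : probability T R) a b f g : bmf f -> bmf g ->
  Rintegral m setT (fun x => a * f x + b * g x)
  = a * Rintegral m setT f + b * Rintegral m setT g.
Proof.
move=> /(bmf_itg m) fi /(bmf_itg m) gi.
by rewrite RintD ?RintZ//; exact: itgZ.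
Qed.

Let bmfDZ a b f g : bmf f -> bmf g -> bmf (fun x => a * f x + b * g x).
Proof. by move=> bf bg; apply: bmfD; apply: bmfM. Qed.

Let trig_eqDZ a b f g : trig_eq f -> trig_eq g -> trig_eq (fun x => a * f x + b * g x).
Proof.
move=> [bf tf] [bg tg]; split; first exact: bmfDZ.
move=> l Ll; have [fc fs] := tf _ Ll; have [gc gs] := tg _ Ll.
have bc := bmf_cos Ll; have bs := bmf_sin Ll.
split.
  have E x : (a * f x + b * g x) * cos (l x)
      = a * (f x * cos (l x)) + b * (g x * cos (l x)) by ring.
  rewrite !(Rint_eq _ E) !RintDZ; [by rewrite fc gc|exact: bmfM..].
have E x : (a * f x + b * g x) * sin (l x)
    = a * (f x * sin (l x)) + b * (g x * sin (l x)) by ring.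
rewrite !(Rint_eq _ E) !RintDZ; [by rewrite fs gs|exact: bmfM..].
Qed.

Let trig_eq_lim (f_ : nat -> T -> R) f k : (forall n, trig_eq (f_ n)) ->
  (forall n x, `|f_ n x| <= k) -> (forall x, f_ ^~ x @ \oo --> f x) -> trig_eq f.
Proof.
move=> tf fk ff.
have lim (g : T -> R) : bmf g -> (forall n, Rintegral m1 setT (fun x => f_ n x * g x)
      = Rintegral m2 setT (fun x => f_ n x * g x)) ->
    Rintegral m1 setT (fun x => f x * g x) = Rintegral m2 setT (fun x => f x * g x).
  move=> [mg [c gc]] E.
  have cv (m : probability T R) :
      Rintegral m setT (fun x => f_ n x * g x) @[n --> \oo] -->
      Rintegral m setT (fun x => f x * g x).
    apply: (@Rint_dct _ _ _ _ _ _ (fun=> k * c)).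
    - by move=> n; apply: measurable_funM => //; have [[]] := tf n.
    - exact: itg_cst.
    - by move=> n x; rewrite normrM ler_pM.
    - by move=> x; apply: cvgM; [exact: ff|exact: cvg_cst].
  have h := cv m1; rewrite (funext E) in h.
  exact: cvg_unique h (cv m2).
split.
  split; first by apply: measurable_fun_cvg (fun x _ => ff x) => n; have [[]] := tf n.
  exists k => x; have h : `|f_ n x| @[n --> \oo] --> `|f x| by apply: cvg_norm; exact: ff.
  rewrite -(cvg_lim _ h)//; apply: limr_le; first exact: cvgP h.
  by near=> n; exact: fk.
move=> l Ll; split; apply: lim.
- exact: bmf_cos.
- by move=> n; have [_ /(_ _ Ll)[]] := tf n.
- exact: bmf_sin.
- by move=> n; have [_ /(_ _ Ll)[]] := tf n.
Unshelve. all: by end_near. Qed.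

Let eq_trig_eq f g : f =1 g -> trig_eq f -> trig_eq g.
Proof. by move=> /funext ->. Qed.

Let eq_mult f g : f =1 g -> mult f -> mult g.
Proof. by move=> /funext ->. Qed.

Let mult_cst k : mult (fun=> k).
Proof.
split; first exact: bmf_cst.
move=> f tf; apply: eq_trig_eq (trig_eqDZ k 0 tf tf) => x; ring.
Qed.

Let multM u v : mult u -> mult v -> mult (fun x => u x * v x).
Proof.
move=> [bu mu] [bv mv]; split; first exact: bmfM.
by move=> f tf; apply: eq_trig_eq (mu _ (mv _ tf)) => x; rewrite mulrA.
Qed.

Let multDZ a b u v : mult u -> mult v -> mult (fun x => a * u x + b * v x).
Proof.
move=> [bu mu] [bv mv]; split; first exact: bmfDZ.
move=> f tf; apply: eq_trig_eq (trig_eqDZ a b (mu _ tf) (mv _ tf)) => x; ring.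
Qed.

Let mult_lim (u_ : nat -> T -> R) u k : (forall n, mult (u_ n)) ->
  (forall n x, `|u_ n x| <= k) -> (forall x, u_ ^~ x @ \oo --> u x) -> mult u.
Proof.
move=> tu uk uu.
have key f : trig_eq f -> trig_eq (fun x => u x * f x).
  move=> tf; have [[_ [c fc]] _] := tf.
  apply: (@trig_eq_lim (fun n x => u_ n x * f x) _ (k * c)).
  - by move=> n; have [_] := tu n; apply.
  - by move=> n x; rewrite normrM ler_pM.
  - by move=> x; apply: cvgM; [exact: uu|exact: cvg_cst].
split => //.
split; first by apply: measurable_fun_cvg (fun x _ => uu x) => n; have [[]] := tu n.
exists k => x; have h : `|u_ n x| @[n --> \oo] --> `|u x| by apply: cvg_norm; exact: uu.
rewrite -(cvg_lim _ h)//; apply: limr_le; first exact: cvgP h.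
by near=> n; exact: uk.
Unshelve. all: by end_near. Qed.

Let L_lin l l' a b : L l -> L l' -> L (fun x => a * l x + b * l' x).
Proof. exact: LD. Qed.

(** The product-to-sum formulas return to cos and sin of [l + l'] and [l - l'], which are again in
    [L]. *)
Let mult_trig l : L l -> mult (fun x => sin (l x)) /\ mult (fun x => cos (l x)).
Proof.
move=> Ll; split; split; try exact: bmf_sin; try exact: bmf_cos.
  move=> f [bf tf]; split; first exact: bmfM (bmf_sin Ll) bf.
  move=> l' Ll'; have [Lp Lq] := (L_lin 1 1 Ll Ll', L_lin 1 (-1) Ll Ll').
  have [pc ps] := tf _ Lp; have [qc qs] := tf _ Lq.
  have [bpc bps] := (bmf_cos Lp, bmf_sin Lp); have [bqc bqs] := (bmf_cos Lq, bmf_sin Lq).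
  split.
    have E x : sin (l x) * f x * cos (l' x) =
        2^-1 * (f x * sin (1 * l x + 1 * l' x)) + 2^-1 * (f x * sin (1 * l x + -1 * l' x)).
      by rewrite !mul1r mulN1r sinB sinD; field.
    by rewrite !(Rint_eq _ E) !RintDZ ?ps ?qs//; exact: bmfM.
  have E x : sin (l x) * f x * sin (l' x) =
      2^-1 * (f x * cos (1 * l x + -1 * l' x)) + (- 2^-1) * (f x * cos (1 * l x + 1 * l' x)).
    by rewrite !mul1r mulN1r cosB cosD; field.
  by rewrite !(Rint_eq _ E) !RintDZ ?pc ?qc//; exact: bmfM.
move=> f [bf tf]; split; first exact: bmfM (bmf_cos Ll) bf.
move=> l' Ll'; have [Lp Lq] := (L_lin 1 1 Ll Ll', L_lin 1 (-1) Ll Ll').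
have [pc ps] := tf _ Lp; have [qc qs] := tf _ Lq.
have [bpc bps] := (bmf_cos Lp, bmf_sin Lp); have [bqc bqs] := (bmf_cos Lq, bmf_sin Lq).
split.
  have E x : cos (l x) * f x * cos (l' x) =
      2^-1 * (f x * cos (1 * l x + 1 * l' x)) + 2^-1 * (f x * cos (1 * l x + -1 * l' x)).
    by rewrite !mul1r mulN1r cosB cosD; field.
  by rewrite !(Rint_eq _ E) !RintDZ ?pc ?qc//; exact: bmfM.
have E x : cos (l x) * f x * sin (l' x) =
    2^-1 * (f x * sin (1 * l x + 1 * l' x)) + (- 2^-1) * (f x * sin (1 * l x + -1 * l' x)).
  by rewrite !mul1r mulN1r sinB sinD; field.
by rewrite !(Rint_eq _ E) !RintDZ ?ps ?qs//; exact: bmfM.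
Qed.

Let mult_sin_shift t r l : L l -> mult (fun x => sin (t * (l x - r))).
Proof.
move=> Ll; have [ms mc] := mult_trig (L_lin t 0 Ll L0).
apply: eq_mult (multDZ (cos (t * r)) (- sin (t * r)) ms mc) => x.
by rewrite mulrBr sinB mulr0 addr0; ring.
Qed.

Let mult_sg_sin t r l : L l -> mult (fun x => Num.sg (sin (t * (l x - r)))).
Proof.
move=> Ll; apply: (@mult_lim (fun n x => iter n (@sharpen R) (sin (t * (l x - r)))) _ 1).
- elim=> [|n IH] /=; first exact: mult_sin_shift.
  apply: eq_mult (multDZ (3 / 2) (- 2^-1) IH (multM IH (multM IH IH))) => x.
  by rewrite /sharpen; field.
- by move=> n x; apply: iter_sharpen_bound; exact: sin_max.
- by move=> x; apply: cvg_iter_sharpen; exact: sin_max.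
Qed.

Let mult_sg (r : R) l : L l -> mult (fun x => Num.sg (l x - r)).
Proof.
move=> Ll; apply: (@mult_lim (fun n x => Num.sg (sin (n.+1%:R^-1 * (l x - r)))) _ 1).
- by move=> n; exact: mult_sg_sin.
- by move=> n x; rewrite normr_sg lern1 leq_b1.
- by move=> x; exact: cvg_sg_sin.
Qed.

(** As the sign s takes the values -1, 0 and 1, (s + s^2) / 2 is the indicator of s = 1, also on the
    boundary of the half-space. *)
Let mult_gt (r : R) l : L l -> mult (fun x => (r < l x)%R%:R).
Proof.
move=> Ll; have s := mult_sg r Ll.
apply: eq_mult (multDZ 2^-1 2^-1 s (multM s s)) => x.
rewrite -subr_gt0; have [h|h|->] := ltgtP (l x - r) 0.
- by rewrite ltr0_sg//= mulr0n; field.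
- by rewrite gtr0_sg//= mulr1n; field.
- by rewrite sgr0 /= mulr0n; field.
Qed.

Definition half_spaces := [set A | exists l (r : R), L l /\ A = [set x : T | r < l x]].

Let cyl (A : set T) := exists s : seq ((T -> R) * R),
  (forall p, List.In p s -> L p.1) /\ A = [set x | all (fun p => p.2 < p.1 x) s].

Lemma trig_uniqueness : measurable `<=` <<s half_spaces >> ->
  forall A, measurable A -> m1 A = m2 A.
Proof.
move=> mgen A mA.
have cm B : cyl B -> measurable B /\ m1 B = m2 B.
  move=> [s [sL ->]].
  have ms : mult (fun x => (all (fun p : (T -> R) * R => (p.2 < p.1 x)%R) s)%:R).
    elim: s sL => [|p s IH] sL /=; first exact: mult_cst.
    have := multM (mult_gt p.2 (sL p (or_introl erefl))) (IH (fun q qs => sL q (or_intror qs))).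
    by apply: eq_mult => x; rewrite -natrM mulnb.
  set B' := [set x | _].
  have E : (fun x => (all (fun p : (T -> R) * R => (p.2 < p.1 x)%R) s)%:R) = \1_B' :> (T -> R).
    apply/funext => x; rewrite indicE; congr (nat_of_bool _)%:R.
    by apply/idP/idP; rewrite inE.
  have [[mB _] tB] := ms; rewrite E in mB.
  have mB' : measurable B' by exact: (proj2 (measurable_indicP R B') mB).
  split; first exact: mB'.
  have t1 : trig_eq (fun=> 1).
    split; first exact: bmf_cst.
    move=> l Ll; have e (g : R -> R) : (fun x => 1 * g (l x)) =1 g \o l.
      by move=> x; rewrite mul1r.
    by rewrite !(Rint_eq _ (e _)) Lcos// Lsin.
  (* The indicator of [B'] multiplies the constant 1; tested against the cosine of the zero
     function, this compares the two measures of [B']. *)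
  have [_ /(_ _ L0)[h _]] := tB _ t1.
  have e (m : probability T R) :
      Rintegral m setT
        (fun x => (all (fun p : (T -> R) * R => (p.2 < p.1 x)%R) s)%:R * 1 * cos 0)
      = fine (m B').
    rewrite (@Rint_eq _ _ _ _ _ \1_B'); last by move=> x; rewrite -E cos0 !mulr1.
    by rewrite /Rintegral integral_indic// setIT.
  have := etrans (esym (e m1)) (etrans h (e m2)).
  move=> h'; rewrite -[LHS]fineK ?fin_num_measure// h' fineK//.
  exact: fin_num_measure.
apply: (g_sigma_algebra_measure_unique cyl _ (fun=> setT)) => //.
- by move=> B /cm[].
- by move=> _; exists [::]; split => //; apply/seteqP.
- by rewrite bigcup_const//; exists 0%N.
- move=> B C [s [sL ->]] [s' [sL' ->]]; exists (s ++ s'); split.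
    by move=> p /(@List.in_app_or _ s s' p)[/sL|/sL'].
  by apply/seteqP; split => x /=; rewrite all_cat => /andP.
- by move=> B /cm[].
- by move=> _; rewrite (le_lt_trans (probability_le1 _ _)) ?ltry.
- apply: smallest_sub (mgen _ mA); first exact: smallest_sigma_algebra.
  move=> B [l [r [Ll ->]]]; apply: sub_sigma_algebra.
  exists [:: (l, r)]; split; first by move=> p [<-|].
  by apply/seteqP; split => x /=; rewrite andbT.
Qed.

End TrigonometricUniqueness.

(** * Normal laws on the line *)

Section DensityIntegral.
Context d (T : measurableType d) (R : realType).
Context (m m' : {measure set T -> \bar R}) (p : T -> R).
Hypotheses (mp : measurable_fun setT p) (p0 : forall x, 0 <= p x).
Hypothesis m'E : forall A, measurable A -> m' A = (\int[m]_(x in A) (p x)%:E)%E.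

Import HBNNSimple.

Let density_nnsfun (f : {nnsfun T >-> R}) :
  (\int[m']_x (f x)%:E = \int[m]_x ((f x)%:E * (p x)%:E))%E.
Proof.
under [LHS]eq_integral do rewrite fimfunE -fsumEFin//.
rewrite [LHS]ge0_integral_fsum//; last 2 first.
- by move=> r; exact/measurable_EFinP/measurableT_comp.
- by move=> n x _; rewrite EFinM nnfun_muleindic_ge0.
under [RHS]eq_integral.
  move=> x xD; rewrite fimfunE -fsumEFin// muleC ge0_mule_fsumr; last first.
    by move=> r; rewrite EFinM nnfun_muleindic_ge0.
  over.
rewrite [RHS]ge0_integral_fsum//; last 2 first.
- move=> r; apply: emeasurable_funM; first exact/measurable_EFinP.
  exact/measurable_EFinP/measurableT_comp.
- by move=> n x _; apply: mule_ge0; [rewrite lee_fin|rewrite EFinM nnfun_muleindic_ge0].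
apply: eq_fsbigr => r _; rewrite integralZl_indic_nnsfun// integral_indic// setIT.
have [r0|r0] := ltP r 0.
  have f0 : f @^-1` [set r] = set0.
    by apply/seteqP; split => // x /= fx; have : 0 <= f x by []; rewrite fx leNgt r0.
  rewrite f0 measure0 mule0; apply/esym/integral0_eq => x _.
  by rewrite indic0 mulr0 mule0.
rewrite m'E// -ge0_integralZl//; last 2 first.
- by apply/measurable_EFinP/measurable_funTS.
- by move=> x _; rewrite lee_fin.
rewrite integral_mkcond; apply: eq_integral => x _; rewrite patchE indicE.
by case: ifPn => xr; rewrite ?mulr1 ?mulr0 ?mule0// muleC.
Qed.

Lemma ge0_integral_density (f : T -> \bar R) :
  measurable_fun setT f -> (forall x, 0 <= f x)%E ->
  (\int[m']_x f x = \int[m]_x (f x * (p x)%:E))%E.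
Proof.
move=> mf f0.
pose f_ := nnsfun_approx measurableT mf.
transitivity (lim (\int[m']_x (f_ n x)%:E @[n --> \oo])%E).
  rewrite -monotone_convergence//=.
  - apply: eq_integral => ? /[!inE] xD; apply/esym/cvg_lim => //=.
    exact: cvg_nnsfun_approx.
  - by move=> n; exact/measurable_EFinP/measurable_funTS.
  - by move=> n ? _; rewrite lee_fin.
  - by move=> ? _ ? ? mn; rewrite lee_fin; exact/lefP/nd_nnsfun_approx.
rewrite [X in _ = X](_ : _ = lim
    (\int[m]_x ((f_ n x)%:E * (p x)%:E) @[n --> \oo])%E); last first.
  rewrite -monotone_convergence//=.
  - apply: eq_integral => x /[!inE] xD; apply/esym/cvg_lim => //.
    apply: cvgeZr; first by [].
    exact: cvg_nnsfun_approx.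
  - move=> n; apply: emeasurable_funM; last exact/measurable_EFinP.
    exact/measurable_EFinP/measurable_funTS.
  - by move=> n x _; rewrite mule_ge0// lee_fin.
  - move=> x _ a b ab; rewrite lee_wpmul2r// ?lee_fin//.
    exact/lefP/nd_nnsfun_approx.
by apply: congr_lim; apply/funext => n /=; exact: density_nnsfun.
Qed.

End DensityIntegral.

Section NormalLaw.
Variable R : realType.
Local Notation mu := (@lebesgue_measure R).
Implicit Types s t x y z : R.

Lemma ge0_integral_normal_prob (m s : R) (f : R -> \bar R) :
  measurable_fun setT f -> (forall x, 0 <= f x)%E ->
  (\int[normal_prob m s]_x f x = \int[mu]_x (f x * (normal_pdf m s x)%:E))%E.
Proof.
move=> mf f0; apply: (@ge0_integral_density _ _ R mu (normal_prob m s)) => //.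
- exact: measurable_normal_pdf.
- by move=> x; exact: normal_pdf_ge0.
Qed.

Lemma normal_peakE s : 0 < s -> normal_peak s = s^-1 * normal_peak 1.
Proof.
move=> s0; rewrite /normal_peak expr1n mul1r -mulrnAr sqrtrM ?sqr_ge0//.
by rewrite sqrtr_sqr ger0_norm ?ltW// invfM.
Qed.

Lemma normal_pdf_gt0E (m s x : R) : 0 < s ->
  normal_pdf m s x = s^-1 * normal_peak 1 * expR (- (x - m) ^+ 2 / (s ^+ 2 *+ 2)).
Proof. by move=> s0; rewrite normal_pdfE ?gt_eqF// normal_peakE. Qed.

(** Completing the square: the tilted density is the stated constant times the normal density with
    mean [s ^+ 2 * t]. *)
Lemma integral_normal_expR s t : 0 < s ->
  (\int[normal_prob 0 s]_x (expR (t * x))%:E = (expR (s ^+ 2 * t ^+ 2 / 2))%:E)%E.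
Proof.
move=> s0; rewrite ge0_integral_normal_prob//=; last first.
  by apply/measurable_EFinP; apply: measurableT_comp => //; exact: measurable_funM.
transitivity (\int[mu]_x ((expR (s ^+ 2 * t ^+ 2 / 2))%:E
    * (normal_pdf (s ^+ 2 * t) s x)%:E))%E.
  apply: eq_integral => x _; rewrite -!EFinM; congr EFin.
  rewrite !normal_pdf_gt0E// mulrCA [RHS]mulrCA -!expRD; congr (_ * expR _).
  by field; rewrite gt_eqF.
rewrite ge0_integralZl//=; first by rewrite integral_normal_pdf mule1.
- by apply/measurable_EFinP; exact: measurable_normal_pdf.
- by move=> x _; rewrite lee_fin normal_pdf_ge0.
Qed.

(** The coefficient is parametrised by the ratio [k] of the new deviation [s * k] to the old one, so
    that positive coefficients (k > 1) and negative ones (k < 1) obey one formula. *)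
Lemma integral_normal_expR_sqr (s k : R) : 0 < s -> 0 < k ->
  (\int[normal_prob 0 s]_x (expR ((1 - k ^- 2) / (s ^+ 2 *+ 2) * x ^+ 2))%:E
   = k%:E)%E.
Proof.
move=> s0 k0; rewrite ge0_integral_normal_prob//=; last first.
  apply/measurable_EFinP; apply: measurableT_comp => //; apply: measurable_funM => //.
transitivity (\int[mu]_x (k%:E * (normal_pdf 0 (s * k) x)%:E))%E.
  apply: eq_integral => x _; rewrite -!EFinM; congr EFin.
  rewrite !normal_pdf_gt0E ?mulr_gt0// mulrCA -expRD [RHS]mulrA; congr (_ * expR _).
    by field; rewrite !gt_eqF.
  by rewrite !subr0; field; rewrite !gt_eqF.
rewrite ge0_integralZl//=; first by rewrite integral_normal_pdf mule1.
- by apply/measurable_EFinP; exact: measurable_normal_pdf.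
- by move=> x _; rewrite lee_fin normal_pdf_ge0.
- by rewrite lee_fin ltW.
Qed.

Lemma integral_oppr (g : R -> \bar R) :
  measurable_fun setT g -> (forall x, 0 <= g x)%E ->
  (\int[mu]_x g x = \int[mu]_x (g \o -%R) x)%E.
Proof.
move=> mg g0.
rewrite (eq_measure_integral (pushforward mu (-%R : _ -> measurableTypeR R))); last first.
  by move=> A mA _; apply/esym; exact: lebesgue_measureN.
have mN : measurable_fun setT (-%R : measurableTypeR R -> measurableTypeR R).
  exact: oppr_measurable.
exact: (@ge0_integral_pushforward _ _ _ _ R _ mN mu setT g measurableT mg
  (fun y _ => g0 y)).
Qed.

Lemma integral_translation (f : R -> R) x : continuous f -> (forall y, 0 <= f y) ->
  (\int[mu]_z (f z)%:E = \int[mu]_y (f (x + y))%:E)%E.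
Proof.
move=> cf f0.
have dF : (fun y : R => x + y)^`()%classic = cst 1.
  by apply/funext => y; rewrite derive1E deriveD// derive_cst derive_id add0r.
rewrite (@increasing_ge0_integration_by_substitutionT R (fun y => x + y))//.
- by apply: eq_integral => y _; rewrite dF /= !fctE mulr1.
- by move=> a b ab; rewrite ltrD2l.
- by rewrite dF => ?; exact: cvg_cst.
- by rewrite dF; exact: is_cvg_cst.
- by rewrite dF; exact: is_cvg_cst.
- by apply: cvg_addrl_Ny.
- by apply: cvg_addrl.
Qed.

(** The joint density of one summand x and the sum z, factored into the density of z and the
    conditional density of x given z. *)
Lemma normal_pdf_convolution s1 s2 s x z : 0 < s1 -> 0 < s2 -> 0 < s ->
  s ^+ 2 = s1 ^+ 2 + s2 ^+ 2 ->
  normal_pdf 0 s1 x * normal_pdf 0 s2 (z - x)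
  = normal_pdf 0 s z * normal_pdf (s1 ^+ 2 * z / s ^+ 2) (s1 * s2 / s) x.
Proof.
move=> s10 s20 s0 sE; rewrite !normal_pdf_gt0E ?divr_gt0 ?mulr_gt0//.
rewrite mulrACA -expRD [RHS]mulrACA -[X in _ = _ * X]expRD; congr (_ * expR _).
  by field; rewrite !gt_eqF.
rewrite !subr0.
have s2E : s2 ^+ 2 = s ^+ 2 - s1 ^+ 2 by rewrite sE addrAC subrr add0r.
have h : s ^+ 2 - s1 ^+ 2 != 0 by rewrite -s2E expf_neq0 ?gt_eqF.
rewrite !expr_div_n exprMn s2E.
by field; rewrite h !gt_eqF.
Qed.

Lemma normal_prob_convolution s1 s2 s (f : R -> R) : 0 < s1 -> 0 < s2 -> 0 < s ->
  s ^+ 2 = s1 ^+ 2 + s2 ^+ 2 -> continuous f -> (forall x, 0 <= f x) ->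
  (\int[normal_prob 0 s1]_x \int[normal_prob 0 s2]_y (f (x + y))%:E
   = \int[normal_prob 0 s]_z (f z)%:E)%E.
Proof.
move=> s10 s20 s0 sE cf f0.
have mf : measurable_fun setT f by exact: continuous_measurable_fun.
have mpdf (m' s' : R) := measurable_normal_pdf m' s'.
have pdf0 (m' s' x : R) := normal_pdf_ge0 m' s' x.
have inner x : (\int[normal_prob 0 s2]_y (f (x + y))%:E
    = \int[mu]_z (f z * normal_pdf 0 s2 (z - x))%:E)%E.
  have mfx : measurable_fun setT (fun y => (f (x + y))%:E).
    by apply/measurable_EFinP; apply: measurableT_comp mf _; exact: measurable_funD.
  have fx0 y : (0 <= (f (x + y))%:E)%E by rewrite lee_fin.
  have cg : continuous (fun z => f z * normal_pdf 0 s2 (z - x)).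
    move=> z; apply: cvgM; first exact: cf.
    apply: (@cvg_comp _ _ _ (fun z => z - x) (normal_pdf 0 s2)); last first.
      by apply: continuous_normal_pdf; rewrite gt_eqF.
    by apply: cvgB; [exact: cvg_id|exact: cvg_cst].
  have g0 z : 0 <= f z * normal_pdf 0 s2 (z - x).
    by apply: mulr_ge0; [exact: f0|exact: pdf0].
  apply: (etrans (ge0_integral_normal_prob 0 s2 mfx fx0)).
  apply: (etrans _ (esym (integral_translation x cg g0))).
  by apply: eq_integral => y _; rewrite (addrC x y) addrK.
under eq_integral do rewrite inner.
have mj : measurable_fun setT (fun xz : measurableTypeR R * measurableTypeR R =>
    (f xz.2 * normal_pdf 0 s2 (xz.2 - xz.1))%:E).
  apply/measurable_EFinP; apply: measurable_funM.
    by apply: measurableT_comp => //; exact: measurable_snd.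
  apply: measurableT_comp => //; apply: measurable_funB.
    exact: measurable_snd.
  exact: measurable_fst.
rewrite (@ge0_integral_normal_prob 0 s1)//=; last 2 first.
- apply: (@measurable_fun_fubini_tonelli_F _ _ _ _ R mu _ mj) => xz.
  by rewrite lee_fin mulr_ge0.
- by move=> x; apply: integral_ge0 => z _; rewrite lee_fin mulr_ge0.
transitivity (\int[mu]_x \int[mu]_z
  ((normal_pdf 0 s z * f z)%:E * (normal_pdf (s1 ^+ 2 * z / s ^+ 2) (s1 * s2 / s) x)%:E))%E.
  apply: eq_integral => x _.
  have mfx : measurable_fun setT (fun z => (f z * normal_pdf 0 s2 (z - x))%:E).
    apply/measurable_EFinP; apply: measurable_funM; first exact: mf.
    by apply: measurableT_comp (mpdf _ _) _; exact: measurable_funB.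
  have fx0 z : setT z -> (0 <= (f z * normal_pdf 0 s2 (z - x))%:E)%E.
    by move=> _; rewrite lee_fin; apply: mulr_ge0; [exact: f0|exact: pdf0].
  have px0 : (0 <= (normal_pdf 0 s1 x)%:E)%E by rewrite lee_fin; exact: pdf0.
  apply: (etrans (esym (ge0_integralZr mu measurableT mfx fx0 px0))).
  apply: eq_integral => z _; rewrite -!EFinM; congr EFin.
  transitivity (f z * (normal_pdf 0 s1 x * normal_pdf 0 s2 (z - x))); first by ring.
  by rewrite (normal_pdf_convolution _ _ s10 s20 s0 sE); ring.
have mj' : measurable_fun setT (fun xz : measurableTypeR R * measurableTypeR R =>
    (normal_pdf 0 s xz.2 * f xz.2)%:E
    * (normal_pdf (s1 ^+ 2 * xz.2 / s ^+ 2) (s1 * s2 / s) xz.1)%:E)%E.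
  rewrite (_ : (fun _ => _) = fun xz => ((normal_pdf 0 s1 xz.1
      * normal_pdf 0 s2 (xz.2 - xz.1)) * f xz.2)%:E); last first.
    apply/funext => xz; rewrite -EFinM (normal_pdf_convolution _ _ s10 s20 s0 sE).
    by congr EFin; rewrite mulrAC.
  apply/measurable_EFinP; apply: measurable_funM; last first.
    by apply: measurableT_comp => //; exact: measurable_snd.
  apply: measurable_funM.
    by apply: measurableT_comp => //; exact: measurable_fst.
  apply: measurableT_comp => //; apply: measurable_funB.
    exact: measurable_snd.
  exact: measurable_fst.
rewrite (@fubini_tonelli _ _ _ _ R mu mu _ mj')/=; last first.
  by move=> xz; rewrite mule_ge0// lee_fin ?mulr_ge0.
rewrite ge0_integral_normal_prob//; last exact/measurable_EFinP.
apply: eq_integral => z _; rewrite ge0_integralZl//.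
- by rewrite integral_normal_pdf mule1 EFinM muleC.
- by apply/measurable_EFinP; exact: mpdf.
- by move=> x _; rewrite lee_fin.
- by rewrite lee_fin mulr_ge0.
Qed.

Lemma measurable_cosR : measurable_fun [set: R] (@cos R).
Proof. by apply: continuous_measurable_fun; exact: continuous_cos. Qed.

Lemma measurable_sinR : measurable_fun [set: R] (@sin R).
Proof. by apply: continuous_measurable_fun; exact: continuous_sin. Qed.

(** The density is even and sin is odd. Adding 1 makes the integrands nonnegative, as the change of
    variables [integral_oppr] requires. *)
Lemma Rint_normal_sin s : 0 < s -> Rintegral (normal_prob 0 s) setT (@sin R) = 0.
Proof.
move=> s0; set N := normal_prob 0 s.
have si : itg N sin by apply: (@itg_bounded _ _ _ _ _ 1); [exact: measurable_sinR|exact: sin_max].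
have m1 : measurable_fun [set: R] (fun x => 1 + sin x).
  by apply: measurable_funD => //; exact: measurable_sinR.
have m2 : measurable_fun [set: R] (fun x => 1 - sin x).
  by apply: measurable_funB => //; exact: measurable_sinR.
have p1 x : 0 <= 1 + sin x :> R by have := sin_geN1 x; lra.
have p2 x : 0 <= 1 - sin x :> R by have := sin_le1 x; lra.
have : (\int[N]_x (1 + sin x)%:E = \int[N]_x (1 - sin x)%:E)%E.
  rewrite !ge0_integral_normal_prob//; try exact/measurable_EFinP.
  have mf : measurable_fun setT (fun x => ((1 + sin x)%:E * (normal_pdf 0 s x)%:E)%E).
    apply: emeasurable_funM; apply/measurable_EFinP; first exact: m1.
    exact: measurable_normal_pdf.
  have f0 x : (0 <= (1 + sin x)%:E * (normal_pdf 0 s x)%:E)%E.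
    by apply: mule_ge0; rewrite lee_fin; [exact: p1|exact: normal_pdf_ge0].
  apply: (etrans (integral_oppr mf f0)).
  apply: eq_integral => x _; rewrite /comp sinN -!EFinM; congr (_ * _)%:E.
  by rewrite !normal_pdf_gt0E// !subr0 sqrrN.
have i1 := itg_cst N 1.
move=> /(congr1 fine); rewrite -!/(Rintegral _ _ _).
rewrite (RintD i1 si) (RintB i1 si); lra.
Qed.

Lemma Rint_cos_convolution (N1 N2 N : probability (measurableTypeR R) R) :
  (\int[N1]_x \int[N2]_y (1 + cos (x + y))%:E = \int[N]_z (1 + cos z)%:E)%E ->
  Rintegral N2 setT (@sin R) = 0 ->
  Rintegral N setT (@cos R) = Rintegral N1 setT (@cos R) * Rintegral N2 setT (@cos R).
Proof.
move=> + sin0.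
have ci (P : probability (measurableTypeR R) R) : itg P (@cos R).
  by apply: (@itg_bounded _ _ _ _ _ 1); [exact: measurable_cosR|exact: cos_max].
have si : itg N2 (@sin R).
  by apply: (@itg_bounded _ _ _ _ _ 1); [exact: measurable_sinR|exact: sin_max].
have i1 (P : probability (measurableTypeR R) R) := itg_cst P (1 : R).
set c2 := Rintegral N2 setT _.
have inner x : (\int[N2]_y (1 + cos (x + y))%:E)%E = (1 + c2 * cos x)%:E.
  have icc := itgZ (cos x) (ci N2); have iss := itgZ (sin x) si.
  have E : (fun y => 1 + cos (x + y)) = (fun y => 1 + (cos x * cos y - sin x * sin y)).
    by apply/funext => y; rewrite cosD.
  have i2 := itgD (i1 N2) (itgB icc iss).
  have i3 : itg N2 (fun y => 1 + cos (x + y)) by rewrite E.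
  rewrite -(EFin_Rint i3) E (RintD (i1 N2) (itgB icc iss)) (RintB icc iss).
  by rewrite (RintZ _ (ci N2)) (RintZ _ si) Rint_cst sin0 mulr0 subr0 mulrC.
move=> /(congr1 fine) H.
have : Rintegral N1 setT (fun x => 1 + c2 * cos x)
    = Rintegral N setT (fun z => 1 + cos z).
  apply: etrans H; congr fine; apply: eq_integral => x _.
  by rewrite inner.
rewrite (RintD (i1 N1) (itgZ _ (ci N1))) (RintD (i1 N) (ci N)).
rewrite (RintZ _ (ci N1)) !Rint_cst; lra.
Qed.

(** The characteristic function of N(0, v), with the value of the Dirac mass at v = 0. Its closed
    form is never computed: for uniqueness it is enough that it depends on [v] alone and is
    multiplicative ([normal_cfD]). *)
Definition normal_cf (v : R) :=
  if v == 0 then 1 else Rintegral (normal_prob 0 (Num.sqrt v)) setT (@cos R).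

Lemma normal_cfD (v1 v2 : R) : 0 <= v1 -> 0 <= v2 ->
  normal_cf (v1 + v2) = normal_cf v1 * normal_cf v2.
Proof.
rewrite le_eqVlt => /predU1P[<- _|v10].
  by rewrite add0r /normal_cf eqxx mul1r.
rewrite le_eqVlt => /predU1P[<-|v20].
  by rewrite addr0 /normal_cf eqxx mulr1.
rewrite /normal_cf !gt_eqF ?addr_gt0//.
have s10 : 0 < Num.sqrt v1 by rewrite sqrtr_gt0.
have s20 : 0 < Num.sqrt v2 by rewrite sqrtr_gt0.
have s0 : 0 < Num.sqrt (v1 + v2) by rewrite sqrtr_gt0 addr_gt0.
have sE : Num.sqrt (v1 + v2) ^+ 2 = Num.sqrt v1 ^+ 2 + Num.sqrt v2 ^+ 2.
  by rewrite !sqr_sqrtr ?addr_ge0// ltW.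
have p1 x : 0 <= 1 + cos x :> R by have := cos_geN1 x; lra.
have c1 : continuous (fun x : R => 1 + cos x).
  by move=> x; apply: cvgD; [exact: cvg_cst|exact: continuous_cos].
apply: Rint_cos_convolution; last exact: Rint_normal_sin.
exact: (normal_prob_convolution s10 s20 s0 sE c1 p1).
Qed.

(* [u <= (exp(b u) - 1) / b] and its mirror image squeeze the second moment
   between difference quotients of the moment generating function of [x^2]. *)
Lemma normal_second_moment s : 0 < s ->
  (\int[normal_prob 0 s]_x (x ^+ 2)%:E = (s ^+ 2)%:E)%E.
Proof.
move=> s0; set N := normal_prob 0 s.
have mX : measurable_fun [set: R] (fun x : R => x ^+ 2) by exact: exprn_measurable.
have mE c : measurable_fun [set: R] (fun x : R => expR (c * x ^+ 2)).
  by apply: measurableT_comp => //; exact: measurable_funM.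
have k2 (k : R) : 0 < k -> k ^+ 2 != 0 by move=> k0; rewrite expf_neq0// gt_eqF.
(* The bound is (k - 1) / b for the coefficient b of [integral_normal_expR_sqr]; it tends to s^2 as
   k tends to 1. The lower bound [lo] is the same expression with k < 1. *)
have up k : 1 < k -> (\int[N]_x (x ^+ 2)%:E
    <= (s ^+ 2 * (2 * k ^+ 2 / (k + 1)))%:E)%E.
  move=> k1; have k0 : 0 < k by lra.
  set b := (1 - k ^- 2) / (s ^+ 2 *+ 2).
  have b0 : 0 < b.
    by rewrite divr_gt0 ?pmulrn_lgt0 ?exprn_gt0// subr_gt0 invf_lt1 ?exprn_gt0// exprn_egt1.
  have kE : k = 1 + b * (s ^+ 2 * (2 * k ^+ 2 / (k + 1))).
    rewrite /b; field; rewrite !gt_eqF//; lra.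
  have h : ((1 : R)%:E + b%:E * \int[N]_x (x ^+ 2)%:E <= k%:E)%E.
    rewrite -(integral_normal_expR_sqr s0 k0) -ge0_integralZl//; last 3 first.
    - exact/measurable_EFinP.
    - by move=> x _; rewrite lee_fin sqr_ge0.
    - by rewrite lee_fin ltW.
    rewrite -[X in (X%:E + _)%E](Rint_cst N) EFin_Rint; last exact: itg_cst.
    rewrite -ge0_integralD//; last 2 first.
    - by move=> x _; rewrite -EFinM lee_fin mulr_ge0 ?sqr_ge0// ltW.
    - by apply/measurable_EFinP; exact: measurable_funM.
    apply: ge0_le_integral => //.
    - by move=> x _; rewrite adde_ge0// -EFinM lee_fin mulr_ge0 ?sqr_ge0// ltW.
    - by apply: emeasurable_funD => //; apply/measurable_EFinP; exact: measurable_funM.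
    - by apply/measurable_EFinP; exact: mE.
    - by move=> x _; rewrite -EFinM -EFinD lee_fin expR_ge1Dx.
  have I0 : (0 <= \int[N]_x (x ^+ 2)%:E)%E.
    by apply: integral_ge0 => x _; rewrite lee_fin sqr_ge0.
  move: h I0; case: (\int[N]_x (x ^+ 2)%:E)%E => [r| |]//.
  - by rewrite -EFinM -EFinD !lee_fin => h _; rewrite -(ler_pM2l b0) -(lerD2l 1) -kE.
  - by rewrite gt0_muley ?lte_fin// addey// leye_eq.
have lo (k : R) : 0 < k < 1 -> ((s ^+ 2 * (2 * k ^+ 2 / (k + 1)))%:E
    <= \int[N]_x (x ^+ 2)%:E)%E.
  move=> /andP[k0 k1].
  set b := (k ^- 2 - 1) / (s ^+ 2 *+ 2).
  have b0 : 0 < b.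
    rewrite divr_gt0 ?pmulrn_lgt0 ?exprn_gt0// subr_gt0 invf_gt1 ?exprn_gt0//.
    by rewrite exprn_ilt1// ltW.
  have kE : 1 = k + b * (s ^+ 2 * (2 * k ^+ 2 / (k + 1))).
    rewrite /b; field; rewrite !gt_eqF//; lra.
  have h : ((1 : R)%:E <= k%:E + b%:E * \int[N]_x (x ^+ 2)%:E)%E.
    rewrite -(integral_normal_expR_sqr s0 k0) -ge0_integralZl//; last 3 first.
    - exact/measurable_EFinP.
    - by move=> x _; rewrite lee_fin sqr_ge0.
    - by rewrite lee_fin ltW.
    rewrite -[X in (X%:E <= _)%E](Rint_cst N) EFin_Rint; last exact: itg_cst.
    rewrite -ge0_integralD//; last 3 first.
    - by apply/measurable_EFinP; exact: mE.
    - by move=> x _; rewrite -EFinM lee_fin mulr_ge0 ?sqr_ge0// ltW.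
    - by apply/measurable_EFinP; exact: measurable_funM.
    apply: ge0_le_integral => //.
    - apply: emeasurable_funD; apply/measurable_EFinP; first exact: mE.
      exact: measurable_funM.
    - move=> x _; rewrite -EFinM -EFinD lee_fin -lerBlDr.
      have -> : (1 - k ^- 2) / (s ^+ 2 *+ 2) = - b by rewrite /b -mulNr opprB.
      by rewrite mulNr expR_ge1Dx.
  move: h; case: (\int[N]_x (x ^+ 2)%:E)%E => [r| |]//.
  - by rewrite -EFinM -EFinD !lee_fin => h; rewrite -(ler_pM2l b0) -(lerD2l k) -kE.
  - by rewrite leey.
  - by rewrite gt0_muleNy ?lte_fin// addeNy// leeNy_eq.
have lim (u : nat -> R) : u n @[n --> \oo] --> (1 : R) ->
    s ^+ 2 * (2 * u n ^+ 2 / (u n + 1)) @[n --> \oo] --> s ^+ 2.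
  move=> u1; rewrite -[X in _ --> X]mulr1; apply: cvgM; first exact: cvg_cst.
  rewrite [X in _ --> X](_ : _ = 2 * 1 ^+ 2 / (1 + 1)); last by field.
  apply: cvgM.
    apply: cvgM; first exact: cvg_cst.
    by rewrite expr2; under eq_fun do rewrite expr2; exact: cvgM.
  apply: cvgV; first by rewrite gt_eqF.
  by apply: cvgD => //; exact: cvg_cst.
have u1 : 1 + n.+1%:R^-1 @[n --> \oo] --> (1 : R).
  rewrite -[X in _ --> X]addr0; apply: cvgD; first exact: cvg_cst.
  exact: cvg_harmonic.
(* The shift to [n.+2] keeps the parameter strictly positive already at n = 0. *)
have u2 : 1 - n.+2%:R^-1 @[n --> \oo] --> (1 : R).
  rewrite -[X in _ --> X]subr0; apply: cvgB; first exact: cvg_cst.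
  by rewrite (cvg_shiftS (@harmonic R)); exact: cvg_harmonic.
have I0 : (0 <= \int[N]_x (x ^+ 2)%:E)%E.
  by apply: integral_ge0 => x _; rewrite lee_fin sqr_ge0.
have inv0 n : 0 < (n.+1%:R : R)^-1 by rewrite invr_gt0 ltr0n.
have inv1 n : (n.+2%:R : R)^-1 < 1 by rewrite invf_lt1 ?ltr0n// ltr1n.
have up' n := up (1 + n.+1%:R^-1) ltac:(by rewrite ltrDl).
have lo' n := lo (1 - n.+2%:R^-1)
  ltac:(by rewrite subr_gt0 inv1 ltrBlDr ltrDl inv0).
move: up' lo' I0; case: (\int[N]_x (x ^+ 2)%:E)%E => [r| |]//.
- move=> up' lo' _; congr EFin; apply/eqP; rewrite eq_le; apply/andP; split.
    rewrite -(cvg_lim _ (lim _ u1))//; apply: limr_ge; first exact: cvgP (lim _ u1).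
    by near=> n; have := up' n; rewrite lee_fin.
  rewrite -(cvg_lim _ (lim _ u2))//; apply: limr_le; first exact: cvgP (lim _ u2).
  by near=> n; have := lo' n; rewrite lee_fin.
- by move=> /(_ 0%N).
Unshelve. all: by end_near. Qed.

End NormalLaw.

(** * The Hilbert space and the operator Q *)

Section Hilbert.
Context (R : realType) (H : completeNormedModType R) (ip : H -> H -> R).
Context (e : nat -> H) (q : nat -> R).
Hypothesis ipP : is_inner_product ip.
Hypothesis onb : is_onb ip e.
Hypothesis q0 : forall k, 0 < q k.
Hypothesis qdec : forall k, q k.+1 <= q k.
Hypothesis qsum : cvgn (series q).
Implicit Types (x y z h : H) (a b c : R).

Lemma ipC x y : ip x y = ip y x. Proof. by case: ipP. Qed.

Lemma ipxx x : ip x x = `|x| ^+ 2. Proof. by case: ipP. Qed.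

Lemma ipDZl a x y z : ip (a *: x + y) z = a * ip x z + ip y z.
Proof. by case: ipP. Qed.

Lemma ipDl x y z : ip (x + y) z = ip x z + ip y z.
Proof. by have := ipDZl 1 x y z; rewrite scale1r mul1r. Qed.

Lemma ip0l z : ip 0 z = 0.
Proof. by have := ipDl 0 0 z; rewrite addr0; lra. Qed.

Lemma ipZl a x z : ip (a *: x) z = a * ip x z.
Proof. by have := ipDZl a x 0 z; rewrite addr0 ip0l addr0. Qed.

Lemma ipNl x z : ip (- x) z = - ip x z.
Proof. by rewrite -scaleN1r ipZl mulN1r. Qed.

Lemma ipBl x y z : ip (x - y) z = ip x z - ip y z.
Proof. by rewrite ipDl ipNl. Qed.

Lemma ipDr x y z : ip x (y + z) = ip x y + ip x z.
Proof. by rewrite ipC ipDl !(ipC x). Qed.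

Lemma ip0r x : ip x 0 = 0. Proof. by rewrite ipC ip0l. Qed.

Lemma ipZr a x z : ip x (a *: z) = a * ip x z.
Proof. by rewrite ipC ipZl (ipC x). Qed.

Lemma ipNr x z : ip x (- z) = - ip x z.
Proof. by rewrite ipC ipNl (ipC x). Qed.

Lemma ipBr x y z : ip x (y - z) = ip x y - ip x z.
Proof. by rewrite ipDr ipNr. Qed.

Lemma ip_suml n (f : nat -> H) z :
  ip (\sum_(i < n) f i) z = \sum_(i < n) ip (f i) z.
Proof.
elim: n => [|n IH]; first by rewrite !big_ord0 ip0l.
by rewrite !big_ord_recr /= ipDl IH.
Qed.

Lemma norm_sqrD x y : `|x + y| ^+ 2 = `|x| ^+ 2 + 2 * ip x y + `|y| ^+ 2.
Proof. by rewrite -!ipxx ipDl !ipDr (ipC y x); ring. Qed.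

Lemma norm_sqrB x y : `|x - y| ^+ 2 = `|x| ^+ 2 - 2 * ip x y + `|y| ^+ 2.
Proof. by rewrite norm_sqrD ipNr normrN; ring. Qed.

Lemma cauchy_schwarz x y : `|ip x y| <= `|x| * `|y|.
Proof.
have [->|y0] := eqVneq y 0; first by rewrite ip0r !normr0 mulr0.
have ny : 0 < `|y| ^+ 2 by rewrite exprn_gt0// normr_gt0.
rewrite -(@ler_pXn2r _ 2)// ?nnegrE// ?mulr_ge0// real_normK ?num_real// exprMn.
have : 0 <= `|x - (ip x y / `|y| ^+ 2) *: y| ^+ 2 by rewrite sqr_ge0.
rewrite norm_sqrB ipZr normrZ exprMn real_normK ?num_real//.
have -> : `|x| ^+ 2 - 2 * (ip x y / `|y| ^+ 2 * ip x y)
    + (ip x y / `|y| ^+ 2) ^+ 2 * `|y| ^+ 2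
    = (`|x| ^+ 2 * `|y| ^+ 2 - ip x y ^+ 2) / `|y| ^+ 2.
  by field; rewrite normr_eq0.
by rewrite pmulr_lge0 ?invr_gt0// subr_ge0.
Qed.

Lemma continuous_ip h : continuous (ip h : H -> R).
Proof.
move=> x; apply/cvgrPdist_le => eps eps0.
have hp : 0 < `|h| + 1 by rewrite ltr_wpDl.
near=> y; rewrite -ipBr (le_trans (cauchy_schwarz _ _))//.
apply: (@le_trans _ _ ((`|h| + 1) * (eps / (`|h| + 1)))).
  apply: ler_pM => //; first by rewrite lerDl.
  near: y; apply: cvgr_dist_le; last by rewrite divr_gt0.
  exact: cvg_id.
by rewrite mulrCA divff ?mulr1// gt_eqF.
Unshelve. all: by end_near. Qed.

Definition partial n x := \sum_(i < n) ip x (e i) *: e i.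

Lemma cvg_partial x : partial n x @[n --> \oo] --> x.
Proof.
case: onb => _ /(_ x); rewrite /series/=.
by under eq_fun do rewrite big_mkord.
Qed.

Lemma ip_onb i j : ip (e i) (e j) = (i == j)%:R.
Proof. by case: onb => -> _; case: eqP. Qed.

Lemma norm_onb i : `|e i| = 1.
Proof.
apply/eqP; rewrite -(@eqrXn2 _ 2)// -ipxx ip_onb eqxx expr1n; exact/eqP.
Qed.

Lemma ip_partial n x y : ip (partial n x) y = \sum_(i < n) ip x (e i) * ip y (e i).
Proof.
rewrite /partial (ip_suml _ (fun i => ip x (e i) *: e i)).
by apply: eq_bigr => i _; rewrite ipZl (ipC (e i)).
Qed.

Lemma ip_partial_onb n x j : ip (partial n x) (e j) = if (j < n)%N then ip x (e j) else 0.
Proof.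
rewrite ip_partial; elim: n => [|n IH]; first by rewrite big_ord0.
rewrite big_ord_recr /= IH ip_onb [in RHS]ltnS [in RHS]leq_eqVlt.
have [->|_] := eqVneq j n; first by rewrite ltnn mulr1 add0r.
by rewrite mulr0 addr0.
Qed.

Lemma norm_partial_sqr n x : `|partial n x| ^+ 2 = \sum_(i < n) ip x (e i) ^+ 2.
Proof.
rewrite -ipxx ip_partial; apply: eq_bigr => i _.
by rewrite ip_partial_onb ltn_ord expr2.
Qed.

Lemma cvg_ip x y : \sum_(i < n) ip x (e i) * ip y (e i) @[n --> \oo] --> ip x y.
Proof.
rewrite (_ : (fun n => _) = (fun n => ip y (partial n x))); last first.
  by apply/funext => n; rewrite ipC ip_partial.
by rewrite ipC; apply: continuous_cvg; [exact: continuous_ip|exact: cvg_partial].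
Qed.

Lemma cvg_norm_sqr x : \sum_(i < n) ip x (e i) ^+ 2 @[n --> \oo] --> `|x| ^+ 2.
Proof. by rewrite -ipxx; exact: cvg_ip. Qed.

Lemma bessel n x : \sum_(i < n) ip x (e i) ^+ 2 <= `|x| ^+ 2.
Proof.
rewrite -(cvg_lim _ (@cvg_norm_sqr x))//; apply: nondecreasing_cvgn_le; last first.
  exact: cvgP (@cvg_norm_sqr x).
apply/nondecreasing_seqP => m.
by rewrite big_ord_recr /= lerDl sqr_ge0.
Qed.

Lemma norm_partial_le n x : `|partial n x| <= `|x|.
Proof. by rewrite -(@ler_pXn2r _ 2)// ?nnegrE// norm_partial_sqr bessel. Qed.

Lemma coord_le k x : `|ip x (e k)| <= `|x|.
Proof. by rewrite (le_trans (cauchy_schwarz _ _))// norm_onb mulr1. Qed.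

Lemma q_le0 k : q k <= q 0%N.
Proof. by elim: k => // k; exact: le_trans. Qed.

Lemma cvg_Qop x : \sum_(k < n) (q k * ip x (e k)) *: e k @[n --> \oo] --> Qop ip e q x.
Proof.
have h : cvgn (series (fun k => (q k * ip x (e k)) *: e k)).
  apply: normed_cvg; apply: (@series_le_cvg _ _ (fun k => `|x| * q k)).
  - by move=> n /=.
  - by move=> n; rewrite mulr_ge0// ltW.
  - move=> n /=; rewrite normrZ norm_onb mulr1 normrM gtr0_norm// mulrC.
    by rewrite ler_pM2r// coord_le.
  - rewrite (_ : series _ = fun n => `|x| * series q n).
      exact: is_cvgMr.
    by apply/funext => n; rewrite /series/= mulr_sumr.
rewrite (_ : (fun n => _) = series (fun k => (q k * ip x (e k)) *: e k)); first exact: h.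
by apply/funext => n; rewrite /series/= big_mkord.
Qed.

Lemma cvg_ip_Qop x y :
  \sum_(k < n) q k * ip x (e k) * ip y (e k) @[n --> \oo] --> ip (Qop ip e q x) y.
Proof.
rewrite ipC (_ : (fun n => _) =
    (fun n => ip y (\sum_(k < n) (q k * ip x (e k)) *: e k))); last first.
  apply/funext => n; rewrite ipC (ip_suml _ (fun k => (q k * ip x (e k)) *: e k)).
  by apply: eq_bigr => k _; rewrite ipZl (ipC (e k)).
by apply: continuous_cvg; [exact: continuous_ip|exact: cvg_Qop].
Qed.

Lemma Qop_onb x k : ip (Qop ip e q x) (e k) = q k * ip x (e k).
Proof.
apply/esym; rewrite -(cvg_lim _ (@cvg_ip_Qop x (e k)))//; apply/esym/cvg_lim => //.
apply: cvg_near_cst; near=> n.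
have kn : (k < n)%N by near: n; exact: nbhs_infty_gt.
rewrite (bigD1 (Ordinal kn))//= ip_onb eqxx mulr1 big1 ?addr0// => i ik.
rewrite ip_onb; have [ki|] := eqVneq k i; last by rewrite mulr0.
by move: ik; rewrite -val_eqE /= ki eqxx.
Unshelve. all: by end_near. Qed.

Lemma ip_ext x y : (forall k, ip x (e k) = ip y (e k)) -> x = y.
Proof.
move=> xy; have /cvg_lim <- // := @cvg_partial x.
have /cvg_lim <- // := @cvg_partial y.
congr (limn _); apply/funext => n; apply: eq_bigr => i _; by rewrite xy.
Qed.

Lemma QopDZ a x y : Qop ip e q (a *: x + y) = a *: Qop ip e q x + Qop ip e q y.
Proof.
by apply: ip_ext => k; rewrite ipDZl !Qop_onb ipDZl; ring.
Qed.

Lemma QopB x y : Qop ip e q (x - y) = Qop ip e q x - Qop ip e q y.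
Proof. by rewrite addrC -scaleN1r QopDZ scaleN1r addrC. Qed.

Lemma norm_Qop x : `|Qop ip e q x| <= q 0%N * `|x|.
Proof.
rewrite -(@ler_pXn2r _ 2)// ?nnegrE// ?mulr_ge0// ?(ltW (q0 0))//.
have h := @cvg_norm_sqr (Qop ip e q x).
rewrite -(cvg_lim _ h)//; apply: limr_le; first exact: cvgP h.
near=> n; rewrite exprMn.
apply: (@le_trans _ _ (q 0%N ^+ 2 * \sum_(i < n) ip x (e i) ^+ 2)); last first.
  by rewrite ler_pM2l ?exprn_gt0// bessel.
rewrite mulr_sumr; apply: ler_sum => i _; rewrite Qop_onb exprMn.
apply: ler_wpM2r; first exact: sqr_ge0.
by rewrite ler_pXn2r ?q_le0// nnegrE ltW.
Unshelve. all: by end_near. Qed.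

Lemma cvg_Qform h : \sum_(k < n) q k * ip h (e k) ^+ 2 @[n --> \oo] --> Qform ip e q h.
Proof.
rewrite /Qform (_ : (fun n => _)
    = (fun n => \sum_(k < n) q k * ip h (e k) * ip h (e k))); last first.
  by apply/funext => n; apply: eq_bigr => k _; rewrite expr2 mulrA.
exact: cvg_ip_Qop.
Qed.

Lemma Qform_ge0 h : 0 <= Qform ip e q h.
Proof.
rewrite -(cvg_lim _ (@cvg_Qform h))//; apply: limr_ge; first exact: cvgP (@cvg_Qform h).
by near=> n; apply: sumr_ge0 => k _; rewrite mulr_ge0 ?sqr_ge0// ltW.
Unshelve. all: by end_near. Qed.

Lemma ip_QopC x y : ip (Qop ip e q x) y = ip (Qop ip e q y) x.
Proof.
rewrite -(cvg_lim _ (@cvg_ip_Qop x y))// -(cvg_lim _ (@cvg_ip_Qop y x))//.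
by congr (limn _); apply/funext => n; apply: eq_bigr => k _; rewrite mulrAC.
Qed.

Lemma QformDZ a b h k : Qform ip e q (a *: h + b *: k)
  = a ^+ 2 * Qform ip e q h + 2 * a * b * ip (Qop ip e q h) k + b ^+ 2 * Qform ip e q k.
Proof.
rewrite /Qform; have -> : b *: k = b *: k + 0 by rewrite addr0.
rewrite QopDZ QopDZ.
have -> : Qop ip e q 0 = 0 by apply: ip_ext => i; rewrite Qop_onb !ip0l mulr0.
rewrite !addr0 !ipDl !ipDr !ipZl !ipZr (ip_QopC k h); ring.
Qed.

End Hilbert.

(** * Measurability in a separable Hilbert space *)

Section BorelHilbert.
Context (R : realType) (H : completeNormedModType R).

Lemma continuous_measurable_BH (f : H -> R) : continuous f ->
  measurable_fun (setT : set (@BH R H)) f.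
Proof.
move=> cf; apply: (measurability _ (RGenOInfty.measurableE R)).
move=> _ [_ [r ->] <-]; rewrite setTI; apply: sub_sigma_algebra.
by apply: open_comp => // x _; exact: cf.
Qed.

Lemma continuous_measurable_BHBH (f : H -> H) : continuous f ->
  measurable_fun (setT : set (@BH R H)) (f : @BH R H -> @BH R H).
Proof.
move=> cf; apply: (measurability _ (erefl : @measurable _ (@BH R H) = <<s @open H >>)).
move=> _ [U oU <-]; rewrite setTI; apply: sub_sigma_algebra.
by apply: open_comp => // x _; exact: cf.
Qed.

Context (ip : H -> H -> R) (e : nat -> H).
Hypothesis ipP : is_inner_product ip.
Hypothesis onb : is_onb ip e.

Definition rat_comb (s : seq rat) : H := \sum_(i < size s) ratr s`_i *: e i.

Lemma rat_comb_dense (x : H) (eps : R) : 0 < eps -> exists s, `|x - rat_comb s| < eps.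
Proof.
move=> eps0.
have [n xn] : exists n, `|x - partial ip e n x| < eps / 2.
  have /cvgrPdist_lt/(_ (eps / 2)) := cvg_partial onb (x:=x).
  by rewrite divr_gt0// => /(_ isT)[n _ /(_ n (leqnn n))]; exists n.
have n1 : 0 < n.+1%:R :> R by rewrite ltr0n.
(* Each of the n coordinates may err by eps / (2 (n + 1)), so that they add up to at most eps / 2; n
   + 1 avoids a division by 0. *)
have rat_ex (i : nat) : exists r : rat, `|ip x (e i) - ratr r| < eps / 2 / n.+1%:R.
  have : 0 < eps / 2 / n.+1%:R :> R by rewrite !divr_gt0.
  move: (_ / n.+1%:R) => dl d0.
  have /rat_in_itvoo[r] : ip x (e i) - dl < ip x (e i) + dl by lra.
  rewrite in_itv/= => /andP[r1 r2]; exists r; rewrite ltr_norml; lra.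
have [g gP] := choice rat_ex.
exists (mkseq g n); rewrite (le_lt_trans (ler_distD (partial ip e n x) _ _))//.
rewrite [ltRHS]splitr ltr_leD//.
rewrite /partial /rat_comb size_mkseq -sumrB (le_trans (ler_norm_sum _ _ _))//.
apply: (@le_trans _ _ (\sum_(i < n) (eps / 2 / n.+1%:R))).
  apply: ler_sum => i _; rewrite -scalerBl normrZ (norm_onb ipP onb) mulr1.
  by rewrite nth_mkseq// ltW.
rewrite sumr_const card_ord -[_ *+ n]mulr_natr -mulrA ler_piMr//.
  by rewrite divr_ge0// ltW.
by rewrite mulrC ler_pdivrMr// mul1r ler_nat.
Qed.

Context d (T : measurableType d).

(** Weak measurability suffices: squared distances to fixed points are limits of sums of squared
    coordinates, and an open set is a countable union of balls with rational centres and radii. This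
    gives measurability of sums without any topology on [T], in particular on product
    sigma-algebras. *)
Lemma measurable_BH_of_ip (f : T -> @BH R H) :
  (forall h, measurable_fun setT (fun t => ip h (f t))) -> measurable_fun setT f.
Proof.
move=> mf.
have md (a : H) : measurable_fun setT (fun t => `|(f t : H) - a| ^+ 2).
  apply: (@measurable_fun_cvg _ _ _ _
    (fun n t => \sum_(i < n) ip ((f t : H) - a) (e i) ^+ 2)) => [n|t _]; last first.
    exact: (cvg_norm_sqr ipP onb (x := (f t : H) - a)).
  apply: measurable_sum => i; apply: measurable_funX.
  under eq_fun do rewrite (ipBl ipP) (ipC ipP).
  exact: measurable_funB.
apply: (measurability _ (erefl : @measurable _ (@BH R H) = <<s @open H >>)).
move=> _ [U oU <-]; rewrite setTI.
pose B (p : seq rat * nat) : set H := [set y | `|y - rat_comb p.1| < p.2.+1%:R^-1].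
have -> : f @^-1` U = \bigcup_(p in [set p | B p `<=` U]) (f @^-1` B p).
  apply/seteqP; split => [t Ut|t [p /= pU]]; last exact: pU.
  have /nbhs_ballP[eps /= eps0 bU] := open_nbhs_nbhs (conj oU Ut).
  have [n nP] : exists n : nat, n.+1%:R^-1 < eps / 2.
    exists (Num.truncn (2 / eps)); rewrite invf_plt ?posrE ?ltr0n ?divr_gt0//.
    by rewrite invf_div truncnS_gt.
  have [s sP] := rat_comb_dense (f t) (eps := n.+1%:R^-1) ltac:(by rewrite invr_gt0 ltr0n).
  exists (s, n); last exact: sP.
  move=> y /= yB; apply: bU; rewrite -ball_normE /=.
  rewrite (le_lt_trans (ler_distD (rat_comb s) _ _))// [ltRHS]splitr ltrD//.
    exact: lt_trans nP.
  by rewrite distrC; exact: lt_trans nP.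
rewrite bigcup_mkcond; apply: countable_bigcupT_measurable; first exact: countableP.
move=> p; case: ifPn => // _.
rewrite (_ : _ @^-1` _ = setT `&` [set t | `|(f t : H) - rat_comb p.1| ^+ 2 < (p.2.+1%:R^-1) ^+ 2]).
  have := md (rat_comb p.1) measurableT `]-oo, (p.2.+1%:R^-1 ^+ 2)[%classic (measurable_itv _).
  by congr measurable; apply/seteqP; split => t /=; rewrite in_itv.
rewrite setTI; apply/seteqP; split => t /=; by rewrite ltr_pXn2r ?nnegrE ?invr_ge0.
Qed.

End BorelHilbert.

(** * Gaussian measures *)

Section TrigonometricTransfer.
Context d1 d2 (T1 : measurableType d1) (T2 : measurableType d2) (R : realType).
Context (P1 : probability T1 R) (P2 : probability T2 R) (phi : T1 -> T2).
Hypothesis mphi : measurable_fun setT phi.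
Variable L : (T2 -> R) -> Prop.
Hypothesis L0 : L (fun=> 0).
Hypothesis LD : forall a b l l', L l -> L l' -> L (fun x => a * l x + b * l' x).
Hypothesis Lm : forall l, L l -> measurable_fun setT l.
Hypothesis Lcos : forall l, L l ->
  Rintegral P2 setT (cos \o l) = Rintegral P1 setT (cos \o l \o phi).
Hypothesis Lsin : forall l, L l ->
  Rintegral P2 setT (sin \o l) = Rintegral P1 setT (sin \o l \o phi).
Hypothesis Lgen : measurable `<=` <<s half_spaces L >>.

Lemma trig_transfer A : measurable A -> P2 A = P1 (phi @^-1` A).
Proof.
pose X : {mfun T1 >-> T2} := HB.pack phi (isMeasurableFun.Build _ _ _ _ _ mphi).
have tr (f : R -> R) l : measurable_fun setT f -> (forall x, `|f x| <= 1) -> L l ->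
    Rintegral (distribution P1 X) setT (f \o l) = Rintegral P1 setT (f \o l \o phi).
  move=> mf f1 Ll.
  have ml : measurable_fun setT (f \o l) by apply: measurableT_comp mf (Lm Ll).
  apply: (@Rint_transfer _ _ _ _ _ phi mphi P1 (distribution P1 X)) => //.
  apply: (@itg_bounded _ _ _ _ _ 1) => [|x]; last exact: f1.
  exact: measurableT_comp.
move=> mA; change (P2 A = distribution P1 X A).
apply: (trig_uniqueness L0 LD Lm _ _ Lgen mA) => l Ll.
- rewrite (Lcos Ll) tr//; [exact: measurable_cosR|exact: cos_max].
- rewrite (Lsin Ll) tr//; [exact: measurable_sinR|exact: sin_max].
Qed.

End TrigonometricTransfer.

Section Functionals.
Context (R : realType) (H : completeNormedModType R) (ip : H -> H -> R) (e : nat -> H).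
Hypothesis ipP : is_inner_product ip.
Hypothesis onb : is_onb ip e.

Lemma measurable_ip (h : H) : measurable_fun setT (fun x : @BH R H => ip h x).
Proof. by apply: continuous_measurable_BH; exact: continuous_ip. Qed.

Definition functional (l : @BH R H -> R) := exists h, l = ip h.

Lemma functional0 : functional (fun=> 0).
Proof. by exists 0; apply/funext => x; rewrite (ip0l ipP). Qed.

Lemma functionalD (a b : R) l l' : functional l -> functional l' ->
  functional (fun x => a * l x + b * l' x).
Proof.
move=> [h ->] [k ->]; exists (a *: h + b *: k); apply/funext => x.
by rewrite (ipDl ipP) !(ipZl ipP).
Qed.

Lemma functional_measurable l : functional l -> measurable_fun setT l.
Proof. by move=> [h ->]; exact: measurable_ip. Qed.

(** By [measurable_BH_of_ip] the identity is measurable from the sigma-algebra of half-spaces to the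
    Borel one. *)
Lemma functional_gen : measurable `<=` <<s half_spaces functional >>.
Proof.
have mid : measurable_fun setT
    (fun x : g_sigma_algebraType (half_spaces functional) => (x : @BH R H)).
  apply: (measurable_BH_of_ip ipP onb) => h.
  apply: (measurability _ (RGenOInfty.measurableE R)).
  move=> _ [_ [r ->] <-]; rewrite setTI; apply: sub_sigma_algebra.
  exists (ip h), r; split; first by exists h.
  by apply/seteqP; split => x /=; rewrite in_itv/= andbT.
by move=> A mA; have := mid measurableT A mA; rewrite setTI.
Qed.

Definition functional2 (l : @BH R H * @BH R H -> R) :=
  exists h k, l = fun z => ip h z.1 + ip k z.2.

Lemma functional2_0 : functional2 (fun=> 0).
Proof. by exists 0, 0; apply/funext => x; rewrite !(ip0l ipP) addr0. Qed.

Lemma functional2D (a b : R) l l' : functional2 l -> functional2 l' ->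
  functional2 (fun x => a * l x + b * l' x).
Proof.
move=> [h [k ->]] [h' [k' ->]]; exists (a *: h + b *: h'), (a *: k + b *: k').
by apply/funext => x; rewrite !(ipDl ipP) !(ipZl ipP); ring.
Qed.

Lemma functional2_measurable l : functional2 l -> measurable_fun setT l.
Proof.
move=> [h [k ->]]; apply: measurable_funD.
  exact: (measurableT_comp (measurable_ip h) measurable_fst).
exact: (measurableT_comp (measurable_ip k) measurable_snd).
Qed.

(** The same argument for both projections: a functional with one component 0 sees only the other
    factor. *)
Lemma functional2_gen : measurable `<=` <<s half_spaces functional2 >>.
Proof.
pose T := g_sigma_algebraType (half_spaces functional2).
have mf h k : measurable_fun setT (fun z : T => ip h z.1 + ip k z.2).
  apply: (measurability _ (RGenOInfty.measurableE R)).
  move=> _ [_ [r ->] <-]; rewrite setTI; apply: sub_sigma_algebra.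
  exists (fun z => ip h z.1 + ip k z.2), r; split; first by exists h, k.
  by apply/seteqP; split => x /=; rewrite in_itv/= andbT.
have m1 : measurable_fun setT (fun z : T => (z.1 : @BH R H)).
  apply: (measurable_BH_of_ip ipP onb) => h; have := mf h 0.
  by under eq_fun do rewrite (ip0l ipP) addr0.
have m2 : measurable_fun setT (fun z : T => (z.2 : @BH R H)).
  apply: (measurable_BH_of_ip ipP onb) => h; have := mf 0 h.
  by under eq_fun do rewrite (ip0l ipP) add0r.
have mid := measurable_fun_pair m1 m2.
move=> A mA; have := mid measurableT A mA; rewrite setTI.
by congr measurable; apply/seteqP; split => -[].
Qed.

Context d (T : measurableType d).
Implicit Types f g : T -> @BH R H.

Lemma measurable_BH_D f g : measurable_fun setT f -> measurable_fun setT g ->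
  measurable_fun setT (fun t => (f t : H) + (g t : H) : @BH R H).
Proof.
move=> mf mg; apply: (measurable_BH_of_ip ipP onb) => h.
under eq_fun do rewrite (ipDr ipP).
by apply: measurable_funD; apply: (measurableT_comp (measurable_ip h)).
Qed.

Lemma measurable_BH_Z (a : R) f : measurable_fun setT f ->
  measurable_fun setT (fun t => a *: (f t : H) : @BH R H).
Proof.
move=> mf; apply: (measurable_BH_of_ip ipP onb) => h.
under eq_fun do rewrite (ipZr ipP).
by apply: measurable_funM => //; apply: (measurableT_comp (measurable_ip h)).
Qed.

End Functionals.

Section GaussianLaw.
Context (R : realType) (H : completeNormedModType R) (ip : H -> H -> R).
Context (e : nat -> H) (q : nat -> R).
Hypothesis ipP : is_inner_product ip.
Hypothesis onb : is_onb ip e.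
Hypothesis q0 : forall k, 0 < q k.
Hypothesis qsum : cvgn (series q).
Context (c : R) (g : probability (@BH R H) R).
Hypothesis c0 : 0 <= c.
Hypothesis gP : gaussian_cov ip e q c g.
Implicit Types h k : H.

Let v h := c * Qform ip e q h.

Let v0 h : 0 <= v h.
Proof. by rewrite mulr_ge0// (Qform_ge0 ipP onb q0 qsum). Qed.

Lemma ge0_integral_gaussian h (f : R -> \bar R) : measurable_fun setT f ->
  (forall x, 0 <= f x)%E -> (\int[g]_x f (ip h x))%E
  = if v h == 0 then f 0 else (\int[normal_prob 0 (Num.sqrt (v h))]_x f x)%E.
Proof.
move=> mf f0.
have mh : measurable_fun setT (ip h : @BH R H -> measurableTypeR R).
  exact: measurable_ip.
have -> : (\int[g]_x f (ip h x))%E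
    = (\int[pushforward g (ip h : @BH R H -> measurableTypeR R)]_x f x)%E.
  exact/esym/(@ge0_integral_pushforward _ _ _ _ R _ mh g setT f measurableT mf
    (fun y _ => f0 y)).
have vE A : measurable A -> g [set x : BH | A (ip h x)] =
    (if v h == 0 then \d_(0 : R) A else normal_prob 0 (Num.sqrt (v h)) A).
  by move=> mA; rewrite gP.
case: ifPn => vh.
  rewrite (eq_measure_integral (\d_(0 : measurableTypeR R))); last first.
    by move=> A mA _; have := vE A mA; rewrite vh.
  by rewrite integral_dirac// diracT mul1e.
apply: eq_measure_integral => A mA _; have := vE A mA.
by rewrite (negbTE vh).
Qed.

Lemma gaussian_expR h : (\int[g]_x (expR (ip h x))%:E = (expR (v h / 2))%:E)%E.
Proof.
rewrite (@ge0_integral_gaussian h (fun u => (expR u)%:E)); last 2 first.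
- by apply/measurable_EFinP; exact: measurable_expR.
- by move=> u; rewrite lee_fin expR_ge0.
have [->|vh] := eqVneq (v h) 0; first by rewrite mul0r.
have s0 : 0 < Num.sqrt (v h) by rewrite sqrtr_gt0 lt_neqAle eq_sym vh v0.
have := integral_normal_expR 1 s0.
rewrite sqr_sqrtr// expr1n mulr1 => <-.
by apply: eq_integral => u _; rewrite mul1r.
Qed.

Lemma gaussian_sqr h : (\int[g]_x (ip h x ^+ 2)%:E = (v h)%:E)%E.
Proof.
rewrite (@ge0_integral_gaussian h (fun u => (u ^+ 2)%:E)); last 2 first.
- by apply/measurable_EFinP; exact: exprn_measurable.
- by move=> u; rewrite lee_fin sqr_ge0.
have [->|vh] := eqVneq (v h) 0; first by rewrite expr0n.
have s0 : 0 < Num.sqrt (v h) by rewrite sqrtr_gt0 lt_neqAle eq_sym vh v0.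
by rewrite normal_second_moment// sqr_sqrtr.
Qed.

Lemma gaussian_itg_sqr h : itg g (fun x => ip h x ^+ 2).
Proof.
apply/integrableP; split.
  by apply/measurable_EFinP; apply: measurable_funX; exact: measurable_ip.
rewrite (_ : integral _ _ _ = (v h)%:E) ?ltry// -gaussian_sqr.
by apply: eq_integral => x _ /=; rewrite ger0_norm// sqr_ge0.
Qed.

Lemma gaussian_Rint_sqr h : Rintegral g setT (fun x => ip h x ^+ 2) = v h.
Proof. by rewrite /Rintegral gaussian_sqr. Qed.

Lemma itg_cos_ip h : itg g (fun x => cos (ip h x)).
Proof.
apply: (@itg_bounded _ _ _ _ _ 1) => [|x]; last exact: cos_max.
by apply: measurableT_comp (@measurable_cosR R) (measurable_ip ipP h).
Qed.

Lemma itg_sin_ip h : itg g (fun x => sin (ip h x)).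
Proof.
apply: (@itg_bounded _ _ _ _ _ 1) => [|x]; last exact: sin_max.
by apply: measurableT_comp (@measurable_sinR R) (measurable_ip ipP h).
Qed.

Lemma gaussian_Rint_bounded h (f : R -> R) : measurable_fun setT f ->
  (forall x, `|f x| <= 1) -> Rintegral g setT (fun x => f (ip h x))
  = if v h == 0 then f 0 else Rintegral (normal_prob 0 (Num.sqrt (v h))) setT f.
Proof.
move=> mf f1.
have m1 : measurable_fun setT (fun u : R => (1 + f u)%:E).
  by apply/measurable_EFinP; exact: measurable_funD.
have p1 u : (0 <= (1 + f u)%:E)%E.
  by rewrite lee_fin; have := f1 u; rewrite ler_norml; lra.
have fg : itg g (fun x => f (ip h x)).
  apply: (@itg_bounded _ _ _ _ _ 1) => [|x]; last exact: f1.
  by apply: measurableT_comp mf (measurable_ip ipP h).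
have := ge0_integral_gaussian h m1 p1; case: ifP => vh E.
  have : Rintegral g setT (fun x => 1 + f (ip h x)) = 1 + f 0 by rewrite /Rintegral E.
  by rewrite (RintD (itg_cst g 1) fg) Rint_cst => /addrI.
have : Rintegral g setT (fun x => 1 + f (ip h x))
  = Rintegral (normal_prob 0 (Num.sqrt (v h))) setT (fun u => 1 + f u).
  by rewrite /Rintegral E.
rewrite (RintD (itg_cst g 1) fg) Rint_cst.
have fN : itg (normal_prob 0 (Num.sqrt (v h))) f by apply: (@itg_bounded _ _ _ _ _ 1).
rewrite (RintD (itg_cst (normal_prob 0 (Num.sqrt (v h))) 1) fN).
by rewrite (Rint_cst (normal_prob 0 (Num.sqrt (v h)))) => /addrI.
Qed.

Lemma gaussian_cos h : Rintegral g setT (fun x => cos (ip h x)) = normal_cf (v h).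
Proof.
rewrite gaussian_Rint_bounded; [|exact: measurable_cosR|exact: cos_max].
by rewrite /normal_cf cos0.
Qed.

Lemma gaussian_sin h : Rintegral g setT (fun x => sin (ip h x)) = 0.
Proof.
rewrite gaussian_Rint_bounded; [|exact: measurable_sinR|exact: sin_max].
have [_|vh] := eqVneq (v h) 0; first by rewrite sin0.
by apply: Rint_normal_sin; rewrite sqrtr_gt0 lt_neqAle eq_sym vh v0.
Qed.

Lemma gaussian2_cos_sin h k :
  Rintegral (g \x g)%E setT (fun z => cos (ip h z.1 + ip k z.2)) = normal_cf (v h + v k) /\
  Rintegral (g \x g)%E setT (fun z => sin (ip h z.1 + ip k z.2)) = 0.
Proof.
have [[[ch ck] sh] sk] := (itg_cos_ip h, itg_cos_ip k, itg_sin_ip h, itg_sin_ip k).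
split.
  transitivity (Rintegral (g \x g)%E setT (fun z =>
      cos (ip h z.1) * cos (ip k z.2) - sin (ip h z.1) * sin (ip k z.2))).
    by apply: Rint_eq => z; rewrite cosD.
  rewrite (RintB (itg_mul ch ck) (itg_mul sh sk)) (Rint_mul ch ck) (Rint_mul sh sk).
  by rewrite !gaussian_cos gaussian_sin mul0r subr0 normal_cfD.
transitivity (Rintegral (g \x g)%E setT (fun z =>
    sin (ip h z.1) * cos (ip k z.2) + cos (ip h z.1) * sin (ip k z.2))).
  by apply: Rint_eq => z; rewrite sinD.
rewrite (RintD (itg_mul sh ck) (itg_mul ch sk)) (Rint_mul sh ck) (Rint_mul ch sk).
by rewrite !gaussian_sin mul0r mulr0 addr0.
Qed.

(** For a^2 + b^2 = 1 this orthogonal map is a reflection rather than a proper rotation. Being its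
    own inverse, it exchanges the point [z.1] with its image [a *: z.1 + b *: z.2], which is the
    symmetry behind all integrations by parts below. *)
Definition rotation (a b : R) (z : @BH R H * @BH R H) : @BH R H * @BH R H :=
  (a *: (z.1 : H) + b *: (z.2 : H), b *: (z.1 : H) - a *: (z.2 : H)).

Lemma measurable_rotation a b : measurable_fun setT (rotation a b).
Proof.
apply: measurable_fun_pair.
  apply: (measurable_BH_D ipP onb); apply: (measurable_BH_Z ipP onb);
    [exact: measurable_fst|exact: measurable_snd].
under eq_fun do rewrite -scaleNr.
apply: (measurable_BH_D ipP onb); apply: (measurable_BH_Z ipP onb);
  [exact: measurable_fst|exact: measurable_snd].
Qed.

(** The characteristic function of the product depends on (h, k) only through [v h + v k]. The
    adjoint map sends (h, k) to (a h + b k, b h - a k), and there the cross terms of the quadratic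
    form cancel. *)
Lemma rotation_invariant a b A : a ^+ 2 + b ^+ 2 = 1 -> measurable A ->
  (g \x g)%E A = (g \x g)%E (rotation a b @^-1` A).
Proof.
move=> ab mA.
apply: (@trig_transfer _ _ _ _ R (g \x g)%E (g \x g)%E (rotation a b)
  (measurable_rotation a b) (functional2 ip) (functional2_0 ipP)
  (@functional2D _ _ _ ipP) (@functional2_measurable _ _ _ ipP) _ _
  (@functional2_gen _ _ _ _ ipP onb) A mA).
all: move=> l [h [k ->]].
all: have E z : ip h (rotation a b z).1 + ip k (rotation a b z).2
  = ip (a *: h + b *: k) z.1 + ip (b *: h + (- a) *: k) z.2
  by rewrite /rotation /= !(ipDr ipP, ipDl ipP, ipNr ipP, ipZr ipP, ipZl ipP); ring.
- transitivity (normal_cf (v h + v k)); first by have [] := gaussian2_cos_sin h k.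
  transitivity (Rintegral (g \x g)%E setT (fun z : @BH R H * @BH R H =>
      cos (ip (a *: h + b *: k) z.1 + ip (b *: h + (- a) *: k) z.2))); last first.
    by apply: Rint_eq => z; rewrite /= E.
  have [-> _] := gaussian2_cos_sin (a *: h + b *: k) (b *: h + (- a) *: k).
  congr normal_cf; rewrite /v !(QformDZ ipP onb q0 qsum).
  have -> : b ^+ 2 = 1 - a ^+ 2 by rewrite -ab addrAC subrr add0r.
  by ring.
- transitivity (0 : R); first by have [] := gaussian2_cos_sin h k.
  transitivity (Rintegral (g \x g)%E setT (fun z : @BH R H * @BH R H =>
      sin (ip (a *: h + b *: k) z.1 + ip (b *: h + (- a) *: k) z.2))); last first.
    by apply: Rint_eq => z; rewrite /= E.
  by have [_ ->] := gaussian2_cos_sin (a *: h + b *: k) (b *: h + (- a) *: k).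
Qed.

End GaussianLaw.

Section GaussianScaling.
Context (R : realType) (H : completeNormedModType R) (ip : H -> H -> R).
Context (e : nat -> H) (q : nat -> R).
Hypothesis ipP : is_inner_product ip.
Hypothesis onb : is_onb ip e.
Hypothesis q0 : forall k, 0 < q k.
Hypothesis qsum : cvgn (series q).

Lemma gaussian_scaling (t c : R) (g g' : probability (@BH R H) R) A :
  0 <= c -> gaussian_cov ip e q c g -> gaussian_cov ip e q (t ^+ 2 * c) g' ->
  measurable A -> g' A = g ((fun x : @BH R H => t *: (x : H) : @BH R H) @^-1` A).
Proof.
move=> c0 gP g'P mA.
have c'0 : 0 <= t ^+ 2 * c by rewrite mulr_ge0 ?sqr_ge0.
have mt : measurable_fun setT (fun x : @BH R H => t *: (x : H) : @BH R H).
  by apply: (measurable_BH_Z ipP onb).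
apply: (@trig_transfer _ _ _ _ R g g' _ mt (functional ip) (functional0 ipP)
  (@functionalD _ _ _ ipP) (@functional_measurable _ _ _ ipP) _ _
  (@functional_gen _ _ _ _ ipP onb) A mA).
all: move=> l [h ->].
all: have E x : ip h (t *: x) = ip (t *: h) x by rewrite (ipZr ipP) (ipZl ipP).
- transitivity (normal_cf (t ^+ 2 * c * Qform ip e q h)).
    exact: (gaussian_cos ipP g'P).
  transitivity (Rintegral g setT (fun x : @BH R H => cos (ip (t *: h) x))); last first.
    by apply: Rint_eq => x; rewrite /= E.
  rewrite (gaussian_cos ipP gP); congr normal_cf.
  have := QformDZ ipP onb q0 qsum t 0 h 0.
  by rewrite scale0r addr0 => ->; ring.
- transitivity (0 : R); first exact: (gaussian_sin ipP onb q0 qsum c'0 g'P).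
  transitivity (Rintegral g setT (fun x : @BH R H => sin (ip (t *: h) x))); last first.
    by apply: Rint_eq => x; rewrite /= E.
  by rewrite (gaussian_sin ipP onb q0 qsum c0 gP).
Qed.

End GaussianScaling.

(** * Exponential square moments of the Gaussian measure *)

Section GaussianExponentialMoment.
Context (R : realType) (H : completeNormedModType R) (ip : H -> H -> R).
Context (e : nat -> H) (q : nat -> R).
Hypothesis ipP : is_inner_product ip.
Hypothesis onb : is_onb ip e.
Hypothesis q0 : forall k, 0 < q k.
Hypothesis qdec : forall k, q k.+1 <= q k.
Hypothesis qsum : cvgn (series q).
Context (nu : probability (@BH R H) R).
Hypothesis nuP : gaussian_cov ip e q (2^-1) nu.
Context (A : R).
Hypothesis A0 : 0 < A.
Hypothesis A1 : A * q 0%N < 1.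

(** The mean of exp (A x_k^2) for a coordinate x_k of variance q_k / 2, and also the ratio of
    deviations to be used in [integral_normal_expR_sqr]. *)
Let kap k := (Num.sqrt (1 - A * q k))^-1.

Let Aq k : 0 < A * q k < 1.
Proof.
rewrite mulr_gt0//= (le_lt_trans _ A1)// ler_pM2l//.
exact: q_le0.
Qed.

Let kap_gt0 k : 0 < kap k.
Proof. by rewrite invr_gt0 sqrtr_gt0 subr_gt0; case/andP: (Aq k). Qed.

Let kap_sqr k : kap k ^- 2 = 1 - A * q k.
Proof.
by rewrite exprVn invrK sqr_sqrtr// subr_ge0 ltW//; case/andP: (Aq k).
Qed.

Let sq n (x : H) := \sum_(k < n) ip x (e k) ^+ 2.

Let measurable_sq n : measurable_fun setT (sq n : @BH R H -> R).
Proof.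
apply: measurable_sum => k; apply: measurable_funX.
by under eq_fun do rewrite (ipC ipP); exact: measurable_ip.
Qed.

(* Each factor [exp (A x_n^2)] is a Gaussian average of [exp (t x_n)], which
   shifts [h] by a multiple of [e n] (Hubbard-Stratonovich). *)
Let exp_moment_partial n h : (forall k, (k < n)%N -> ip h (e k) = 0) ->
  (\int[nu]_x (expR (ip h x + A * sq n x))%:E
   = ((\prod_(k < n) kap k) * expR (Qform ip e q h / 4))%:E)%E.
Proof.
elim: n h => [|n IH] h hk.
  rewrite big_ord0 mul1r.
  have c0 : 0 <= 2^-1 :> R by rewrite invr_ge0.
  have := gaussian_expR ipP onb q0 qsum c0 nuP h.
  have -> : 2^-1 * Qform ip e q h / 2 = Qform ip e q h / 4 by field.
  move=> <-; apply: eq_integral => x _.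
  by rewrite /sq big_ord0 mulr0 addr0.
set N := normal_prob (0 : R) 1.
(* Chosen with t^2 / 2 = A, so that the mean of exp (t x_n u) over a standard normal u is exp (A
   x_n^2). *)
pose t := Num.sqrt (2 * A).
have t2 : t ^+ 2 = 2 * A by rewrite sqr_sqrtr// mulr_ge0// ltW.
pose G (z : @BH R H * measurableTypeR R) :=
  (expR (ip (h + (z.2 * t) *: e n) z.1 + A * sq n z.1))%:E.
have GE x u : ip (h + (u * t) *: e n) x = ip h x + t * ip x (e n) * u.
  by rewrite (ipDl ipP) (ipZl ipP) (ipC ipP (e n)); ring.
have mG : measurable_fun setT G.
  apply/measurable_EFinP; apply: measurableT_comp; first exact: measurable_expR.
  under eq_fun do rewrite GE.
  apply: measurable_funD; last first.
    apply: measurable_funM => //.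
    exact: (measurableT_comp (measurable_sq n) measurable_fst).
  apply: measurable_funD.
    exact: (measurableT_comp (measurable_ip ipP h) measurable_fst).
  apply: measurable_funM; last exact: measurable_snd.
  apply: measurable_funM => //; under eq_fun do rewrite (ipC ipP).
  exact: (measurableT_comp (measurable_ip ipP (e n)) measurable_fst).
have G0 z : (0 <= G z)%E by rewrite lee_fin expR_ge0.
have step1 : (\int[nu]_x (expR (ip h x + A * sq n.+1 x))%:E
    = \int[nu]_x \int[N]_u G (x, u))%E.
  apply: eq_integral => x _.
  have mu_ : measurable_fun [set: R] (fun u : R => (expR (t * ip x (e n) * u))%:E).
    by apply/measurable_EFinP; apply: measurableT_comp => //; exact: measurable_funM.
  have p0 (u : R) : setT u -> (0 <= (expR (t * ip x (e n) * u))%:E)%E.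
    by move=> _; rewrite lee_fin expR_ge0.
  have k0 : (0 <= (expR (ip h x + A * sq n x))%:E)%E by rewrite lee_fin expR_ge0.
  have H1 := ge0_integralZl N measurableT mu_ p0 k0.
  have H2 := integral_normal_expR (t * ip x (e n)) (@ltr01 R).
  transitivity ((expR (ip h x + A * sq n x))%:E
     * \int[N]_u (expR (t * ip x (e n) * u))%:E)%E.
    rewrite H2 -EFinM -expRD; congr (expR _)%:E.
    by rewrite /sq big_ord_recr/= expr1n mul1r exprMn t2; field.
  rewrite -H1; apply: eq_integral => u _.
  by rewrite /G /= GE -EFinM -expRD; congr (expR _)%:E; ring.
have step2 : (\int[nu]_x \int[N]_u G (x, u) = \int[N]_u \int[nu]_x G (x, u))%E.
  exact: (@fubini_tonelli _ _ _ _ R nu N G mG G0).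
rewrite step1 step2.
(* The induction hypothesis applies to [h + (u * t) *: e n], still orthogonal to the first n basis
   vectors. What remains of u is exp (A q_n u^2 / 2), whose mean is [kap n]. *)
have inner (u : R) : (\int[nu]_x G (x, u))%E = ((\prod_(k < n) kap k)
    * expR (Qform ip e q h / 4) * expR ((1 - kap n ^- 2) / (1 ^+ 2 *+ 2) * u ^+ 2))%:E.
  rewrite /G /= IH => [|k kn]; last first.
    rewrite (ipDl ipP) (ipZl ipP) hk ?(ltnW kn)//; last exact: ltnW.
    by rewrite (ip_onb onb) gtn_eqF// mulr0 addr0.
  rewrite -mulrA -expRD; congr (_ * expR _)%:E.
  have := QformDZ ipP onb q0 qsum 1 (u * t) h (e n).
  rewrite scale1r => ->; rewrite /Qform !(Qop_onb ipP onb q0 qsum) (hk n)//.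
  by rewrite (ip_onb onb) eqxx kap_sqr expr1n exprMn t2 mulr1n; field.
have -> : (\int[N]_u \int[nu]_x G (x, u))%E = (\int[N]_u
   (((\prod_(k < n) kap k) * expR (Qform ip e q h / 4))%:E
    * (expR ((1 - kap n ^- 2) / (1 ^+ 2 *+ 2) * u ^+ 2))%:E))%E.
  by apply: eq_integral => u _; rewrite inner EFinM.
have mE : measurable_fun [set: R]
    (fun u : R => (expR ((1 - kap n ^- 2) / (1 ^+ 2 *+ 2) * u ^+ 2))%:E).
  apply/measurable_EFinP; apply: measurableT_comp => //.
  by apply: measurable_funM => //; exact: exprn_measurable.
have E0 (u : R) : setT u -> (0 <= (expR ((1 - kap n ^- 2) / (1 ^+ 2 *+ 2) * u ^+ 2))%:E)%E.
  by move=> _; rewrite lee_fin expR_ge0.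
have C0 : (0 <= ((\prod_(k < n) kap k) * expR (Qform ip e q h / 4))%:E)%E.
  rewrite lee_fin mulr_ge0 ?expR_ge0//.
  by apply: prodr_ge0 => k _; rewrite ltW.
rewrite (ge0_integralZl N measurableT mE E0 C0).
rewrite (integral_normal_expR_sqr (@ltr01 R) (kap_gt0 n)) -EFinM.
by rewrite big_ord_recr /= mulrAC.
Qed.

(** From 1 <= kap k <= (kap k)^2 = 1 + A q_k / (1 - A q_k). An exponent proportional to q_k bounds
    all finite products at once, because the q_k are summable. *)
Let kap_le k : kap k <= expR (A / (1 - A * q 0%N) * q k).
Proof.
have /andP[a0 a1] := Aq k.
have d0 : 0 < 1 - A * q 0%N by rewrite subr_gt0.
have d1 : 0 < 1 - A * q k by rewrite subr_gt0.
have le1 : 1 <= kap k.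
  rewrite /kap invf_ge1 ?sqrtr_gt0// -[leRHS]sqrtr1 ler_wsqrtr//.
  by rewrite lerBlDr lerDl ltW.
apply: (@le_trans _ _ (kap k ^+ 2)); first by rewrite expr2 ler_peMr// ltW.
rewrite -[kap k ^+ 2]invrK kap_sqr.
apply: (@le_trans _ _ (1 + A * q k / (1 - A * q k))).
  by rewrite le_eqVlt; apply/orP; left; apply/eqP; field; rewrite gt_eqF.
apply: (le_trans (expR_ge1Dx _)); rewrite ler_expR [leRHS]mulrAC.
rewrite ler_pM2l// lef_pV2 ?posrE//.
by rewrite lerD2l lerN2 ler_pM2l// q_le0.
Qed.

Lemma gaussian_exp_moment : itg nu (fun x => expR (A * `|x : H| ^+ 2)).
Proof.
have mn : measurable_fun setT (fun x : @BH R H => expR (A * `|x : H| ^+ 2)).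
  apply: measurableT_comp; first exact: measurable_expR.
  apply: measurable_funM => //; apply: measurable_funX.
  by apply: continuous_measurable_BH; exact: norm_continuous.
apply/integrableP; split; first exact/measurable_EFinP.
pose f n (x : @BH R H) := (expR (A * sq n x))%:E.
have mf n : measurable_fun setT (f n).
  apply/measurable_EFinP; apply: measurableT_comp; first exact: measurable_expR.
  by apply: measurable_funM => //; exact: measurable_sq.
have f0 n x : setT x -> (0 <= f n x)%E by move=> _; rewrite lee_fin expR_ge0.
have fnd x : setT x -> nondecreasing_seq (f ^~ x).
  move=> _; apply/nondecreasing_seqP => n.
  by rewrite lee_fin ler_expR ler_pM2l// /sq big_ord_recr /= lerDl sqr_ge0.
have -> : (\int[nu]_x `|(EFin \o (fun x : H => expR (A * `|x| ^+ 2))) x|)%E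
    = (\int[nu]_x limn (f ^~ x))%E.
  apply: eq_integral => x _ /=; rewrite ger0_norm ?expR_ge0//.
  apply/esym/cvg_lim => //; apply: cvg_EFin; first by near=> n.
  apply: continuous_cvg; first exact: continuous_expR.
  apply: cvgM; first exact: cvg_cst.
  exact: (cvg_norm_sqr ipP onb (x := x)).
rewrite (monotone_convergence nu measurableT mf f0 fnd).
set K := A / (1 - A * q 0%N).
have K0 : 0 <= K by apply: divr_ge0; rewrite ?subr_ge0 ltW.
have qs n : \sum_(k < n) q k <= limn (series q).
  have -> : \sum_(k < n) q k = series q n by rewrite /series /= big_mkord.
  apply: nondecreasing_cvgn_le => //; apply/nondecreasing_seqP => m.
  by rewrite /series /= !big_mkord big_ord_recr /= lerDl ltW.
apply: (@le_lt_trans _ _ (expR (K * limn (series q)))%:E); last by rewrite ltry.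
apply: lime_le.
  apply: ereal_nondecreasing_is_cvgn => m n le_mn; apply: ge0_le_integral => //.
  - by move=> x _; exact: f0.
  - by move=> x _; apply: fnd le_mn.
near=> n; have -> : (\int[nu]_x f n x)%E = (\prod_(k < n) kap k)%:E.
  have h0 k : (k < n)%N -> ip 0 (e k) = 0 by rewrite (ip0l ipP).
  have := exp_moment_partial h0.
  have -> : Qform ip e q 0 = 0 by rewrite /Qform (ip0r ipP).
  rewrite mul0r expR0 mulr1 => <-; apply: eq_integral => x _.
  by rewrite /f (ip0l ipP) add0r.
rewrite lee_fin; apply: (@le_trans _ _ (expR (K * \sum_(k < n) q k))); last first.
  by rewrite ler_expR ler_wpM2l.
rewrite mulr_sumr expR_sum; apply: ler_prod => k _.
by rewrite kap_le (ltW (kap_gt0 _)).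
Unshelve. all: by end_near. Qed.

End GaussianExponentialMoment.

(** * Frechet differentials *)

Lemma lipschitz_continuous (R : realType) (H W : normedModType R) (f : H -> W) (a : R) :
  0 <= a -> (forall x y, `|f y - f x| <= a * `|y - x|) -> continuous f.
Proof.
move=> a0 lip x; apply/cvgrPdist_le => eps eps0.
have a1 : 0 < a + 1 by rewrite ltr_wpDl.
near=> y; rewrite distrC (le_trans (lip _ _))//.
apply: (@le_trans _ _ ((a + 1) * (eps / (a + 1)))).
  apply: ler_pM => //; first by rewrite lerDl.
  rewrite distrC; near: y; apply: cvgr_dist_le; last by rewrite divr_gt0.
  exact: cvg_id.
by rewrite mulrCA divff ?mulr1// gt_eqF.
Unshelve. all: by end_near. Qed.

Section MeanValue.
Variable R : realType.

Lemma mean_value_eps (g dg : R -> R) :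
  (forall t (eps : R), 0 < eps -> exists2 del : R, 0 < del & forall s, `|s - t| < del ->
     `|g s - g t - dg t * (s - t)| <= eps * `|s - t|) ->
  exists2 t, 0 < t < 1 & g 1 - g 0 = dg t.
Proof.
move=> gP.
have dP t : is_derive t (1 : R) g (dg t).
  have lim : h^-1 *: ((g \o shift t) (h *: (1 : R)) - g t) @[h --> 0^'] --> dg t.
    apply/cvgrPdist_le => eps eps0; have [del del0 delP] := gP t eps eps0.
    near=> h; have h0 : h != 0 by near: h; exact: nbhs_dnbhs_neq.
    have hd : `|h| < del by near: h; exact: dnbhs0_lt.
    have := delP (h + t); rewrite addrK => /(_ hd) => b.
    rewrite /= [h *: 1]mulr1 distrC.
    have -> : h^-1 *: (g (h + t) - g t) - dg t = h^-1 * (g (h + t) - g t - dg t * h).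
      by rewrite /GRing.scale /=; field.
    rewrite normrM normfV mulrC ler_pdivrMr ?normr_gt0//.
  by apply: DeriveDef; [exact: cvgP lim|exact: cvg_lim lim].
have cg : {within `[0, 1], continuous g}.
  apply: continuous_subspaceT => t; apply: differentiable_continuous.
  by apply/derivable1_diffP; case: (dP t).
have [c] := MVT ltr01 (fun t _ => dP t) cg.
by rewrite in_itv/= subr0 mulr1 => c01 ->; exists c.
Unshelve. all: by end_near. Qed.

Context (H : normedModType R).

(** The candidate derivative [l] is a bare function, so that ['d f z] and [D2 z] with one argument
    fixed are treated alike. *)
Definition frechet (W : normedModType R) (f : H -> W) (x : H) (l : H -> W) :=
  forall eps : R, 0 < eps -> exists2 del : R, 0 < del & forall y, `|y - x| < del ->
    `|f y - f x - l (y - x)| <= eps * `|y - x|.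

Lemma frechet_differentiable (W : normedModType R) (f : H -> W) x :
  differentiable f x -> frechet f x ('d f x).
Proof.
move=> /diff_locally/eqaddoP fo eps eps0.
have /nbhs_ballP[del /= del0 delP] := fo eps eps0.
exists del => // y yx; have := delP (y - x); rewrite -ball_normE /= sub0r normrN.
by move=> /(_ yx); rewrite !fctE /= subrK opprD addrA.
Qed.

Lemma mean_value_frechet (f : H -> R) (l : H -> H -> R) x y :
  (forall z, frechet f z (l z)) -> (forall z a u, l z (a *: u) = a * l z u) ->
  exists2 t : R, 0 < t < 1 & f y - f x = l (x + t *: (y - x)) (y - x).
Proof.
move=> fl lZ; set k := y - x.
have [|t t01 tE] := @mean_value_eps (fun t => f (x + t *: k)) (fun t => l (x + t *: k) k).
  move=> t eps eps0.
  have k1 : 0 < `|k| + 1 by rewrite ltr_wpDl.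
  have [del del0 delP] := fl (x + t *: k) (eps / (`|k| + 1)) (divr_gt0 eps0 k1).
  exists (del / (`|k| + 1)); first by rewrite divr_gt0.
  move=> s st; have E : x + s *: k - (x + t *: k) = (s - t) *: k.
    by rewrite opprD addrACA subrr add0r scalerBl.
  have nE : `|(s - t) *: k| <= `|s - t| * (`|k| + 1).
    by rewrite normrZ ler_wpM2l// lerDl.
  have := delP (x + s *: k); rewrite E lZ (mulrC (s - t)).
  rewrite (le_lt_trans nE) -?ltr_pdivlMr// => /(_ isT) h.
  apply: (le_trans h); apply: (le_trans (ler_wpM2l _ nE)).
    by rewrite divr_ge0// ltW.
  by rewrite mulrCA divfK ?gt_eqF// mulrC.
exists t => //; rewrite -tE scale1r scale0r addr0; congr (f _ - _).
by rewrite /k addrCA subrr addr0.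
Qed.

Context (W : normedModType R) (ipW : W -> W -> R).
Hypothesis ipWDZ : forall a x y z, ipW (a *: x + y) z = a * ipW x z + ipW y z.
Hypothesis ipWxx : forall x, ipW x x = `|x| ^+ 2.
Hypothesis ipWle : forall x y, `|ipW x y| <= `|x| * `|y|.

Let ipWB x y z : ipW (x - y) z = ipW x z - ipW y z.
Proof. by rewrite addrC -scaleN1r ipWDZ mulN1r addrC. Qed.

Let ipW0 z : ipW 0 z = 0.
Proof. by rewrite -(subrr 0) ipWB subrr. Qed.

Let ipWZ a x z : ipW (a *: x) z = a * ipW x z.
Proof. by have := ipWDZ a x 0 z; rewrite addr0 ipW0 addr0. Qed.

(** The scalar mean value theorem is applied to the pairing of f with r = f y - f x - v, which gives
    |r|^2 <= C |r|. The choice v = 0 yields Lipschitz bounds, v = 'd f x (y - x) yields Taylor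
    bounds; W is R or H. *)
Lemma mean_value_inequality (f : H -> W) (l : H -> H -> W) x y v (C : R) :
  (forall z, frechet f z (l z)) -> (forall z a u, l z (a *: u) = a *: l z u) ->
  (forall t : R, 0 < t < 1 -> `|l (x + t *: (y - x)) (y - x) - v| <= C) ->
  `|f y - f x - v| <= C.
Proof.
move=> fl lZ lC; set r := f y - f x - v.
have [r0|r0] := eqVneq r 0.
  rewrite r0 normr0 (le_trans _ (lC (2^-1) _))//.
  by apply/andP; split; lra.
have r1 : 0 < `|r| by rewrite normr_gt0.
have [|z a u|t t01 tE] := @mean_value_frechet (fun z => ipW (f z) r)
    (fun z k => ipW (l z k) r) x y.
- move=> z eps eps0; have [del del0 delP] := fl z (eps / `|r|) (divr_gt0 eps0 r1).
  exists del => // y' /delP h; rewrite -!ipWB (le_trans (ipWle _ _))//.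
  by rewrite (le_trans (ler_wpM2r (ltW r1) h))// mulrAC divfK ?gt_eqF.
- by rewrite lZ ipWZ.
have : `|r| ^+ 2 <= C * `|r|.
  rewrite -ipWxx {1}/r !ipWB tE -ipWB (le_trans (ler_norm _))//.
  by rewrite (le_trans (ipWle _ _))// ler_wpM2r// lC.
by rewrite expr2 ler_pM2r.
Qed.

Lemma lipschitz_of_diff (f : H -> W) (A : R) :
  (forall x, differentiable f x) -> (forall x h, `|'d f x h| <= A * `|h|) ->
  forall x y, `|f y - f x| <= A * `|y - x|.
Proof.
move=> df dA x y; rewrite -[f y - f x]subr0.
apply: (@mean_value_inequality f (fun z => 'd f z)).
- by move=> z; exact: frechet_differentiable.
- by move=> z a u; rewrite linearZ.
- by move=> t _; rewrite subr0.
Qed.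

Lemma diff_lipschitz_taylor (f : H -> W) (M : R) : 0 <= M ->
  (forall x, differentiable f x) ->
  (forall x y h, `|'d f y h - 'd f x h| <= M * `|y - x| * `|h|) ->
  forall x y, `|f y - f x - 'd f x (y - x)| <= M * `|y - x| ^+ 2.
Proof.
move=> M0 df dM x y; apply: (@mean_value_inequality f (fun z => 'd f z)).
- by move=> z; exact: frechet_differentiable.
- by move=> z a u; rewrite linearZ.
- move=> t /andP[t0 t1]; apply: (le_trans (dM _ _ _)).
  rewrite addrAC subrr add0r normrZ gtr0_norm// expr2 [leRHS]mulrA.
  rewrite ler_wpM2r// ler_wpM2l//.
  by rewrite ler_piMl// ltW.
Qed.

End MeanValue.

Section SecondDerivative.
Context (R : realType) (H : completeNormedModType R).
Context (W : normedModType R) (ipW : W -> W -> R).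
Hypothesis ipWDZ : forall a x y z, ipW (a *: x + y) z = a * ipW x z + ipW y z.
Hypothesis ipWxx : forall x, ipW x x = `|x| ^+ 2.
Hypothesis ipWle : forall x y, `|ipW x y| <= `|x| * `|y|.

Lemma second_deriv_lipschitz (f : H -> W) (D2 : H -> H -> H -> W) (M : R) :
  is_second_deriv f D2 -> (forall x h k, `|D2 x h k| <= M * `|h| * `|k|) ->
  forall x y h, `|'d f y h - 'd f x h| <= M * `|y - x| * `|h|.
Proof.
move=> [df D2l _ _ D2P] D2M x y h; rewrite -['d f y h - _]subr0.
have D0 z k : D2 z 0 k = 0.
  have := D2l z 1 0 0 k; rewrite !scale1r addr0 => /eqP.
  by rewrite -subr_eq subrr => /eqP.
apply: (@mean_value_inequality _ H W ipW ipWDZ ipWxx ipWle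
  (fun z => 'd f z h) (fun z k => D2 z k h)).
- move=> z eps eps0.
  have h1 : 0 < `|h| + 1 by rewrite ltr_wpDl.
  have [del del0 delP] := D2P z (eps / (`|h| + 1)) (divr_gt0 eps0 h1).
  exists del => // y' /delP/(_ h) b; apply: (le_trans b).
  rewrite mulrAC ler_wpM2r// -mulrA ler_piMr//; first exact: ltW.
  by rewrite mulrC ler_pdivrMr// mul1r lerDl.
- by move=> z a u; have := D2l z a u 0 h; rewrite !addr0 D0 addr0.
- by move=> t _; rewrite subr0 D2M.
Qed.

End SecondDerivative.

(** * Test functions with Lipschitz differential *)

Section ClassC11.
Context (R : realType) (H : completeNormedModType R).

(** [d] is the differential of [psi], described by a quadratic Taylor bound instead of ['d]. In this
    form an average over the noise inherits the bounds by integrating inequalities, without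
    differentiating under the integral sign. *)
Definition C11 (psi : H -> R) (d : H -> H -> R) (a b : R) :=
  [/\ 0 <= a /\ 0 <= b, forall x y, `|psi y - psi x| <= a * `|y - x|,
      forall x s u v, d x (s *: u + v) = s * d x u + d x v &
      forall x y, `|psi y - psi x - d x (y - x)| <= b * `|y - x| ^+ 2].

Context (psi : H -> R) (d : H -> H -> R) (a b : R).
Hypothesis C : C11 psi d a b.

Lemma C11_DZ x s u v : d x (s *: u + v) = s * d x u + d x v.
Proof. by case: C. Qed.

Lemma C11_D x u v : d x (u + v) = d x u + d x v.
Proof. by have := C11_DZ x 1 u v; rewrite scale1r mul1r. Qed.

Lemma C11_0 x : d x 0 = 0.
Proof. by have := C11_D x 0 0; rewrite addr0; lra. Qed.

Lemma C11_Z x s u : d x (s *: u) = s * d x u.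
Proof. by have := C11_DZ x s u 0; rewrite !addr0 C11_0 addr0. Qed.

Lemma C11_N x u : d x (- u) = - d x u.
Proof. by rewrite -scaleN1r C11_Z mulN1r. Qed.

Lemma C11_B x u v : d x (u - v) = d x u - d x v.
Proof. by rewrite C11_D C11_N. Qed.

(** Compare the Lipschitz and Taylor bounds at [x + t *: h], divide by t and let t tend to 0. *)
Lemma C11_bound x h : `|d x h| <= a * `|h|.
Proof.
have [[a0 b0] lip _ tay] := C.
apply/ler_addgt0Pr => eps eps0.
have n0 : 0 < b * `|h| ^+ 2 + 1 by rewrite ltr_wpDl// mulr_ge0 ?sqr_ge0.
set t := eps / (b * `|h| ^+ 2 + 1); have t0 : 0 < t by rewrite divr_gt0.
have e0 : x + t *: h - x = t *: h by rewrite addrAC subrr add0r.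
have h1 := tay x (x + t *: h); have h2 := lip x (x + t *: h).
rewrite e0 normrZ gtr0_norm// in h2.
rewrite e0 C11_Z normrZ gtr0_norm// in h1.
have : t * `|d x h| <= a * (t * `|h|) + b * (t * `|h|) ^+ 2.
  rewrite -[X in X * `|d x h|](gtr0_norm t0) -normrM.
  have -> : t * d x h = (psi (x + t *: h) - psi x) - (psi (x + t *: h) - psi x - t * d x h).
    by ring.
  by rewrite (le_trans (ler_normB _ _))// lerD.
have -> : a * (t * `|h|) + b * (t * `|h|) ^+ 2 = t * (a * `|h| + t * (b * `|h| ^+ 2)).
  by ring.
rewrite ler_pM2l// => /le_trans; apply; rewrite lerD2l /t mulrAC ler_pdivrMr//.
by rewrite ler_pM2l// lerDl.
Qed.

(** Rescale h to a vector k of length t = |y - x|. Then d y k - d x k combines three Taylor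
    remainders with displacements of length at most t, 2 t and t, and 1 + 4 + 1 = 6. *)
Lemma C11_lip x y h : `|d y h - d x h| <= 6 * b * `|y - x| * `|h|.
Proof.
have [[a0 b0] _ _ tay] := C.
have [->|h0] := eqVneq h 0; first by rewrite !C11_0 subr0 !normr0 mulr0.
have [->|yx] := eqVneq y x; first by rewrite !subrr !normr0 mulr0 mul0r.
have hp : 0 < `|h| by rewrite normr_gt0.
set t := `|y - x|; have t0 : 0 < t by rewrite normr_gt0 subr_eq0.
set k := (t / `|h|) *: h.
have nk : `|k| = t by rewrite normrZ normrM normfV !normr_id divfK ?gt_eqF.
have h1 := tay y (y + k); have h2 := tay x (y + k); have h3 := tay x y.
have e1 : y + k - y = k by rewrite addrAC subrr add0r.
have e2 : y + k - x = (y - x) + k by rewrite addrAC.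
rewrite e1 nk in h1; rewrite e2 C11_D in h2; rewrite -/t in h3.
have h2' : b * `|y - x + k| ^+ 2 <= 4 * b * t ^+ 2.
  have -> : 4 * b * t ^+ 2 = b * (2 * t) ^+ 2 by ring.
  rewrite ler_wpM2l//.
  have h4 : `|y - x + k| <= 2 * t.
    by rewrite (le_trans (ler_normD _ _))// nk -/t; lra.
  by apply: lerXn2r; rewrite ?nnegrE// mulr_ge0// ltW.
have : `|d y k - d x k| <= 6 * b * t ^+ 2.
  have -> : d y k - d x k = (psi (y + k) - psi x - (d x (y - x) + d x k))
     - (psi (y + k) - psi y - d y k) - (psi y - psi x - d x (y - x)) by ring.
  apply: (le_trans (ler_normB _ _)); apply: (le_trans (lerD (ler_normB _ _) (lexx _))).
  have := le_trans h2 h2'; lra.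
rewrite /k !C11_Z -mulrBr normrM ger0_norm ?divr_ge0//; last exact: ltW.
have -> : 6 * b * t ^+ 2 = (t / `|h|) * (6 * b * t * `|h|).
  by field; rewrite gt_eqF.
by rewrite ler_pM2l// divr_gt0.
Qed.

Lemma C11_growth x : `|psi x| <= `|psi 0| + a * `|x|.
Proof.
have [_ lip _ _] := C; have := lip 0 x; rewrite subr0 => h.
have -> : psi x = psi 0 + (psi x - psi 0) by ring.
by rewrite (le_trans (ler_normD _ _))// lerD2l.
Qed.

Lemma C11_continuous : continuous psi.
Proof. by have [[a0 _] lip _ _] := C; exact: lipschitz_continuous lip. Qed.

Lemma C11_measurable : measurable_fun (setT : set (@BH R H)) psi.
Proof. by apply: continuous_measurable_BH; exact: C11_continuous. Qed.

Context (ip : H -> H -> R) (e : nat -> H).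
Hypothesis ipP : is_inner_product ip.
Hypothesis onb : is_onb ip e.

(** [d] is a pointwise limit of difference quotients of the continuous [psi], hence jointly
    measurable in base point and direction. *)
Lemma C11_measurable_diff dT (T : measurableType dT) (u w : T -> @BH R H) :
  measurable_fun setT u -> measurable_fun setT w ->
  measurable_fun setT (fun t => d (u t) (w t)).
Proof.
move=> mu mw; have [[_ b0] _ _ tay] := C.
apply: (@measurable_fun_cvg _ _ _ _
  (fun n t => n.+1%:R * (psi ((u t : H) + n.+1%:R^-1 *: (w t : H)) - psi (u t)))).
  move=> n; apply: measurable_funM => //; apply: measurable_funB.
    apply: (measurableT_comp C11_measurable).
    by apply: (measurable_BH_D ipP onb) => //; exact: (measurable_BH_Z ipP onb).
  exact: (measurableT_comp C11_measurable).
move=> t _; set x : H := u t; set h : H := w t.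
apply/cvgrPdist_le => eps eps0.
have lim : b * `|h| ^+ 2 * n.+1%:R^-1 @[n --> \oo] --> (0 : R).
  rewrite -[X in _ --> X](mulr0 (b * `|h| ^+ 2)); apply: cvgM; first exact: cvg_cst.
  exact: cvg_harmonic.
near=> n; have n0 : 0 < n.+1%:R :> R by rewrite ltr0n.
have := tay x (x + n.+1%:R^-1 *: h).
have -> : x + n.+1%:R^-1 *: h - x = n.+1%:R^-1 *: h by rewrite addrAC subrr add0r.
rewrite C11_Z normrZ normfV (gtr0_norm n0) => h1.
rewrite distrC.
have -> : n.+1%:R * (psi (x + n.+1%:R^-1 *: h) - psi x) - d x h
  = n.+1%:R * (psi (x + n.+1%:R^-1 *: h) - psi x - n.+1%:R^-1 * d x h).
  by rewrite [RHS]mulrBr mulrA divff ?mul1r// gt_eqF.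
rewrite normrM (gtr0_norm n0) (le_trans (ler_wpM2l (ltW n0) h1))//.
have -> : n.+1%:R * (b * (n.+1%:R^-1 * `|h|) ^+ 2) = b * `|h| ^+ 2 * n.+1%:R^-1.
  by field; rewrite gt_eqF.
apply: (le_trans (ler_norm _)); rewrite -[X in `|X|]subr0 distrC.
by near: n; move/cvgrPdist_le: lim; apply.
Unshelve. all: by end_near. Qed.

End ClassC11.

Section Kernel.
Context (R : realType) (H : completeNormedModType R) (ip : H -> H -> R) (e : nat -> H).
Hypothesis ipP : is_inner_product ip.
Hypothesis onb : is_onb ip e.
Context (nu : probability (@BH R H) R).
Hypothesis nu1 : itg nu (fun z => `|z : H|).

(** One operator for the Euler chain ([Phi x] = x + dt G x, [tau] = sqrt (2 dt)) and for the
    Ornstein-Uhlenbeck semigroup ([Phi x] = c x, [tau] = s). *)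
Definition kernel (Phi : H -> H) (tau : R) (psi : H -> R) (x : H) : R :=
  Rintegral nu setT (fun z : @BH R H => psi (Phi x + tau *: (z : H))).

Definition kernel_diff (Phi : H -> H) (J : H -> H -> H) (tau : R)
    (d : H -> H -> R) (x k : H) : R :=
  Rintegral nu setT (fun z : @BH R H => d (Phi x + tau *: (z : H)) (J x k)).

Lemma measurable_shift (y : H) (tau : R) :
  measurable_fun setT (fun z : @BH R H => y + tau *: (z : H) : @BH R H).
Proof.
apply: (measurable_BH_D ipP onb); first by [].
by apply: (measurable_BH_Z ipP onb).
Qed.

Lemma kernel_itg psi d a b (y : H) (tau : R) : C11 psi d a b ->
  itg nu (fun z => psi (y + tau *: (z : H))).
Proof.
move=> C; have [[a0 _] _ _ _] := C.
apply: (@itg_dom _ _ _ _ _ (fun z : @BH R H => (`|psi 0| + a * `|y|) + (a * `|tau|) * `|z : H|)).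
- exact: (measurableT_comp (C11_measurable C) (measurable_shift y tau)).
- move=> z; rewrite (le_trans (C11_growth C _))// -!addrA lerD2l -mulrA -mulrDr.
  by rewrite ler_wpM2l// (le_trans (ler_normD _ _))// normrZ.
- by apply: itgD; [exact: itg_cst|exact: itgZ].
Qed.

Lemma kernel_diff_itg psi d a b (y k : H) (tau : R) : C11 psi d a b ->
  itg nu (fun z => d (y + tau *: (z : H)) k).
Proof.
move=> C; apply: (@itg_bounded _ _ _ _ _ (a * `|k|)).
  by apply: (C11_measurable_diff C ipP onb) => //; exact: measurable_shift.
by move=> z; exact: C11_bound C _ _.
Qed.

(** The chain rule: the remainder of [psi] along the displacement of [Phi] costs b r^2, and the
    differential applied to the remainder of [Phi] costs a m. The noise cancels in every
    difference. *)
Lemma kernel_C11 psi d a b (Phi : H -> H) (J : H -> H -> H) (tau r m : R) :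
  C11 psi d a b -> 0 <= r -> 0 <= m ->
  (forall x y, `|Phi y - Phi x| <= r * `|y - x|) ->
  (forall x s u v, J x (s *: u + v) = s *: J x u + J x v) ->
  (forall x y, `|Phi y - Phi x - J x (y - x)| <= m * `|y - x| ^+ 2) ->
  C11 (kernel Phi tau psi) (kernel_diff Phi J tau d) (a * r) (b * r ^+ 2 + a * m).
Proof.
move=> C r0 m0 lipP linJ tayP; have [[a0 b0] lip lin tay] := C.
have gen (f : @BH R H -> R) k : measurable_fun setT f -> (forall z, `|f z| <= k) ->
    `|Rintegral nu setT f| <= k.
  by move=> mf fk; rewrite -[leRHS](Rint_cst nu k); apply: Rint_abs_le => //; exact: itg_cst.
split.
- by split; rewrite ?addr_ge0 ?mulr_ge0 ?sqr_ge0.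
- move=> x y; rewrite /kernel -RintB; [|exact: kernel_itg C..].
  apply: gen => [|z].
    by apply: itg_measurable; apply: itgB; exact: kernel_itg C.
  rewrite (le_trans (lip _ _))// opprD addrACA subrr addr0 -mulrA.
  by rewrite ler_wpM2l.
- move=> x s u v; rewrite /kernel_diff -RintZ; last exact: kernel_diff_itg C.
  rewrite -RintD; [|by apply: itgZ; exact: kernel_diff_itg C|exact: kernel_diff_itg C].
  by apply: Rint_eq => z; rewrite linJ lin.
- move=> x y; rewrite /kernel /kernel_diff -RintB; [|exact: kernel_itg C..].
  have i1 : itg nu (fun z => psi (Phi y + tau *: (z : H)) - psi (Phi x + tau *: (z : H))).
    by apply: itgB; exact: kernel_itg C.
  rewrite -RintB//; last exact: kernel_diff_itg C.
  apply: gen => [|z].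
    apply: (itg_measurable (P := nu)); apply: (itgB i1); exact: kernel_diff_itg C.
  have E : Phi y + tau *: (z : H) - (Phi x + tau *: (z : H)) = Phi y - Phi x.
    by rewrite opprD addrACA subrr addr0.
  have h1 := tay (Phi x + tau *: (z : H)) (Phi y + tau *: (z : H)); rewrite E in h1.
  have h2 := C11_bound C (Phi x + tau *: (z : H)) (Phi y - Phi x - J x (y - x)).
  rewrite (C11_B C _ (Phi y - Phi x)) in h2.
  set p := psi (Phi y + _) - psi _ in h1 *.
  set q1 := d _ (Phi y - Phi x) in h1 h2; set q2 := d _ (J x _) in h2 *.
  have -> : p - q2 = (p - q1) + (q1 - q2) by ring.
  rewrite (le_trans (ler_normD _ _))// mulrDl lerD//.
    rewrite (le_trans h1)// -mulrA ler_wpM2l// -exprMn.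
    by rewrite ler_pXn2r// ?nnegrE ?mulr_ge0.
  by rewrite (le_trans h2)// -mulrA ler_wpM2l.
Qed.

End Kernel.

Section RotationExpectation.
Context (R : realType) (H : completeNormedModType R) (ip : H -> H -> R).
Context (e : nat -> H) (q : nat -> R).
Hypothesis ipP : is_inner_product ip.
Hypothesis onb : is_onb ip e.
Hypothesis q0 : forall k, 0 < q k.
Hypothesis qsum : cvgn (series q).
Context (nu : probability (@BH R H) R).
Hypothesis nuP : gaussian_cov ip e q (2^-1) nu.
Local Notation HH := (@BH R H * @BH R H)%type.

Definition mean2 (g : HH -> R) : R := Rintegral (nu \x nu)%E setT g.

Let half_ge0 : 0 <= 2^-1 :> R. Proof. by rewrite invr_ge0. Qed.

Lemma mean2_rotation (a b : R) (g : HH -> R) : a ^+ 2 + b ^+ 2 = 1 ->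
  itg (nu \x nu)%E g -> mean2 g = mean2 (g \o rotation a b).
Proof.
move=> ab gi; have inv A := @rotation_invariant _ _ _ _ _ ipP onb q0 qsum _ _ half_ge0 nuP a b A ab.
apply: (Rint_transfer (measurable_rotation ipP onb a b) inv).
  exact: itg_measurable gi.
exact: (itg_transferV (measurable_rotation ipP onb a b) inv gi).
Qed.

Lemma itg_rotation (a b : R) (g : HH -> R) : a ^+ 2 + b ^+ 2 = 1 ->
  itg (nu \x nu)%E g -> itg (nu \x nu)%E (g \o rotation a b).
Proof.
move=> ab gi; have inv A := @rotation_invariant _ _ _ _ _ ipP onb q0 qsum _ _ half_ge0 nuP a b A ab.
exact: (itg_transferV (measurable_rotation ipP onb a b) inv gi).
Qed.

(** The map [rotation 1 0] is (x, y) |-> (x, - y). *)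
Lemma mean2_odd (g : HH -> R) : itg (nu \x nu)%E g ->
  (forall x y : H, g (x, - y) = - g (x, y)) -> mean2 g = 0.
Proof.
move=> gi odd.
have h1 : (1 : R) ^+ 2 + 0 ^+ 2 = 1 by rewrite expr1n expr0n addr0.
have := mean2_rotation h1 gi.
have -> : mean2 (g \o rotation 1 0) = mean2 (fun z => (-1) * g z).
  apply: Rint_eq => -[x y]; rewrite /comp /rotation /= scale1r !scale0r scale1r.
  by rewrite addr0 sub0r odd mulN1r.
rewrite /mean2 RintZ// mulN1r => h; lra.
Qed.

Lemma mean2_fubini (g : HH -> R) : itg (nu \x nu)%E g ->
  (forall x, itg nu (fun y => g (x, y))) ->
  mean2 g = Rintegral nu setT (fun x => Rintegral nu setT (fun y => g (x, y))).
Proof. by move=> gi gx; have [] := Rint_fubini gi gx. Qed.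

Hypothesis nu2 : itg nu (fun x => `|x : H| ^+ 2).

Lemma itg_ip_ip (h k : H) : itg nu (fun y => ip h y * ip k y) /\
  Rintegral nu setT (fun y => ip h y * ip k y) = 2^-1 * ip (Qop ip e q h) k.
Proof.
have sq l := gaussian_itg_sqr ipP onb q0 qsum half_ge0 nuP l.
have E (y : @BH R H) : ip h y * ip k y = 4^-1 * ip (1 *: h + 1 *: k) y ^+ 2
    - 4^-1 * ip (1 *: h + (-1) *: k) y ^+ 2.
  by rewrite !(ipDl ipP) !(ipZl ipP); field.
have i1 := itgZ (4^-1) (sq (1 *: h + 1 *: k)).
have i2 := itgZ (4^-1) (sq (1 *: h + (-1) *: k)).
split; first by apply: eq_itg (itgB i1 i2) => y; rewrite E.
rewrite (Rint_eq _ E) (RintB i1 i2) (RintZ _ (sq _)) (RintZ _ (sq _)).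
rewrite !(gaussian_Rint_sqr ipP onb q0 qsum half_ge0 nuP) !(QformDZ ipP onb q0 qsum).
by field.
Qed.

(** The covariance identity holds on the span of the basis by [itg_ip_ip]; the projections [partial]
    extend it to any bounded linear [l] by dominated convergence, without representing [l] by a
    vector. *)
Lemma gaussian_second_moment (l : H -> R) (a : R) (k : H) : 0 <= a ->
  (forall s u v, l (s *: u + v) = s * l u + l v) ->
  (forall h, `|l h| <= a * `|h|) -> measurable_fun (setT : set (@BH R H)) l ->
  Rintegral nu setT (fun y => ip k y * l y) = 2^-1 * l (Qop ip e q k).
Proof.
move=> a0 lDZ la ml.
have lD u v : l (u + v) = l u + l v by have := lDZ 1 u v; rewrite scale1r mul1r.
have l0 : l 0 = 0 by have := lD 0 0; rewrite addr0; lra.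
have lZ s u : l (s *: u) = s * l u by have := lDZ s u 0; rewrite !addr0 l0 addr0.
have lpart n y : l (partial ip e n y) = \sum_(i < n) ip y (e i) * l (e i).
  rewrite /partial; elim: n => [|n IH]; first by rewrite !big_ord0 l0.
  by rewrite !big_ord_recr /= lD IH lZ.
have lcvg y : l (partial ip e n y) @[n --> \oo] --> l y.
  apply/cvgrPdist_le => eps eps0.
  have a1 : 0 < a + 1 by rewrite ltr_wpDl.
  near=> n; have -> : l y - l (partial ip e n y) = l (y - partial ip e n y).
    by have := lDZ (-1) (partial ip e n y) y; rewrite scaleN1r mulN1r addrC => ->; rewrite addrC.
  apply: (le_trans (la _)).
  apply: (@le_trans _ _ ((a + 1) * (eps / (a + 1)))).
    apply: ler_pM => //; first by rewrite lerDl.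
    near: n; have /cvgrPdist_le := cvg_partial onb (x := y).
    by apply; rewrite divr_gt0.
  by rewrite mulrCA divff ?mulr1// gt_eqF.
have mp n : measurable_fun setT (fun y : @BH R H => ip k y * l (partial ip e n y)).
  apply: measurable_funM; first exact: measurable_ip.
  under eq_fun do rewrite lpart.
  apply: measurable_sum => i; apply: measurable_funM => //.
  by under eq_fun do rewrite (ipC ipP); exact: measurable_ip.
have lim1 : Rintegral nu setT (fun y => ip k y * l (partial ip e n y))
    @[n --> \oo] --> Rintegral nu setT (fun y => ip k y * l y).
  apply: (@Rint_dct _ _ _ nu _ _ (fun y : @BH R H => (`|k| * a) * `|y : H| ^+ 2)) => //.
  - exact: itgZ.
  - move=> n y; rewrite normrM expr2 mulrACA.
    apply: ler_pM => //; first exact: cauchy_schwarz.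
    rewrite (le_trans (la _))// ler_wpM2l// (norm_partial_le ipP onb)//.
  - by move=> y; apply: cvgM; [exact: cvg_cst|exact: lcvg].
have E n : Rintegral nu setT (fun y => ip k y * l (partial ip e n y))
    = 2^-1 * l (partial ip e n (Qop ip e q k)).
  have ie i : itg nu (fun y => l (e i) * (ip k y * ip (e i) y)).
    by apply: itgZ; have [] := itg_ip_ip k (e i).
  transitivity (Rintegral nu setT
      (fun y => \sum_(i < n) l (e i) * (ip k y * ip (e i) y))).
    apply: Rint_eq => y; rewrite lpart mulr_sumr; apply: eq_bigr => i _.
    by rewrite (ipC ipP y); ring.
  rewrite (Rint_sum (f := fun i : 'I_n => _))// lpart mulr_sumr.
  apply: eq_bigr => i _.
  by rewrite (RintZ _ (proj1 (itg_ip_ip k (e i)))) (proj2 (itg_ip_ip k (e i))); ring.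
rewrite (funext E) in lim1.
apply: (cvg_unique _ lim1); first exact: Rhausdorff.
by apply: cvgM; [exact: cvg_cst|exact: lcvg].
Unshelve. all: by end_near. Qed.

End RotationExpectation.

(** * The Gibbs density under one Euler step *)

Section Consistency.
Context (R : realType) (H : completeNormedModType R) (ip : H -> H -> R).
Context (e : nat -> H) (q : nat -> R).
Hypothesis ipP : is_inner_product ip.
Hypothesis onb : is_onb ip e.
Hypothesis q0 : forall k, 0 < q k.
Hypothesis qsum : cvgn (series q).
Context (nu : probability (@BH R H) R).
Hypothesis nuP : gaussian_cov ip e q (2^-1) nu.
Hypothesis nu1 : itg nu (fun x => `|x : H|).
Hypothesis nu2 : itg nu (fun x => `|x : H| ^+ 2).
Local Notation HH := (@BH R H * @BH R H)%type.

Context (rho : H -> R) (F f : H -> H) (df : H -> H -> H) (K A : R).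
Hypothesis K1 : 1 <= K.
Hypothesis A0 : 0 <= A.
Hypothesis rho_cont : continuous rho.
Hypothesis F_cont : continuous F.
Hypothesis f_cont : continuous f.
Hypothesis rho_ge0 : forall u, 0 <= rho u.
Hypothesis rhoK : forall u, rho u <= K * expR (A * `|u| ^+ 2).
Hypothesis FK : forall u, `|F u| <= K * (1 + `|u|).
Hypothesis fK : forall u, `|f u| <= K * (1 + `|u|).
Hypothesis fF : forall u, f u = Qop ip e q (F u).
Hypothesis dfDZ : forall x s u v, df x (s *: u + v) = s *: df x u + df x v.
Hypothesis dfK : forall x h, `|df x h| <= K * `|h|.
Hypothesis fT : forall x y, `|f y - f x - df x (y - x)| <= K * `|y - x| ^+ 2.
(* The differential of [rho = exp (- 2 V)] is [2 rho F], as [F = - DV]. *)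
Hypothesis rhoT : forall x y (n W : R), 1 + `|x| <= n -> 1 + `|y| <= n ->
  expR (A * `|x| ^+ 2) <= W -> expR (A * `|y| ^+ 2) <= W ->
  `|rho y - rho x - 2 * rho x * ip (F x) (y - x)| <= K * n ^+ 2 * W * `|y - x| ^+ 2.

Definition size2 (z : HH) : R := 1 + `|z.1 : H| + `|z.2 : H|.
Definition weight2 (z : HH) : R := expR (A * (`|z.1 : H| ^+ 2 + `|z.2 : H| ^+ 2)).
(** Every error term is reduced to a multiple of this function by [bound_le]. Since |x|^2 + |y|^2
    bounds the squared norm of each rotated point, one weight controls [rho] before and after a
    rotation. *)
Definition dominant (z : HH) : R := size2 z ^+ 6 * weight2 z.
Hypothesis dom_itg : itg (nu \x nu)%E dominant.
Let MB := mean2 nu dominant.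

Let K0 : 0 <= K. Proof. exact: le_trans K1. Qed.

Let size2_ge1 z : 1 <= size2 z.
Proof. by rewrite /size2 -addrA lerDl addr_ge0. Qed.

Let weight2_ge0 z : 0 <= weight2 z. Proof. exact: expR_ge0. Qed.

Let bound_le z (i j : nat) : (i <= 3)%N -> (j <= 6)%N ->
  K ^+ i * size2 z ^+ j * weight2 z <= K ^+ 3 * dominant z.
Proof.
move=> i3 j6; rewrite /dominant mulrA ler_wpM2r//.
by rewrite ler_pM ?exprn_ge0 ?(le_trans _ (size2_ge1 z))// ler_weXn2l.
Qed.

Let dominant_ge0 z : 0 <= dominant z.
Proof. by rewrite mulr_ge0// exprn_ge0// (le_trans _ (size2_ge1 z)). Qed.

Let mean2_le (g : HH -> R) (k : R) : measurable_fun setT g ->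
  (forall z, `|g z| <= k * dominant z) -> itg (nu \x nu)%E g /\ `|mean2 nu g| <= k * MB.
Proof.
move=> mg gk; have kd : itg (nu \x nu)%E (fun z => k * dominant z) by exact: itgZ.
split; first exact: itg_dom mg gk kd.
by rewrite /MB /mean2 -RintZ//; exact: Rint_abs_le.
Qed.

Let MB_ge0 : 0 <= MB.
Proof.
have [||] := @mean2_le (fun=> 0) 0; first by [].
- by move=> z; rewrite normr0 mul0r.
move=> _ _; rewrite /MB /mean2; apply: Rintegral_ge0 => z _; exact: dominant_ge0.
Qed.

Definition rot1 (c s : R) (z : HH) : @BH R H := c *: (z.1 : H) + s *: (z.2 : H).

Let measurable_rot1 c s : measurable_fun setT (rot1 c s).
Proof.
apply: (measurable_BH_D ipP onb); apply: (measurable_BH_Z ipP onb);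
  [exact: measurable_fst|exact: measurable_snd].
Qed.

Let norm_rot1_sqr (c s : R) z : c ^+ 2 + s ^+ 2 = 1 ->
  `|rot1 c s z : H| ^+ 2 <= `|z.1 : H| ^+ 2 + `|z.2 : H| ^+ 2.
Proof.
move=> cs; have h : 0 <= `|s *: (z.1 : H) - c *: (z.2 : H)| ^+ 2 by exact: sqr_ge0.
have E : `|rot1 c s z : H| ^+ 2 + `|s *: (z.1 : H) - c *: (z.2 : H)| ^+ 2
   = (c ^+ 2 + s ^+ 2) * (`|z.1 : H| ^+ 2 + `|z.2 : H| ^+ 2).
  rewrite /rot1 (norm_sqrD ipP) (norm_sqrB ipP) !(ipZl ipP) !(ipZr ipP).
  by rewrite !normrZ !exprMn !(real_normK (num_real _)); ring.
rewrite cs mul1r in E; lra.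
Qed.

Let abs_le1 (c s : R) : c ^+ 2 + s ^+ 2 = 1 -> `|c| <= 1 /\ `|s| <= 1.
Proof.
move=> cs; have c2 := sqr_ge0 c; have s2 := sqr_ge0 s.
have n1 (t : R) : t ^+ 2 <= 1 -> `|t| <= 1.
  by move=> t1; rewrite -(@ler_pXn2r _ 2)// ?nnegrE// real_normK ?num_real// expr1n.
by split; apply: n1; lra.
Qed.

Let size_rot1 (c s : R) z : c ^+ 2 + s ^+ 2 = 1 -> 1 + `|rot1 c s z : H| <= size2 z.
Proof.
move=> /abs_le1[c1 s1]; rewrite /size2 -addrA lerD2l (le_trans (ler_normD _ _))//.
by rewrite !normrZ lerD// ler_piMl.
Qed.

Let weight_rot1 (c s : R) z : c ^+ 2 + s ^+ 2 = 1 ->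
  expR (A * `|rot1 c s z : H| ^+ 2) <= weight2 z.
Proof. by move=> cs; rewrite ler_expR ler_wpM2l// norm_rot1_sqr. Qed.

Let size_fst z : 1 + `|z.1 : H| <= size2 z.
Proof. by rewrite /size2 lerDl. Qed.

Let weight_fst z : expR (A * `|z.1 : H| ^+ 2) <= weight2 z.
Proof. by rewrite ler_expR ler_wpM2l// lerDl sqr_ge0. Qed.

Let rho_le u z : expR (A * `|u| ^+ 2) <= weight2 z -> `|rho u| <= K * weight2 z.
Proof. by move=> h; rewrite ger0_norm// (le_trans (rhoK u))// ler_wpM2l. Qed.

Let F_le u z : 1 + `|u| <= size2 z -> `|F u| <= K * size2 z.
Proof. by move=> h; rewrite (le_trans (FK u))// ler_wpM2l. Qed.

Let f_le u z : 1 + `|u| <= size2 z -> `|f u| <= K * size2 z.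
Proof. by move=> h; rewrite (le_trans (fK u))// ler_wpM2l. Qed.

Let snd_le z : `|z.2 : H| <= size2 z.
Proof. by rewrite /size2 lerDr addr_ge0. Qed.

Let fst_le z : `|z.1 : H| <= size2 z.
Proof. by rewrite (le_trans _ (size_fst z))// lerDr. Qed.

Let size2_ge0 z : 0 <= size2 z. Proof. exact: le_trans (size2_ge1 z). Qed.

Let mrho (u : HH -> @BH R H) : measurable_fun setT u -> measurable_fun setT (rho \o u).
Proof. by move=> mu; apply: measurableT_comp mu; exact: continuous_measurable_BH. Qed.

Let mf (u : HH -> @BH R H) : measurable_fun setT u ->
  measurable_fun setT (fun z => f (u z) : @BH R H).
Proof. by move=> mu; apply: measurableT_comp mu; exact: continuous_measurable_BHBH. Qed.

Let mF_ip (u w : HH -> @BH R H) : measurable_fun setT u -> measurable_fun setT w ->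
  measurable_fun setT (fun z => ip (F (u z)) (w z)).
Proof.
move=> mu mw; apply: (@measurable_fun_cvg _ _ _ _
  (fun n z => \sum_(i < n) ip (F (u z)) (e i) * ip (w z) (e i))) => [n|z _]; last first.
  exact: (cvg_ip ipP onb (x := F (u z)) (y := w z)).
have mFu : measurable_fun setT (fun z => F (u z) : @BH R H).
  by apply: measurableT_comp mu; exact: continuous_measurable_BHBH.
apply: measurable_sum => i; apply: measurable_funM.
  by under eq_fun do rewrite (ipC ipP); exact: (measurableT_comp (measurable_ip ipP (e i)) mFu).
by under eq_fun do rewrite (ipC ipP); exact: (measurableT_comp (measurable_ip ipP (e i)) mw).
Qed.

Let dfD x u v : df x (u + v) = df x u + df x v.
Proof. by have := dfDZ x 1 u v; rewrite !scale1r. Qed.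

Let df0 x : df x 0 = 0.
Proof.
by have := dfD x 0 0; rewrite addr0 -{1}[df x 0]addr0 => /addrI <-.
Qed.

Let dfZ x s u : df x (s *: u) = s *: df x u.
Proof. by have := dfDZ x s u 0; rewrite !addr0 df0 addr0. Qed.

Let mdf (u w : HH -> @BH R H) : measurable_fun setT u -> measurable_fun setT w ->
  measurable_fun setT (fun z => df (u z) (w z) : @BH R H).
Proof.
move=> mu mw; apply: (measurable_BH_of_ip ipP onb) => h.
apply: (@measurable_fun_cvg _ _ _ _ (fun n z => ip h (n.+1%:R *:
    (f ((u z : H) + n.+1%:R^-1 *: (w z : H)) - f (u z))))).
  move=> n; apply: (measurableT_comp (measurable_ip ipP h)).
  apply: (measurable_BH_Z ipP onb).
  rewrite (_ : (fun z => _) = (fun z => f ((u z : H) + n.+1%:R^-1 *: (w z : H))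
    + (-1) *: f (u z))); last by apply/funext => z; rewrite scaleN1r.
  apply: (measurable_BH_D ipP onb); last by apply: (measurable_BH_Z ipP onb); exact: mf.
  apply: mf; apply: (measurable_BH_D ipP onb) => //.
  exact: (measurable_BH_Z ipP onb).
move=> z _; apply: continuous_cvg; first exact: continuous_ip.
set x : H := u z; set k : H := w z.
apply/cvgrPdist_le => eps eps0.
have lim : K * `|k| ^+ 2 * n.+1%:R^-1 @[n --> \oo] --> (0 : R).
  rewrite -[X in _ --> X](mulr0 (K * `|k| ^+ 2)); apply: cvgM; first exact: cvg_cst.
  exact: cvg_harmonic.
near=> n; have n0 : 0 < n.+1%:R :> R by rewrite ltr0n.
have := fT x (x + n.+1%:R^-1 *: k).
have -> : x + n.+1%:R^-1 *: k - x = n.+1%:R^-1 *: k by rewrite addrAC subrr add0r.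
rewrite dfZ normrZ normfV (gtr0_norm n0) => h1.
rewrite distrC.
have -> : n.+1%:R *: (f (x + n.+1%:R^-1 *: k) - f x) - df x k
  = n.+1%:R *: (f (x + n.+1%:R^-1 *: k) - f x - n.+1%:R^-1 *: df x k).
  by rewrite [RHS]scalerBr scalerA divff ?scale1r// gt_eqF.
rewrite normrZ (gtr0_norm n0) (le_trans (ler_wpM2l (ltW n0) h1))//.
have -> : n.+1%:R * (K * (n.+1%:R^-1 * `|k|) ^+ 2) = K * `|k| ^+ 2 * n.+1%:R^-1.
  by field; rewrite gt_eqF.
apply: (le_trans (ler_norm _)); rewrite -[X in `|X|]subr0 distrC.
by near: n; move/cvgrPdist_le: lim; apply.
Unshelve. all: by end_near. Qed.

Let normM_le (x y X Y : R) : `|x| <= X -> `|y| <= Y -> `|x * y| <= X * Y.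
Proof. by move=> xX yY; rewrite normrM ler_pM. Qed.

(** With eta = sqrt (1 - c), half-integral powers of 1 - c become integral powers of eta, and s^2 =
    1 - c^2. *)
Definition angle (eta c s : R) :=
  [/\ 0 <= eta <= 1, c = 1 - eta ^+ 2, 0 <= s & s ^+ 2 = eta ^+ 2 * (2 - eta ^+ 2)].

Let angle_unit eta c s : angle eta c s -> c ^+ 2 + s ^+ 2 = 1.
Proof. by move=> [_ -> _ ->]; ring. Qed.

Let angle_s eta c s : angle eta c s -> s <= 2 * eta.
Proof.
move=> [/andP[e0 e1] _ s0 sE].
rewrite -(@ler_pXn2r _ 2)// ?nnegrE// ?mulr_ge0// sE mulrC exprMn.
rewrite ler_wpM2r ?sqr_ge0//; have := sqr_ge0 eta; rewrite expr2; lra.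
Qed.

Let rotate_back (c s : R) (x y : H) : c ^+ 2 + s ^+ 2 = 1 ->
  c *: (c *: x + s *: y) + s *: (s *: x - c *: y) = x.
Proof.
move=> cs; rewrite scalerBr scalerDr !scalerA (mulrC s c) addrACA -scalerDl.
by rewrite subrr addr0 -!expr2 cs scale1r.
Qed.

Let rot1_sub eta c s z : angle eta c s ->
  (rot1 c s z : H) - (z.1 : H) = (- eta ^+ 2) *: (z.1 : H) + s *: (z.2 : H).
Proof.
move=> [_ -> _ _]; rewrite /rot1 addrAC -[X in _ - X + _]scale1r -scalerBl.
by congr (_ *: _ + _); ring.
Qed.

Let rot1_dist eta c s z : angle eta c s ->
  `|(rot1 c s z : H) - (z.1 : H)| <= 2 * eta * size2 z.
Proof.
move=> an; have sle := angle_s an; rewrite (rot1_sub z an).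
have [/andP[e0 e1] _ s0 _] := an.
rewrite (le_trans (ler_normD _ _))// !normrZ normrN (ger0_norm s0).
rewrite ger0_norm ?sqr_ge0//.
have e2 : eta ^+ 2 <= 2 * eta.
  by rewrite expr2 ler_wpM2r// (le_trans e1)// ler1n.
apply: (@le_trans _ _ (2 * eta * `|z.1 : H| + 2 * eta * `|z.2 : H|)).
  by rewrite lerD// ler_wpM2r.
rewrite -mulrDr ler_wpM2l ?mulr_ge0//.
by rewrite /size2 -addrA lerDr.
Qed.

Let md psi d a b (u w : HH -> @BH R H) : C11 psi d a b ->
  measurable_fun setT u -> measurable_fun setT w ->
  measurable_fun setT (fun z => d (u z) (w z)).
Proof. by move=> C; exact: (C11_measurable_diff C ipP onb). Qed.

Let d_le psi d a b (x v : H) (X : R) : C11 psi d a b -> `|v| <= X -> `|d x v| <= a * X.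
Proof.
move=> C vX; have [[a0 _] _ _ _] := C.
by rewrite (le_trans (C11_bound C _ _))// ler_wpM2l.
Qed.

Definition gradient_term (d : H -> H -> R) : R :=
  mean2 nu (fun z => rho z.1 * d z.1 (f z.1)).

(** Up to the factor c this is the gradient term of T_c psi, see [gradient_term_ou]. *)
Definition rotated_gradient_term (d : H -> H -> R) (c s : R) : R :=
  mean2 nu (fun z => rho z.1 * d (rot1 c s z) (f z.1)).

Let gradient_dom psi d a b (u v w : HH -> @BH R H) : C11 psi d a b ->
  measurable_fun setT u -> measurable_fun setT v -> measurable_fun setT w ->
  (forall z, expR (A * `|u z : H| ^+ 2) <= weight2 z) ->
  (forall z, 1 + `|w z : H| <= size2 z) ->
  itg (nu \x nu)%E (fun z => rho (u z) * d (v z) (f (w z))) /\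
  `|mean2 nu (fun z => rho (u z) * d (v z) (f (w z)))| <= a * K ^+ 3 * MB.
Proof.
move=> C mu mv mw uW wn; apply: mean2_le => [|z].
  by apply: measurable_funM; [exact: mrho|exact: (md C mv (mf mw))].
apply: (le_trans (normM_le (rho_le (uW z)) (d_le (v z) C (f_le (wn z))))).
have [[a0 _] _ _ _] := C.
have := ler_wpM2l a0 (bound_le z (isT : (2 <= 3)%N) (isT : (1 <= 6)%N)); lra.
Qed.

Lemma gradient_term_le psi d a b : C11 psi d a b ->
  `|gradient_term d| <= a * K ^+ 3 * MB.
Proof.
by move=> C; have [] := @gradient_dom psi d a b fst fst fst C.
Qed.

(** Only [rho] and [f] are expanded, while [d] stays at [z.1]; hence no [b] in the bound. The term
    subtracted is linear in the noise. The pieces r1, r2, r3, r4 cost 4 + 16 + 4 + 3 = 27: remainder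
    of f, product of two increments, remainder of rho, and the radial part - eta^2 x of the
    displacement. *)
Let swap_pointwise psi d a b eta c s z : C11 psi d a b -> angle eta c s ->
  `|rho (rot1 c s z) * d z.1 (f (rot1 c s z)) - rho z.1 * d z.1 (f z.1)
    - s * (rho z.1 * d z.1 (df z.1 z.2) + 2 * rho z.1 * ip (F z.1) z.2 * d z.1 (f z.1))|
  <= 27 * a * eta ^+ 2 * (K ^+ 3 * dominant z).
Proof.
move=> C an; set u : H := rot1 c s z; set x : H := z.1; set y : H := z.2.
have [[a0 b0] _ _ _] := C.
have [/andP[e0 e1] _ s0 _] := an.
have cs := angle_unit an.
set k := u - x; have kE : k = (- eta ^+ 2) *: x + s *: y by exact: rot1_sub.
have kn : `|k| <= 2 * eta * size2 z by exact: rot1_dist.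
set n := size2 z in kn *; set W := weight2 z.
have n1 : 1 <= n by exact: size2_ge1.
have n0 : 0 <= n by exact: size2_ge0.
have W0 : 0 <= W by exact: weight2_ge0.
have kn2 : `|k| ^+ 2 <= 4 * eta ^+ 2 * n ^+ 2.
  have -> : 4 * eta ^+ 2 * n ^+ 2 = (2 * eta * n) ^+ 2 by ring.
  by apply: lerXn2r => //; rewrite nnegrE ?mulr_ge0.
have kn3 : `|k| <= 2 * n.
  by apply: (le_trans kn); rewrite ler_wpM2r// ler_piMr.
have ipB v w X : `|v| <= X -> `|w| <= n -> `|ip v w| <= X * n.
  by move=> vX wn; rewrite (le_trans (cauchy_schwarz ipP _ _))// ler_pM.
have ru : `|rho u| <= K * W by apply: rho_le; exact: weight_rot1.
have rx : `|rho x| <= K * W by apply: rho_le; exact: weight_fst.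
have Fx : `|F x| <= K * n by apply: F_le; exact: size_fst.
have fx : `|f x| <= K * n by apply: f_le; exact: size_fst.
have T := rhoT (size_fst z) (size_rot1 z cs) (weight_fst z) (weight_rot1 z cs).
rewrite -/u -/x -/k -/n -/W in T.
pose er := rho u - rho x - 2 * rho x * ip (F x) k.
have e1b : `|er| <= K * n ^+ 2 * W * (4 * eta ^+ 2 * n ^+ 2).
  by apply: (le_trans T); rewrite ler_wpM2l// !mulr_ge0// exprn_ge0.
(* In the quadratic remainder one factor |k| is bounded by 2 n only; an increment of order eta is
   enough here. *)
have drho : `|rho u - rho x| <= 4 * (K ^+ 2 * n ^+ 3 * W) * (2 * eta * n).
  have -> : rho u - rho x = er + 2 * rho x * ip (F x) k by rewrite /er; ring.
  apply: (le_trans (ler_normD _ _)).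
  have t1 : `|er| <= K * n ^+ 2 * W * ((2 * n) * (2 * eta * n)).
    apply: (le_trans T); rewrite ler_wpM2l// ?mulr_ge0// ?exprn_ge0//.
    by rewrite expr2 ler_pM.
  have t2 : `|2 * rho x * ip (F x) k| <= 2 * (K * W) * (K * n * (2 * eta * n)).
    apply: normM_le; first by rewrite normrM ger0_norm// ler_wpM2l.
    by rewrite (le_trans (cauchy_schwarz ipP _ _))// ler_pM.
  apply: (le_trans (lerD t1 t2)).
  have h1 : K * (n ^+ 3 * W * (eta * n)) <= K ^+ 2 * (n ^+ 3 * W * (eta * n)).
    by rewrite ler_wpM2r ?mulr_ge0 ?exprn_ge0// expr2 ler_peMl.
  have h2 : n * (K ^+ 2 * W * (eta * n)) <= n ^+ 3 * (K ^+ 2 * W * (eta * n)).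
    rewrite ler_wpM2r ?mulr_ge0 ?exprn_ge0//.
    by rewrite -{1}(expr1 n) ler_weXn2l.
  lra.
have dfk : `|d x (df x k)| <= a * (K * (2 * eta * n)).
  by apply: (d_le _ C); rewrite (le_trans (dfK _ _))// ler_wpM2l.
pose r1 := rho u * d x (f u - f x - df x k).
pose r2 := (rho u - rho x) * d x (df x k).
pose r3 := er * d x (f x).
pose r4 := eta ^+ 2 * (rho x * d x (df x x) + 2 * rho x * ip (F x) x * d x (f x)).
have -> : rho u * d x (f u) - rho x * d x (f x)
    - s * (rho x * d x (df x y) + 2 * rho x * ip (F x) y * d x (f x))
  = r1 + r2 + r3 - r4.
  have E1 : d x (df x k) = - eta ^+ 2 * d x (df x x) + s * d x (df x y).
    by rewrite kE dfD !dfZ (C11_D C) !(C11_Z C).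
  have E2 : ip (F x) k = - eta ^+ 2 * ip (F x) x + s * ip (F x) y.
    by rewrite kE (ipDr ipP) !(ipZr ipP).
  by rewrite /r1 /r2 /r3 /r4 /er !(C11_B C) E1 E2; ring.
have P i j : (i <= 3)%N -> (j <= 6)%N -> K ^+ i * n ^+ j * W <= K ^+ 3 * dominant z.
  exact: bound_le.
set D := K ^+ 3 * dominant z in P *.
have D0 : 0 <= D by rewrite mulr_ge0 ?exprn_ge0.
have ae : 0 <= a * eta ^+ 2 by rewrite mulr_ge0 ?sqr_ge0.
have b1 : `|r1| <= 4 * (a * eta ^+ 2 * D).
  have t : `|r1| <= K * W * (a * (K * (4 * eta ^+ 2 * n ^+ 2))).
    apply: normM_le => //; apply: (d_le _ C); rewrite (le_trans (fT _ _))//.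
    by rewrite ler_wpM2l.
  apply: (le_trans t); have := ler_wpM2l ae (P 2%N 2%N isT isT); lra.
have b2 : `|r2| <= 16 * (a * eta ^+ 2 * D).
  apply: (le_trans (normM_le drho dfk)).
  have := ler_wpM2l ae (P 3%N 5%N isT isT); lra.
have b3 : `|r3| <= 4 * (a * eta ^+ 2 * D).
  apply: (le_trans (normM_le e1b (d_le x C fx))).
  have := ler_wpM2l ae (P 2%N 5%N isT isT); lra.
have b4 : `|r4| <= 3 * (a * eta ^+ 2 * D).
  rewrite normrM ger0_norm ?sqr_ge0//.
  have t1 : `|rho x * d x (df x x)| <= K * W * (a * (K * n)).
    apply: normM_le => //; apply: (d_le _ C); rewrite (le_trans (dfK _ _))//.
    by rewrite ler_wpM2l// fst_le.
  have t2 : `|2 * rho x * ip (F x) x * d x (f x)|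
      <= 2 * (K * W) * (K * n * n) * (a * (K * n)).
    apply: normM_le; last exact: (d_le _ C).
    apply: normM_le; first by rewrite normrM ger0_norm// ler_wpM2l.
    by apply: ipB => //; exact: fst_le.
  have t := ler_wpM2l (sqr_ge0 eta) (le_trans (ler_normD _ _) (lerD t1 t2)).
  apply: (le_trans t).
  have := ler_wpM2l ae (P 2%N 1%N isT isT).
  have := ler_wpM2l ae (P 3%N 3%N isT isT); lra.
apply: (le_trans (ler_normB _ _)); apply: (le_trans (lerD (ler_normD _ _) (lexx _))).
apply: (le_trans (lerD (lerD (ler_normD _ _) (lexx _)) (lexx _))).
lra.
Qed.

(* The rotation [(x, y) |-> (c x + s y, s x - c y)] moves the increment from the
   test function to [rho f], which is smooth enough for a gain of [1 - c]. *)
Lemma swap_gradient_term psi d a b eta c s : C11 psi d a b -> angle eta c s ->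
  `|rotated_gradient_term d c s - gradient_term d| <= 27 * a * eta ^+ 2 * K ^+ 3 * MB.
Proof.
move=> C an; have cs := angle_unit an.
have mfst : measurable_fun setT (fst : HH -> @BH R H) by exact: measurable_fst.
have msnd : measurable_fun setT (snd : HH -> @BH R H) by exact: measurable_snd.
have mu := measurable_rot1 c s.
have [i1 _] := gradient_dom C mfst mu mfst (@weight_fst) (@size_fst).
have [i2 _] := gradient_dom C mu mfst mu (fun z => weight_rot1 z cs) (fun z => size_rot1 z cs).
have [i3 _] := gradient_dom C mfst mfst mfst (@weight_fst) (@size_fst).
have -> : rotated_gradient_term d c s
    = mean2 nu (fun z => rho (rot1 c s z) * d z.1 (f (rot1 c s z))).
  rewrite /rotated_gradient_term (mean2_rotation ipP onb q0 qsum nuP cs i1).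
  apply: Rint_eq => -[x y]; rewrite /comp /rotation /=.
  by congr (_ * d _ _); rewrite /rot1 /= rotate_back.
pose g (z : HH) := rho z.1 * d z.1 (df z.1 z.2)
  + 2 * rho z.1 * ip (F z.1) z.2 * d z.1 (f z.1).
have mg : measurable_fun setT g.
  apply: measurable_funD; apply: measurable_funM.
  - exact: (mrho mfst).
  - exact: (md C mfst (mdf mfst msnd)).
  - apply: measurable_funM; last exact: (mF_ip mfst msnd).
    by apply: measurable_funM => //; exact: (mrho mfst).
  - exact: (md C mfst (mf mfst)).
have [ig _] : itg (nu \x nu)%E g /\ `|mean2 nu g| <= 3 * a * K ^+ 3 * MB.
  apply: mean2_le => // z.
  have n0 := size2_ge0 z; have W0 := weight2_ge0 z; have [[a0 _] _ _ _] := C.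
  have rx := rho_le (weight_fst z); have fx := f_le (size_fst z).
  have t1 : `|rho z.1 * d z.1 (df z.1 z.2)| <= K * weight2 z * (a * (K * size2 z)).
    apply: normM_le => //; apply: (d_le _ C); rewrite (le_trans (dfK _ _))//.
    by rewrite ler_wpM2l// snd_le.
  have t2 : `|2 * rho z.1 * ip (F z.1) z.2 * d z.1 (f z.1)|
      <= 2 * (K * weight2 z) * (K * size2 z * size2 z) * (a * (K * size2 z)).
    apply: normM_le; last exact: (d_le _ C).
    apply: normM_le; first by rewrite normrM ger0_norm// ler_wpM2l.
    rewrite (le_trans (cauchy_schwarz ipP _ _))// ler_pM// ?snd_le//.
    exact: F_le (size_fst z).
  apply: (le_trans (ler_normD _ _)); apply: (le_trans (lerD t1 t2)).
  have := ler_wpM2l a0 (bound_le z (isT : (2 <= 3)%N) (isT : (1 <= 6)%N)).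
  have := ler_wpM2l a0 (bound_le z (isT : (3 <= 3)%N) (isT : (3 <= 6)%N)).
  lra.
have gE : mean2 nu g = 0.
  apply: (mean2_odd ipP onb q0 qsum nuP ig) => x y.
  rewrite /g /= -scaleN1r dfZ (C11_Z C) (ipZr ipP); ring.
have -> : mean2 nu (fun z => rho (rot1 c s z) * d z.1 (f (rot1 c s z)))
    - gradient_term d
  = mean2 nu (fun z => rho (rot1 c s z) * d z.1 (f (rot1 c s z))
      - rho z.1 * d z.1 (f z.1) - s * g z).
  rewrite /mean2 RintB//; [|exact: itgB|exact: itgZ].
  by rewrite RintB// RintZ// -/(mean2 nu g) gE mulr0 subr0.
have mm := itg_measurable (itgB (itgB i2 i3) (itgZ s ig)).
have bb z : `|rho (rot1 c s z) * d z.1 (f (rot1 c s z)) - rho z.1 * d z.1 (f z.1)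
    - s * g z| <= 27 * a * eta ^+ 2 * K ^+ 3 * dominant z.
  by rewrite -[leRHS]mulrA; exact: swap_pointwise C an.
by have [] := mean2_le mm bb.
Qed.

Definition pairing (psi : H -> R) : R := mean2 nu (fun z => rho z.1 * psi z.1).

Definition rotated_pairing (psi : H -> R) (c s : R) : R :=
  mean2 nu (fun z => rho z.1 * psi (rot1 c s z)).

Let pairing_itg psi d a b (u v : HH -> @BH R H) : C11 psi d a b ->
  measurable_fun setT u -> measurable_fun setT v ->
  (forall z, expR (A * `|u z : H| ^+ 2) <= weight2 z) ->
  (forall z, 1 + `|v z : H| <= size2 z) ->
  itg (nu \x nu)%E (fun z => rho (u z) * psi (v z)).
Proof.
move=> C mu mv uW vn; have [[a0 _] _ _ _] := C.
have [] // := @mean2_le (fun z => rho (u z) * psi (v z)) ((`|psi 0| + a) * K ^+ 3).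
  by apply: measurable_funM; [exact: mrho|exact: (measurableT_comp (C11_measurable C) mv)].
move=> z.
have t : `|psi (v z)| <= (`|psi 0| + a) * size2 z.
  rewrite (le_trans (C11_growth C _))// mulrDl lerD//.
    by rewrite ler_peMr.
  by rewrite ler_wpM2l// (le_trans _ (vn z))// lerDr.
apply: (le_trans (normM_le (rho_le (uW z)) t)).
have c0 : 0 <= `|psi 0| + a by rewrite addr_ge0.
have := ler_wpM2l c0 (bound_le z (isT : (1 <= 3)%N) (isT : (1 <= 6)%N)); lra.
Qed.

(** Integrating over the noise first, the covariance Q / 2 of nu turns the product of the two linear
    forms into d x (Q F x) / 2. *)
Let gradient_square psi d a b : C11 psi d a b ->
  itg (nu \x nu)%E (fun z => rho z.1 * (ip (F z.1) z.2 * d z.1 z.2)) /\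
  2 * mean2 nu (fun z => rho z.1 * (ip (F z.1) z.2 * d z.1 z.2)) = gradient_term d.
Proof.
move=> C; have [[a0 _] _ _ _] := C.
have mfst : measurable_fun setT (fst : HH -> @BH R H) by exact: measurable_fst.
have msnd : measurable_fun setT (snd : HH -> @BH R H) by exact: measurable_snd.
have [i1 _] : itg (nu \x nu)%E (fun z => rho z.1 * (ip (F z.1) z.2 * d z.1 z.2)) /\
    `|mean2 nu (fun z => rho z.1 * (ip (F z.1) z.2 * d z.1 z.2))| <= a * K ^+ 3 * MB.
  apply: mean2_le => [|z].
    apply: measurable_funM; first exact: (mrho mfst).
    apply: measurable_funM; first exact: (mF_ip mfst msnd).
    exact: (md C mfst msnd).
  have t : `|ip (F z.1) z.2| <= K * size2 z * size2 z.
    rewrite (le_trans (cauchy_schwarz ipP _ _))// ler_pM// ?snd_le//.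
    exact: F_le (size_fst z).
  apply: (le_trans (normM_le (rho_le (weight_fst z))
    (normM_le t (d_le z.1 C (snd_le z))))).
  have := ler_wpM2l a0 (bound_le z (isT : (2 <= 3)%N) (isT : (3 <= 6)%N)); lra.
split => //.
have ml x : measurable_fun (setT : set (@BH R H)) (d x).
  by apply: (C11_measurable_diff C ipP onb (u := fun=> x) (w := id)).
have ii x : itg nu (fun y : @BH R H => ip (F x) y * d x y).
  apply: (@itg_dom _ _ _ nu _ (fun y : @BH R H => (`|F x| * a) * `|y : H| ^+ 2)).
  - by apply: measurable_funM => //; exact: measurable_ip.
  - move=> y; rewrite expr2 mulrACA; apply: normM_le; first exact: cauchy_schwarz.
    exact: C11_bound C _ _.
  - exact: itgZ.
have [i2 _] := gradient_dom C mfst mfst mfst (@weight_fst) (@size_fst).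
rewrite /gradient_term (mean2_fubini i1) => [|x]; last exact: (itgZ (rho x) (ii x)).
rewrite (mean2_fubini i2) => [|x]; last exact: (itg_cst nu (rho x * d x (f x))).
rewrite -RintZ; last by have [] := Rint_fubini i1 (fun x => itgZ (rho x) (ii x)).
apply: Rint_eq => x.
transitivity (2 * (rho x * Rintegral nu setT (fun y => ip (F x) y * d x y))).
  by rewrite -(RintZ (rho x) (ii x)).
transitivity (rho x * d x (f x)); last first.
  by apply/esym; exact: (Rint_cst nu (rho x * d x (f x))).
rewrite (gaussian_second_moment ipP onb q0 qsum nuP nu2 (F x) a0 (C11_DZ C x) (C11_bound C x) (ml x)).
by rewrite fF /=; field.
Qed.

(** The product of the increments is expanded to second order in the displacement - eta^2 x + s y.
    The mixed term, of order s eta^2, is odd in y and is therefore kept apart from the cubic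
    error. *)
Let dirichlet_pointwise psi d a b eta c s z : C11 psi d a b -> angle eta c s ->
  `|(rho (rot1 c s z) - rho z.1) * (psi (rot1 c s z) - psi z.1)
    - s ^+ 2 * (2 * (rho z.1 * (ip (F z.1) z.2 * d z.1 z.2)))
    + s * eta ^+ 2 * (2 * rho z.1 * (ip (F z.1) z.1 * d z.1 z.2 + ip (F z.1) z.2 * d z.1 z.1))|
  <= 18 * (a + b) * eta ^+ 3 * (K ^+ 3 * dominant z).
Proof.
move=> C an; set u : H := rot1 c s z; set x : H := z.1; set y : H := z.2.
have [[a0 b0] lip _ tay] := C.
have [/andP[e0 e1] _ s0 _] := an.
have cs := angle_unit an.
set k := u - x; have kE : k = (- eta ^+ 2) *: x + s *: y by exact: rot1_sub.
have kn : `|k| <= 2 * eta * size2 z by exact: rot1_dist.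
set n := size2 z in kn *; set W := weight2 z.
have n1 : 1 <= n by exact: size2_ge1.
have n0 : 0 <= n by exact: size2_ge0.
have W0 : 0 <= W by exact: weight2_ge0.
have kn2 : `|k| ^+ 2 <= 4 * eta ^+ 2 * n ^+ 2.
  have -> : 4 * eta ^+ 2 * n ^+ 2 = (2 * eta * n) ^+ 2 by ring.
  by apply: lerXn2r => //; rewrite nnegrE ?mulr_ge0.
have rx : `|rho x| <= K * W by apply: rho_le; exact: weight_fst.
have Fx : `|F x| <= K * n by apply: F_le; exact: size_fst.
have xn : `|x| <= n by exact: fst_le.
have T := rhoT (size_fst z) (size_rot1 z cs) (weight_fst z) (weight_rot1 z cs).
rewrite -/u -/x -/k -/n -/W in T.
pose er := rho u - rho x - 2 * rho x * ip (F x) k.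
have erb : `|er| <= K * n ^+ 2 * W * (4 * eta ^+ 2 * n ^+ 2).
  by apply: (le_trans T); rewrite ler_wpM2l// !mulr_ge0// exprn_ge0.
pose ep := psi u - psi x - d x k.
have epb : `|ep| <= b * (4 * eta ^+ 2 * n ^+ 2).
  by apply: (le_trans (tay x u)); rewrite ler_wpM2l.
pose r1 := er * (psi u - psi x).
pose r2 := 2 * rho x * ip (F x) k * ep.
pose r3 := eta ^+ 4 * (2 * rho x * (ip (F x) x * d x x)).
have -> : (rho u - rho x) * (psi u - psi x)
    - s ^+ 2 * (2 * (rho x * (ip (F x) y * d x y)))
    + s * eta ^+ 2 * (2 * rho x * (ip (F x) x * d x y + ip (F x) y * d x x))
  = r1 + r2 + r3.
  have E1 : d x k = - eta ^+ 2 * d x x + s * d x y.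
    by rewrite kE (C11_D C) !(C11_Z C).
  have E2 : ip (F x) k = - eta ^+ 2 * ip (F x) x + s * ip (F x) y.
    by rewrite kE (ipDr ipP) !(ipZr ipP).
  by rewrite /r1 /r2 /r3 /er /ep E1 E2; ring.
have P i j : (i <= 3)%N -> (j <= 6)%N -> K ^+ i * n ^+ j * W <= K ^+ 3 * dominant z.
  exact: bound_le.
set D := K ^+ 3 * dominant z in P *.
have D0 : 0 <= D by rewrite mulr_ge0 ?exprn_ge0.
have e3 : 0 <= eta ^+ 3 by rewrite exprn_ge0.
have ae : 0 <= a * eta ^+ 3 by rewrite mulr_ge0.
have be : 0 <= b * eta ^+ 3 by rewrite mulr_ge0.
have rx2 : `|2 * rho x| <= 2 * (K * W) by rewrite normrM ger0_norm// ler_wpM2l.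
have b1 : `|r1| <= 8 * (a * eta ^+ 3 * D).
  have t : `|psi u - psi x| <= a * (2 * eta * n).
    by apply: (le_trans (lip x u)); rewrite ler_wpM2l.
  apply: (le_trans (normM_le erb t)).
  have := ler_wpM2l ae (P 1%N 5%N isT isT); lra.
have b2 : `|r2| <= 16 * (b * eta ^+ 3 * D).
  have t : `|ip (F x) k| <= K * n * (2 * eta * n).
    by rewrite (le_trans (cauchy_schwarz ipP _ _))// ler_pM.
  apply: (le_trans (normM_le (normM_le rx2 t) epb)).
  have := ler_wpM2l be (P 2%N 4%N isT isT); lra.
have b3 : `|r3| <= 2 * (a * eta ^+ 3 * D).
  have t : `|ip (F x) x| <= K * n * n.
    by rewrite (le_trans (cauchy_schwarz ipP _ _))// ler_pM.
  have e4 : `|eta ^+ 4| <= eta ^+ 3.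
    by rewrite ger0_norm ?exprn_ge0// exprS ler_piMl.
  apply: (le_trans (normM_le e4 (normM_le rx2 (normM_le t (d_le x C xn))))).
  have := ler_wpM2l ae (P 2%N 3%N isT isT); lra.
apply: (le_trans (ler_normD _ _)); apply: (le_trans (lerD (ler_normD _ _) (lexx _))).
have := mulr_ge0 ae D0; have := mulr_ge0 be D0; lra.
Qed.

(** The discrete Dirichlet form: exchanging the point with its rotated image shows that the mean of
    the product of increments [h] is twice the difference of the pairings. *)
Lemma ou_first_order psi d a b eta c s : C11 psi d a b -> angle eta c s ->
  `|pairing psi - rotated_pairing psi c s - eta ^+ 2 * gradient_term d|
  <= 10 * (a + b) * eta ^+ 3 * (K ^+ 3 * MB).
Proof.
move=> C an; have cs := angle_unit an; have [[a0 b0] _ _ _] := C.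
have [/andP[e0 e1] _ s0 sE] := an.
have mfst : measurable_fun setT (fst : HH -> @BH R H) by exact: measurable_fst.
have msnd : measurable_fun setT (snd : HH -> @BH R H) by exact: measurable_snd.
have mu := measurable_rot1 c s.
have wu z := weight_rot1 z cs; have su z := size_rot1 z cs.
have i1 := pairing_itg C mfst mfst (@weight_fst) (@size_fst).
have i2 := pairing_itg C mfst mu (@weight_fst) su.
have i3 := pairing_itg C mu mfst wu (@size_fst).
have i4 := pairing_itg C mu mu wu su.
have E1 : pairing psi = mean2 nu (fun z => rho (rot1 c s z) * psi (rot1 c s z)).
  exact: (mean2_rotation ipP onb q0 qsum nuP cs i1).
have E2 : rotated_pairing psi c s = mean2 nu (fun z => rho (rot1 c s z) * psi z.1).
  rewrite /rotated_pairing (mean2_rotation ipP onb q0 qsum nuP cs i2).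
  apply: Rint_eq => -[x y]; rewrite /comp /rotation /=.
  by congr (_ * psi _); rewrite /rot1 /= rotate_back.
pose g0 (z : HH) := rho z.1 * (ip (F z.1) z.2 * d z.1 z.2).
pose g (z : HH) := 2 * rho z.1
  * (ip (F z.1) z.1 * d z.1 z.2 + ip (F z.1) z.2 * d z.1 z.1).
have [ig0 g0E] := gradient_square C.
have [ig _] : itg (nu \x nu)%E g /\ `|mean2 nu g| <= 4 * a * K ^+ 3 * MB.
  apply: mean2_le => [|z].
    apply: measurable_funM; first by apply: measurable_funM => //; exact: (mrho mfst).
    apply: measurable_funD; apply: measurable_funM.
    - exact: (mF_ip mfst mfst).
    - exact: (md C mfst msnd).
    - exact: (mF_ip mfst msnd).
    - exact: (md C mfst mfst).
  have n0 := size2_ge0 z.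
  have rx2 : `|2 * rho z.1| <= 2 * (K * weight2 z).
    by rewrite normrM ger0_norm// ler_wpM2l// rho_le// weight_fst.
  have t w : `|w| <= size2 z -> `|ip (F z.1) w| <= K * size2 z * size2 z.
    move=> wn; rewrite (le_trans (cauchy_schwarz ipP _ _))// ler_pM//.
    exact: F_le (size_fst z).
  have t1 := normM_le (t _ (fst_le z)) (d_le z.1 C (snd_le z)).
  have t2 := normM_le (t _ (snd_le z)) (d_le z.1 C (fst_le z)).
  apply: (le_trans (normM_le rx2 (le_trans (ler_normD _ _) (lerD t1 t2)))).
  have := ler_wpM2l a0 (bound_le z (isT : (2 <= 3)%N) (isT : (3 <= 6)%N)); lra.
have gE : mean2 nu g = 0.
  apply: (mean2_odd ipP onb q0 qsum nuP ig) => x y.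
  by rewrite /g /= (C11_N C) (ipNr ipP); ring.
pose h (z : HH) := (rho (rot1 c s z) - rho z.1) * (psi (rot1 c s z) - psi z.1).
have ih : itg (nu \x nu)%E h.
  apply: eq_itg (itgB (itgB i4 i3) (itgB i2 i1)) => z; rewrite /h; ring.
have hE : mean2 nu h = 2 * (pairing psi - rotated_pairing psi c s).
  transitivity (mean2 nu (fun z => (rho (rot1 c s z) * psi (rot1 c s z)
      - rho (rot1 c s z) * psi z.1) - (rho z.1 * psi (rot1 c s z) - rho z.1 * psi z.1))).
    by apply: Rint_eq => z; rewrite /h; ring.
  rewrite /mean2 (RintB (itgB i4 i3) (itgB i2 i1)) (RintB i4 i3) (RintB i2 i1).
  rewrite -!/(mean2 nu _) -E1 -E2 -/(pairing psi) -/(rotated_pairing psi c s); ring.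
have ir := itgD (itgB ih (itgZ (s ^+ 2) (itgZ 2 ig0))) (itgZ (s * eta ^+ 2) ig).
have bb z : `|h z - s ^+ 2 * (2 * g0 z) + s * eta ^+ 2 * g z|
    <= 18 * (a + b) * eta ^+ 3 * K ^+ 3 * dominant z.
  by rewrite -[leRHS]mulrA; exact: dirichlet_pointwise C an.
have [_] := mean2_le (itg_measurable ir) bb.
rewrite /mean2 (RintD (itgB ih (itgZ (s ^+ 2) (itgZ 2 ig0))) (itgZ (s * eta ^+ 2) ig)).
rewrite (RintB ih (itgZ (s ^+ 2) (itgZ 2 ig0))) (RintZ _ (itgZ 2 ig0)) (RintZ _ ig0).
rewrite (RintZ _ ig) -!/(mean2 nu _) gE hE g0E sE.
set B := gradient_term d; have Bb : `|B| <= a * K ^+ 3 * MB := gradient_term_le C.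
set p := pairing psi; set pr := rotated_pairing psi c s.
move=> big.
have e4 : `|eta ^+ 4 * B| <= eta ^+ 3 * (a * K ^+ 3 * MB).
  by apply: normM_le => //; rewrite ger0_norm ?exprn_ge0// exprS ler_piMl ?exprn_ge0.
have kd : 0 <= b * eta ^+ 3 * (K ^+ 3 * MB) by rewrite !mulr_ge0 ?exprn_ge0.
have kd' : 0 <= a * eta ^+ 3 * (K ^+ 3 * MB) by rewrite !mulr_ge0 ?exprn_ge0.
(* Here s^2 = 2 eta^2 - eta^4. After division by 2 the bound 18 becomes 9, and the eta^4 term adds
   at most a / 2, below the claimed 10. *)
move: big e4; rewrite !ler_norml => /andP[? ?] /andP[? ?].
by apply/andP; split; lra.
Qed.

Let C11_weaken (psi : H -> R) d (a b a' b' : R) : a <= a' -> b <= b' -> C11 psi d a b -> C11 psi d a' b'.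
Proof.
move=> aa bb [[a0 b0] lip lin tay]; split => //.
- by split; [exact: le_trans aa|exact: le_trans bb].
- by move=> x y; rewrite (le_trans (lip x y))// ler_wpM2r.
- by move=> x y; rewrite (le_trans (tay x y))// ler_wpM2r ?sqr_ge0.
Qed.

(** The Ornstein-Uhlenbeck semigroup T_c in Mehler's form. *)
Definition ou (c s : R) (psi : H -> R) := kernel nu (fun x => c *: x) s psi.

Definition ou_diff (c s : R) (d : H -> H -> R) :=
  kernel_diff nu (fun x => c *: x) (fun _ k => c *: k) s d.

(** Neither constant grows, so that estimates for [psi] apply unchanged to T_c psi in the recursion
    on c. *)
Let ou_C11 psi d a b c s : 0 <= c <= 1 -> C11 psi d a b ->
  C11 (ou c s psi) (ou_diff c s d) a b.
Proof.
move=> /andP[c0 c1] C; have [[a0 b0] _ _ _] := C.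
have := @kernel_C11 _ _ _ _ ipP onb nu nu1 psi d a b (fun x => c *: x)
  (fun _ k => c *: k) s c 0 C c0 (lexx 0).
have lip x y : `|c *: y - c *: x : H| <= c * `|y - x|.
  by rewrite -scalerBr normrZ ger0_norm.
have lin (x : H) t (u v : H) : c *: (t *: u + v) = t *: (c *: u) + c *: v.
  by rewrite scalerDr !scalerA mulrC.
have tay (x y : H) : `|c *: y - c *: x - c *: (y - x)| <= 0 * `|y - x| ^+ 2.
  by rewrite -scalerBr subrr normr0 mul0r.
move=> /(_ lip lin tay); apply: C11_weaken; first by rewrite ler_piMr.
by rewrite mulr0 addr0 ler_piMr// exprn_ile1.
Qed.

Let pairing_ou psi d a b eta c s : C11 psi d a b -> angle eta c s ->
  pairing (ou c s psi) = rotated_pairing psi c s.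
Proof.
move=> C an; have cs := angle_unit an.
have mfst : measurable_fun setT (fst : HH -> @BH R H) by exact: measurable_fst.
have mu := measurable_rot1 c s.
have i2 := pairing_itg C mfst mu (@weight_fst) (fun z => size_rot1 z cs).
have [/andP[e0 e1] cE _ _] := an.
have c01 : 0 <= c <= 1.
  have e2 : eta ^+ 2 <= 1 by rewrite exprn_ile1.
  by have ee := sqr_ge0 eta; rewrite cE; apply/andP; split; lra.
have i1 := pairing_itg (ou_C11 s c01 C) mfst mfst (@weight_fst) (@size_fst).
have ii x : itg nu (fun y => psi (c *: (x : H) + s *: (y : H))).
  exact: (kernel_itg ipP onb nu1 (c *: x) s C).
rewrite /pairing (mean2_fubini i1) => [|x]; last exact: (itg_cst nu (rho x * ou c s psi x)).
rewrite /rotated_pairing (mean2_fubini i2) => [|x]; last exact: (itgZ (rho x) (ii x)).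
apply: Rint_eq => x; transitivity (rho x * ou c s psi x).
  exact: (Rint_cst nu (rho x * ou c s psi x)).
by rewrite -(RintZ (rho x) (ii x)).
Qed.

Let gradient_term_ou psi d a b eta c s : C11 psi d a b -> angle eta c s ->
  gradient_term (ou_diff c s d) = c * rotated_gradient_term d c s.
Proof.
move=> C an; have cs := angle_unit an.
have mfst : measurable_fun setT (fst : HH -> @BH R H) by exact: measurable_fst.
have mu := measurable_rot1 c s.
have [i2 _] := gradient_dom C mfst mu mfst (@weight_fst) (@size_fst).
have [/andP[e0 e1] cE _ _] := an.
have c01 : 0 <= c <= 1.
  have e2 : eta ^+ 2 <= 1 by rewrite exprn_ile1.
  by have ee := sqr_ge0 eta; rewrite cE; apply/andP; split; lra.
have [i1 _] := gradient_dom (ou_C11 s c01 C) mfst mfst mfst (@weight_fst) (@size_fst).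
have ii x k : itg nu (fun y => d (c *: (x : H) + s *: (y : H)) k).
  exact: (kernel_diff_itg ipP onb nu (c *: x) k s C).
rewrite /gradient_term (mean2_fubini i1) => [|x]; last first.
  exact: (itg_cst nu (rho x * ou_diff c s d x (f x))).
rewrite /rotated_gradient_term (mean2_fubini i2) => [|x]; last first.
  exact: (itgZ (rho x) (ii x (f x))).
rewrite -RintZ; last first.
  by have [] := Rint_fubini i2 (fun x => itgZ (rho x) (ii x (f x))).
apply: Rint_eq => x; transitivity (rho x * ou_diff c s d x (f x)).
  exact: (Rint_cst nu (rho x * ou_diff c s d x (f x))).
transitivity (c * (rho x * Rintegral nu setT (fun y => d (c *: (x : H) + s *: (y : H)) (f x)))).
  rewrite mulrCA; congr (_ * _); rewrite /ou_diff /kernel_diff -RintZ//.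
  by apply: Rint_eq => y; rewrite (C11_Z C).
by rewrite -(RintZ (rho x) (ii x (f x))).
Qed.

(** The two independent noises add up to c' s' y + s' z. The reflection with coefficients [al] and
    [be] makes this s times a single noise, as s'^2 (1 + c'^2) = 1 - c^2 = s^2. *)
Let ou_semigroup psi d a b c s c' s' x : C11 psi d a b ->
  c' ^+ 2 + s' ^+ 2 = 1 -> c = c' ^+ 2 -> c ^+ 2 + s ^+ 2 = 1 -> s != 0 ->
  ou c' s' (ou c' s' psi) x = ou c s psi x.
Proof.
move=> C cs' cc cs s0; have [[a0 _] _ _ _] := C.
pose al := c' * s' / s; pose be := s' / s.
have ab : al ^+ 2 + be ^+ 2 = 1.
  have -> : al ^+ 2 + be ^+ 2 = s' ^+ 2 * (1 + c' ^+ 2) / s ^+ 2.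
    by rewrite /al /be; field.
  have -> : s' ^+ 2 = 1 - c' ^+ 2 by rewrite -cs'; ring.
  have -> : (1 - c' ^+ 2) * (1 + c' ^+ 2) = s ^+ 2 by move: cs; rewrite cc => h; lra.
  by rewrite divff// expf_neq0.
pose g (w : HH) := psi (c *: (x : H) + s *: (w.1 : H)).
have mg : measurable_fun setT g.
  apply: (measurableT_comp (C11_measurable C)).
  apply: (measurable_BH_D ipP onb); first by [].
  by apply: (measurable_BH_Z ipP onb); exact: measurable_fst.
have ig : itg (nu \x nu)%E g.
  apply: (@itg_dom _ _ _ _ _ (fun w : HH => (`|psi 0| + a * `|c *: (x : H)|)
      + (a * `|s|) * `|w.1 : H|)) => //.
  - move=> w; rewrite (le_trans (C11_growth C _))// -!addrA lerD2l -mulrA -mulrDr.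
    by rewrite ler_wpM2l// (le_trans (ler_normD _ _))// (normrZ s).
  - apply: itgD; first exact: itg_cst.
    apply: itgZ; apply: (eq_itg _ (itg_mul nu1 (itg_cst nu 1))) => w.
    by rewrite mulr1.
have E1 : ou c s psi x = mean2 nu g.
  rewrite (mean2_fubini ig) => [|y]; last exact: (itg_cst nu (psi (c *: x + s *: y))).
  apply: Rint_eq => y; apply/esym; exact: (Rint_cst nu (psi (c *: x + s *: y))).
have ir := itg_rotation ipP onb q0 qsum nuP ab ig.
have pE (y z : H) : g (rotation al be (y, z)) = psi (c' *: (c' *: x + s' *: y) + s' *: z).
  rewrite /g /rotation /=; congr psi; rewrite !scalerDr !scalerA -addrA cc expr2.
  by congr (_ + (_ *: _ + _ *: _)); rewrite /al /be; field.
rewrite E1 (mean2_rotation ipP onb q0 qsum nuP ab ig) (mean2_fubini ir) => [|y].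
  by apply: Rint_eq => y; apply: Rint_eq => z; rewrite /comp pE.
apply: (eq_itg (f := fun z : @BH R H => psi (c' *: (c' *: x + s' *: y) + s' *: (z : H)))).
  by move=> z; rewrite /comp pE.
exact: (kernel_itg ipP onb nu1 _ s' C).
Qed.

Let ou_error psi (d : H -> H -> R) (eta c s : R) :=
  pairing psi - rotated_pairing psi c s - eta ^+ 2 * gradient_term d.

(** Insert T_(c') psi between psi and T_c psi. Because eta^2 = eta'^2 (1 + c'), the gradient terms
    match except for eta'^2 c' times the difference controlled by [swap_gradient_term], which is of
    order eta'^4. *)
Let ou_error_halving psi d a b eta c s eta' c' s' : C11 psi d a b ->
  angle eta c s -> angle eta' c' s' -> 0 <= c' -> c = c' ^+ 2 -> s != 0 ->
  `|ou_error psi d eta c s| <= `|ou_error psi d eta' c' s'|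
    + `|ou_error (ou c' s' psi) (ou_diff c' s' d) eta' c' s'|
    + 27 * a * eta' ^+ 4 * (K ^+ 3 * MB).
Proof.
move=> C an an' c'0 cc s0; have [[a0 b0] _ _ _] := C.
have c'1 : 0 <= c' <= 1.
  by rewrite c'0; have [_ -> _ _] := an'; have := sqr_ge0 eta'; lra.
have C' := ou_C11 s' c'1 C.
have E : rotated_pairing (ou c' s' psi) c' s' = rotated_pairing psi c s.
  rewrite -(pairing_ou C' an') -(pairing_ou C an); apply: Rint_eq => z.
  by rewrite (ou_semigroup z.1 C (angle_unit an') cc (angle_unit an) s0).
have sw := swap_gradient_term C an'.
have ee : eta ^+ 2 = eta' ^+ 2 * (1 + c').
  have h : eta ^+ 2 = 1 - c by have [_ -> _ _] := an; ring.
  have h' : eta' ^+ 2 = 1 - c' by have [_ -> _ _] := an'; ring.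
  by rewrite h h' cc; ring.
set t := rotated_gradient_term d c' s' - gradient_term d in sw.
have -> : ou_error psi d eta c s = ou_error psi d eta' c' s'
    + ou_error (ou c' s' psi) (ou_diff c' s' d) eta' c' s' + eta' ^+ 2 * (c' * t).
  rewrite /ou_error E (pairing_ou C an') (gradient_term_ou C an') ee /t; ring.
apply: (le_trans (ler_normD _ _)); rewrite lerD//; first exact: ler_normD.
rewrite normrM ger0_norm ?sqr_ge0//.
have -> : 27 * a * eta' ^+ 4 * (K ^+ 3 * MB)
  = eta' ^+ 2 * (27 * a * eta' ^+ 2 * K ^+ 3 * MB) by ring.
rewrite ler_wpM2l ?sqr_ge0// normrM ger0_norm// (le_trans _ sw)//.
by rewrite ler_piMl//; case/andP: c'1.
Qed.

(* [19 / 20] comes from [2 * eta' ^ 3 <= 19 / 20 * eta ^ 3] for [eta ^ 2 = eta' ^ 2 * (1 + sqrt c)]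
   and [1 / 2 <= c]. *)
Let ou_error_iter n psi d a b eta c s : C11 psi d a b -> angle eta c s ->
  2^-1 <= c -> 0 < eta ->
  `|ou_error psi d eta c s|
  <= ((19 / 20) ^+ n * (10 * (a + b) * eta ^+ 3) + 54 * a * eta ^+ 4) * (K ^+ 3 * MB).
Proof.
have G0 : 0 <= K ^+ 3 * MB by exact: (mulr_ge0 (exprn_ge0 3 K0) MB_ge0).
elim: n psi d eta c s => [|n IH] psi d eta c s C an c2 e0.
  have [[a0 b0] _ _ _] := C.
  apply: (le_trans (ou_first_order C an)); rewrite ler_wpM2r// expr0 mul1r lerDl.
  by apply: mulr_ge0; [exact: mulr_ge0|apply: exprn_ge0; exact: ltW].
have [[a0 b0] _ _ _] := C.
have [/andP[_ e1] cE s0 sE] := an.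
have cc0 : 0 < c by rewrite (lt_le_trans _ c2)// invr_gt0.
have e2p : 0 < eta ^+ 2 by rewrite exprn_gt0.
pose c' := Num.sqrt c; have cc : c = c' ^+ 2 by rewrite sqr_sqrtr// ltW.
have c'0 : 0 <= c' by rewrite sqrtr_ge0.
have c'1 : c' < 1.
  by rewrite -(@ltr_pXn2r _ 2)// ?nnegrE// -cc expr1n cE; lra.
have c'7 : 7 / 10 <= c'.
  by rewrite -(@ler_pXn2r _ 2)// ?nnegrE ?divr_ge0// -cc; lra.
pose eta' := Num.sqrt (1 - c').
have e'E : eta' ^+ 2 = 1 - c' by rewrite sqr_sqrtr// subr_ge0 ltW.
have e'0 : 0 < eta' by rewrite sqrtr_gt0 subr_gt0.
have e'1 : eta' <= 1 by rewrite -(@ler_pXn2r _ 2)// ?nnegrE ?ltW// e'E expr1n; lra.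
pose s' := Num.sqrt (1 - c' ^+ 2).
have s'E : s' ^+ 2 = 1 - c' ^+ 2 by rewrite sqr_sqrtr// -cc cE; lra.
have an' : angle eta' c' s'.
  split; [by rewrite (ltW e'0) e'1|by rewrite e'E; ring|exact: sqrtr_ge0|].
  by rewrite s'E e'E; ring.
have sn0 : s != 0.
  apply/eqP => s0'; move: sE; rewrite s0' expr0n /= => /esym/eqP.
  by rewrite mulf_eq0 gt_eqF//=; apply/negP; rewrite gt_eqF//; lra.
have c'2 : 2^-1 <= c' by lra.
have C' := ou_C11 s' (_ : 0 <= c' <= 1) C.
have {}C' : C11 (ou c' s' psi) (ou_diff c' s' d) a b by apply: C'; rewrite c'0 ltW.
have halving := ou_error_halving C an an' c'0 cc sn0.
have h1 := IH _ _ _ _ _ C an' c'2 e'0.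
have h2 := IH _ _ _ _ _ C' an' c'2 e'0.
apply: (le_trans halving); apply: (le_trans (lerD (lerD h1 h2) (lexx _))).
set th := (19 / 20) ^+ n; have th0 : 0 <= th by rewrite exprn_ge0.
have ee : eta ^+ 2 = eta' ^+ 2 * (1 + c').
  have h : eta ^+ 2 = 1 - c by rewrite cE; ring.
  by rewrite e'E h [in LHS]cc; ring.
have x2 : eta' ^+ 2 * (17 / 10) <= eta ^+ 2 by rewrite ee ler_wpM2l ?sqr_ge0//; lra.
have k3 : 2 * eta' ^+ 3 <= 19 / 20 * eta ^+ 3.
  have y0 : 0 <= 19 / 20 * eta ^+ 3 by rewrite mulr_ge0 ?exprn_ge0 ?ltW//; lra.
  rewrite -(@ler_pXn2r _ 2)// ?nnegrE//; last by rewrite mulr_ge0 ?exprn_ge0 ?ltW.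
  have : (eta' ^+ 2 * (17 / 10)) ^+ 3 <= (eta ^+ 2) ^+ 3.
    apply: lerXn2r => //; rewrite nnegrE; last exact: sqr_ge0.
    by apply: mulr_ge0; [exact: sqr_ge0|lra].
  have := exprn_ge0 3 (sqr_ge0 eta').
  have := exprn_ge0 3 (sqr_ge0 eta).
  lra.
(* Two copies of the bound 54 and the new 27 make 135; this is absorbed since 135 / 54 = 5 / 2 is
   less than (17 / 10)^2. *)
have k4 : 135 * eta' ^+ 4 <= 54 * eta ^+ 4.
  have : (eta' ^+ 2 * (17 / 10)) ^+ 2 <= (eta ^+ 2) ^+ 2.
    apply: lerXn2r => //; rewrite nnegrE; last exact: sqr_ge0.
    by apply: mulr_ge0; [exact: sqr_ge0|lra].
  have := exprn_ge0 2 (sqr_ge0 eta').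
  have := exprn_ge0 2 (sqr_ge0 eta).
  lra.
rewrite [(19 / 20) ^+ n.+1]exprSr -/th -mulrDl -mulrDl ler_wpM2r//.
have w0 : 0 <= th * (10 * (a + b)) by rewrite !mulr_ge0// addr_ge0.
have := ler_wpM2l w0 k3; have := ler_wpM2l a0 k4; lra.
Qed.

(** For c >= 1 / 2 the number of halvings tends to infinity and only the eta^4 term survives.
    Otherwise eta >= 1 / 2, and the first-order bound already has the right order. *)
Lemma ou_second_order psi d a b eta c s : C11 psi d a b -> angle eta c s -> 0 < eta ->
  `|pairing psi - rotated_pairing psi c s - eta ^+ 2 * gradient_term d|
  <= 54 * (a + b) * eta ^+ 4 * (K ^+ 3 * MB).
Proof.
move=> C an e0; have [[a0 b0] _ _ _] := C.
have G0 : 0 <= K ^+ 3 * MB by exact: (mulr_ge0 (exprn_ge0 3 K0) MB_ge0).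
have [/andP[_ e1] cE s0 sE] := an.
have [c2|c2] := leP (2^-1) c; last first.
  apply: (le_trans (ou_first_order C an)); rewrite ler_wpM2r//.
  have e2 : 2^-1 <= eta.
    rewrite -(@ler_pXn2r _ 2)// ?nnegrE ?invr_ge0 ?ltW//.
    by rewrite exprVn; move: c2; rewrite cE; lra.
  have e3 : 0 <= eta ^+ 3 by rewrite exprn_ge0// ltW.
  have w0 : 0 <= (a + b) * eta ^+ 3 by rewrite mulr_ge0// addr_ge0.
  have w1 : 0 <= (a + b) * eta ^+ 3 * eta by rewrite mulr_ge0// ltW.
  have := ler_wpM2l w0 e2; lra.
apply: (@le_trans _ _ (54 * a * eta ^+ 4 * (K ^+ 3 * MB))); last first.
  rewrite ler_wpM2r//; apply: ler_wpM2r; last lra.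
  by apply: exprn_ge0; exact: ltW.
set X := `|_|.
have lim : ((19 / 20) ^+ n * (10 * (a + b) * eta ^+ 3) + 54 * a * eta ^+ 4) * (K ^+ 3 * MB)
    @[n --> \oo] --> (0 * (10 * (a + b) * eta ^+ 3) + 54 * a * eta ^+ 4) * (K ^+ 3 * MB).
  apply: cvgM; last exact: cvg_cst.
  apply: cvgD; last exact: cvg_cst.
  apply: cvgM; last exact: cvg_cst.
  by apply: cvg_expr; rewrite ger0_norm; lra.
rewrite mul0r add0r in lim; rewrite -(cvg_lim _ lim)//.
apply: limr_ge; first exact: cvgP lim.
by near=> n; exact: ou_error_iter C an c2 e0.
Unshelve. all: by end_near. Qed.

(** [dl] is the excess of the Euler noise over the noise of T_c. It is only of order eta^3, so its
    linear effect is split off with the differential frozen at c x, where it is odd in the noise;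
    moving the base point there costs another eta by [C11_lip]. *)
Let euler_pointwise psi d a b eta c s dl z : C11 psi d a b -> angle eta c s ->
  0 <= dl -> dl <= eta ^+ 3 ->
  `|rho z.1 * psi ((c *: (z.1 : H) + eta ^+ 2 *: f z.1) + (s + dl) *: (z.2 : H))
    - rho z.1 * psi (rot1 c s z) - eta ^+ 2 * (rho z.1 * d (rot1 c s z) (f z.1))
    - dl * (rho z.1 * d (c *: (z.1 : H)) z.2)|
  <= 16 * b * eta ^+ 4 * (K ^+ 3 * dominant z).
Proof.
move=> C an dl0 dle; set u : H := rot1 c s z; set x : H := z.1; set y : H := z.2.
have [[a0 b0] lip _ tay] := C.
have [/andP[e0 e1] _ s0 _] := an.
set n := size2 z; set W := weight2 z.
have n1 : 1 <= n by exact: size2_ge1.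
have n0 : 0 <= n by exact: size2_ge0.
have W0 : 0 <= W by exact: weight2_ge0.
have rx : `|rho x| <= K * W by apply: rho_le; exact: weight_fst.
have fx : `|f x| <= K * n by apply: f_le; exact: size_fst.
have yn : `|y| <= n by exact: snd_le.
have P i j : (i <= 3)%N -> (j <= 6)%N -> K ^+ i * n ^+ j * W <= K ^+ 3 * dominant z.
  exact: bound_le.
set D := K ^+ 3 * dominant z in P *.
set w := c *: x + eta ^+ 2 *: f x + (s + dl) *: y.
set k := w - u; have kE : k = eta ^+ 2 *: f x + dl *: y.
  rewrite /k /w /u /rot1 -/x -/y scalerDl; apply/eqP; rewrite subr_eq; apply/eqP.
  by rewrite -!addrA addrCA; congr (_ + _); rewrite addrA addrC.
have dle2 : dl <= eta ^+ 2.
  by rewrite (le_trans dle)// exprS ler_piMl// exprn_ge0.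
have kn : `|k| <= 2 * eta ^+ 2 * (K * n).
  rewrite kE (le_trans (ler_normD _ _))// !normrZ (ger0_norm dl0).
  rewrite ger0_norm ?sqr_ge0//.
  have t1 : eta ^+ 2 * `|f x| <= eta ^+ 2 * (K * n) by rewrite ler_wpM2l ?sqr_ge0.
  have t2 : dl * `|y| <= eta ^+ 2 * (K * n).
    apply: ler_pM => //; apply: (le_trans yn); by rewrite ler_peMl.
  lra.
pose r1 := rho x * (psi w - psi u - d u k).
pose r2 := dl * (rho x * (d u y - d (c *: x) y)).
have -> : rho x * psi w - rho x * psi u - eta ^+ 2 * (rho x * d u (f x))
    - dl * (rho x * d (c *: x) y) = r1 + r2.
  have E : d u k = eta ^+ 2 * d u (f x) + dl * d u y.
    by rewrite kE (C11_D C) !(C11_Z C).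
  by rewrite /r1 /r2 E; ring.
have be : 0 <= b * eta ^+ 4 by rewrite mulr_ge0 ?exprn_ge0.
have b1 : `|r1| <= 4 * (b * eta ^+ 4 * D).
  have kn2 : `|k| ^+ 2 <= (2 * eta ^+ 2 * (K * n)) ^+ 2.
    by rewrite ler_pXn2r ?nnegrE// (le_trans _ kn).
  have t : `|psi w - psi u - d u k| <= b * (2 * eta ^+ 2 * (K * n)) ^+ 2.
    by apply: (le_trans (tay u w)); rewrite ler_wpM2l.
  apply: (le_trans (normM_le rx t)).
  have := ler_wpM2l be (P 3%N 2%N isT isT); lra.
have b2 : `|r2| <= 12 * (b * eta ^+ 4 * D).
  have t : `|d u y - d (c *: x) y| <= 6 * b * (2 * eta * n) * n.
    apply: (le_trans (C11_lip C _ _ _)); apply: ler_pM => //; rewrite ?mulr_ge0//.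
    rewrite ler_wpM2l ?mulr_ge0// /u /rot1 addrAC subrr add0r normrZ (ger0_norm s0).
    by apply: ler_pM => //; exact: (angle_s an).
  have dl' : `|dl| <= eta ^+ 3 by rewrite ger0_norm.
  apply: (le_trans (normM_le dl' (normM_le rx t))).
  have := ler_wpM2l be (P 1%N 2%N isT isT); lra.
apply: (le_trans (ler_normD _ _)); lra.
Qed.

(** With eta^2 = h and c = 1 - h, the drift part of the step is c x + h f x and sig - s = h^2 / (sig
    + s) is at most eta^3. *)
Lemma euler_consistency psi d a b d1 a1 b1 (Phi : H -> H) h sig :
  C11 psi d a b -> C11 (kernel nu Phi sig psi) d1 a1 b1 ->
  0 < h <= 1 -> 0 <= sig -> sig ^+ 2 = 2 * h ->
  (forall x, Phi x = (1 - h) *: x + h *: f x) ->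
  `|pairing (kernel nu Phi sig psi) - pairing psi|
  <= 81 * (a + b) * h ^+ 2 * (K ^+ 3 * MB).
Proof.
move=> C C1 /andP[h0 h1] sig0 sigE PhiE; have [[a0 b0] _ _ _] := C.
pose eta := Num.sqrt h.
have eE : eta ^+ 2 = h by rewrite sqr_sqrtr// ltW.
have e0 : 0 < eta by rewrite sqrtr_gt0.
have e1 : eta <= 1 by rewrite -(@ler_pXn2r _ 2)// ?nnegrE ?(ltW e0)// eE expr1n; lra.
pose c := 1 - h; pose s := Num.sqrt (h * (2 - h)).
have sE : s ^+ 2 = h * (2 - h) by rewrite sqr_sqrtr// mulr_ge0//; lra.
have s0 : 0 <= s by exact: sqrtr_ge0.
have an : angle eta c s.
  by split; [rewrite (ltW e0) e1|rewrite eE|exact: s0|rewrite eE sE].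
have cs := angle_unit an.
pose dl := sig - s.
have dlh : dl * (sig + s) = h ^+ 2 by rewrite -subr_sqr sigE sE; ring.
have sige : eta <= sig.
  by rewrite -(@ler_pXn2r _ 2)// ?nnegrE ?(ltW e0)// eE sigE; lra.
have ss : 0 < sig + s by rewrite ltr_wpDr// (lt_le_trans e0).
have dl0 : 0 <= dl.
  by rewrite -(pmulr_lge0 _ ss) dlh sqr_ge0.
have dle : dl <= eta ^+ 3.
  rewrite -(ler_pM2r e0) -exprSr.
  have -> : eta ^+ 4 = h ^+ 2 by rewrite -eE; ring.
  by rewrite -dlh ler_wpM2l// (le_trans sige)// lerDl.
have sigs : sig = s + dl by rewrite /dl; ring.
have mfst : measurable_fun setT (fst : HH -> @BH R H) by exact: measurable_fst.
have msnd : measurable_fun setT (snd : HH -> @BH R H) by exact: measurable_snd.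
have mu := measurable_rot1 c s.
have mcx : measurable_fun setT (fun z : HH => c *: (z.1 : H) : @BH R H).
  exact: (measurable_BH_Z ipP onb).
pose v (z : HH) : @BH R H := (c *: (z.1 : H) + h *: f z.1) + (s + dl) *: (z.2 : H).
have mv : measurable_fun setT v.
  apply: (measurable_BH_D ipP onb); last exact: (measurable_BH_Z ipP onb).
  apply: (measurable_BH_D ipP onb) => //.
  by apply: (measurable_BH_Z ipP onb); exact: mf.
have cn : `|c| <= 1 by rewrite ler_norml /c; apply/andP; split; lra.
have sn : `|s + dl| <= 2.
  rewrite -sigs ger0_norm// -(@ler_pXn2r _ 2)// ?nnegrE// sigE; lra.
have ip_ : itg (nu \x nu)%E (fun z => rho z.1 * psi (v z)).
  have [] // := @mean2_le (fun z => rho z.1 * psi (v z)) ((`|psi 0| + 4 * a) * K ^+ 3).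
    by apply: measurable_funM; [exact: mrho|exact: (measurableT_comp (C11_measurable C) mv)].
  move=> z; have n0 := size2_ge0 z; have n1 := size2_ge1 z.
  have Kn : size2 z <= K * size2 z by rewrite ler_peMl.
  have Kn1 : 1 <= K * size2 z by exact: le_trans Kn.
  have vn : `|v z : H| <= 4 * (K * size2 z).
    rewrite (le_trans (ler_normD _ _))// (le_trans (lerD (ler_normD _ _) (lexx _)))//.
    rewrite !normrZ.
    have t1 : `|c| * `|z.1 : H| <= 1 * size2 z by apply: ler_pM => //; exact: fst_le.
    have t2 : `|h| * `|f z.1| <= 1 * (K * size2 z).
      by apply: ler_pM => //; [rewrite gtr0_norm|exact: f_le (size_fst z)].
    have t3 : `|s + dl| * `|z.2 : H| <= 2 * size2 z by apply: ler_pM => //; exact: snd_le.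
    lra.
  have t : `|psi (v z)| <= (`|psi 0| + 4 * a) * (K * size2 z).
    have t1 := C11_growth C (v z).
    have t2 := ler_wpM2l a0 vn; have t3 := ler_wpM2l (normr_ge0 (psi 0)) Kn1.
    by apply: (le_trans t1); rewrite mulr1 in t3; lra.
  apply: (le_trans (normM_le (rho_le (weight_fst z)) t)).
  have c0 : 0 <= `|psi 0| + 4 * a by rewrite addr_ge0// mulr_ge0.
  have := ler_wpM2l c0 (bound_le z (isT : (2 <= 3)%N) (isT : (1 <= 6)%N)); lra.
have ipu := pairing_itg C mfst mu (@weight_fst) (fun z => size_rot1 z cs).
have [igr _] := gradient_dom C mfst mu mfst (@weight_fst) (@size_fst).
have [iodd _] : itg (nu \x nu)%E (fun z => rho z.1 * d (c *: (z.1 : H)) z.2) /\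
    `|mean2 nu (fun z => rho z.1 * d (c *: (z.1 : H)) z.2)| <= a * K ^+ 3 * MB.
  apply: mean2_le => [|z].
    by apply: measurable_funM; [exact: (mrho mfst)|exact: (md C mcx msnd)].
  apply: (le_trans (normM_le (rho_le (weight_fst z)) (d_le _ C (snd_le z)))).
  have := ler_wpM2l a0 (bound_le z (isT : (1 <= 3)%N) (isT : (1 <= 6)%N)); lra.
have odd0 : mean2 nu (fun z => rho z.1 * d (c *: (z.1 : H)) z.2) = 0.
  apply: (mean2_odd ipP onb q0 qsum nuP iodd) => x y.
  by rewrite /= (C11_N C); ring.
have pE : pairing (kernel nu Phi sig psi) = mean2 nu (fun z => rho z.1 * psi (v z)).
  have i1 := pairing_itg C1 mfst mfst (@weight_fst) (@size_fst).
  have ii x : itg nu (fun y => psi (c *: (x : H) + h *: f x + (s + dl) *: (y : H))).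
    exact: (kernel_itg ipP onb nu1 _ (s + dl) C).
  rewrite /pairing (mean2_fubini i1) => [|x].
    rewrite (mean2_fubini ip_) => [|x]; last exact: (itgZ (rho x) (ii x)).
    apply: Rint_eq => x; transitivity (rho x * kernel nu Phi sig psi x).
      exact: (Rint_cst nu (rho x * kernel nu Phi sig psi x)).
    by rewrite /kernel PhiE sigs -(RintZ (rho x) (ii x)).
  exact: (itg_cst nu (rho x * kernel nu Phi sig psi x)).
have ir := itgB (itgB (itgB ip_ ipu) (itgZ (eta ^+ 2) igr)) (itgZ dl iodd).
have bb z : `|rho z.1 * psi (v z) - rho z.1 * psi (rot1 c s z)
    - eta ^+ 2 * (rho z.1 * d (rot1 c s z) (f z.1))
    - dl * (rho z.1 * d (c *: (z.1 : H)) z.2)| <= 16 * b * eta ^+ 4 * K ^+ 3 * dominant z.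
  by rewrite -[leRHS]mulrA /v -eE; exact: euler_pointwise C an dl0 dle.
have [_] := mean2_le (itg_measurable ir) bb.
rewrite /mean2 (RintB (itgB (itgB ip_ ipu) (itgZ (eta ^+ 2) igr)) (itgZ dl iodd)).
rewrite (RintB (itgB ip_ ipu) (itgZ (eta ^+ 2) igr)) (RintB ip_ ipu).
rewrite (RintZ _ igr) (RintZ _ iodd) -!/(mean2 nu _) odd0 -pE.
rewrite -/(rotated_pairing psi c s) -/(rotated_gradient_term d c s).
(* The Euler shift contributes eta^2 times the rotated gradient term, the passage to T_c contributes
   minus eta^2 times the unrotated one; [sw] compares the two. The errors 16 b, 54 (a + b) and 27 a
   add up to at most 81 (a + b). *)
have sw := swap_gradient_term C an.
have so := ou_second_order C an e0.
have e2 : 0 <= eta ^+ 2 by exact: sqr_ge0.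
have sw2 := ler_wpM2l e2 sw.
rewrite -[X in X * `|_|](ger0_norm e2) -normrM in sw2.
have e4 : h ^+ 2 = eta ^+ 4 by rewrite -eE; ring.
rewrite e4; move: so sw2.
have G0 : 0 <= K ^+ 3 * MB by exact: (mulr_ge0 (exprn_ge0 3 K0) MB_ge0).
have -> : 16 * b * eta ^+ 4 * K ^+ 3 * MB = 16 * (b * eta ^+ 4 * (K ^+ 3 * MB)) by ring.
have -> : 54 * (a + b) * eta ^+ 4 * (K ^+ 3 * MB) = 54 * (a * eta ^+ 4 * (K ^+ 3 * MB))
   + 54 * (b * eta ^+ 4 * (K ^+ 3 * MB)) by ring.
have -> : eta ^+ 2 * (27 * a * eta ^+ 2 * K ^+ 3 * MB)
  = 27 * (a * eta ^+ 4 * (K ^+ 3 * MB)) by ring.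
have -> : 81 * (a + b) * eta ^+ 4 * (K ^+ 3 * MB) = 81 * (a * eta ^+ 4 * (K ^+ 3 * MB))
   + 81 * (b * eta ^+ 4 * (K ^+ 3 * MB)) by ring.
have e40 : 0 <= eta ^+ 4 by exact: (exprn_ge0 4 (ltW e0)).
have Xa : 0 <= a * eta ^+ 4 * (K ^+ 3 * MB) by exact: mulr_ge0 (mulr_ge0 a0 e40) G0.
have Xb : 0 <= b * eta ^+ 4 * (K ^+ 3 * MB) by exact: mulr_ge0 (mulr_ge0 b0 e40) G0.
move: Xa Xb; move: (a * _ * _) (b * _ * _) => X Y X0 Y0.
rewrite mulrBr; move: (pairing _) (pairing _) (rotated_pairing _ _ _) => p1 p2 p3.
move: (eta ^+ 2 * _) (eta ^+ 2 * _) => g1 g2.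
rewrite !ler_norml => /andP[? ?] /andP[? ?] /andP[? ?].
by apply/andP; split; lra.
Qed.

End Consistency.

(** * Growth and Taylor expansion of exp (- 2 V) *)

Section Density.
Context (R : realType) (H : completeNormedModType R) (ip : H -> H -> R).
Context (V : H -> R) (F : H -> H) (L : R).
Hypothesis ipP : is_inner_product ip.
Hypothesis V_diff : forall x, differentiable V x.
Hypothesis VF : forall x h, 'd V x h = - ip (F x) h.
Hypothesis L0 : 0 <= L.
Hypothesis FL : forall x y, `|F y - F x| <= L * `|y - x|.

Definition density (x : H) : R := expR (- 2 * V x).

Lemma potential_taylor x y : `|V y - V x + ip (F x) (y - x)| <= L * `|y - x| ^+ 2.
Proof.
have dV u v h : `|'d V v h - 'd V u h| <= L * `|v - u| * `|h|.
  rewrite !VF opprK addrC -(ipBl ipP) (le_trans (cauchy_schwarz ipP _ _))//.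
  by rewrite ler_wpM2r// distrC.
rewrite -[ip _ _]opprK -VF.
apply: (diff_lipschitz_taylor (ipW := fun u v : R => u * v)) => //.
- by move=> a u v w; rewrite /= mulrDl mulrA.
- by move=> u; rewrite real_normK ?num_real.
- by move=> u v; rewrite normrM.
Qed.

(* The mean value theorem is applied to V + L |.|^2 / 2: Taylor's formula would only give
   the factor L instead of L / 2, which is not enough for the integrability of exp (- 2 V). *)
Lemma potential_ge x : V 0 - `|F 0| * `|x| - L / 2 * `|x| ^+ 2 <= V x.
Proof.
pose l (z h : H) := - ip (F z) h + L * ip z h.
have fr z : frechet (fun u => V u + L / 2 * `|u| ^+ 2) z (l z).
  move=> eps eps0; have e2 : 0 < eps / 2 by rewrite divr_gt0.
  have [del del0 delP] := frechet_differentiable (V_diff z) e2.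
  have L1 : 0 < L + 1 by rewrite ltr_wpDl.
  exists (Num.min del (eps / (L + 1))) => [|y]; first by rewrite lt_min del0 divr_gt0.
  rewrite lt_min => /andP[/delP yd ye]; rewrite VF in yd.
  have yE : `|y| ^+ 2 = `|z| ^+ 2 + 2 * ip z (y - z) + `|y - z| ^+ 2.
    by rewrite -(norm_sqrD ipP) addrC subrK.
  have -> : V y + L / 2 * `|y| ^+ 2 - (V z + L / 2 * `|z| ^+ 2) - l z (y - z)
      = (V y - V z - - ip (F z) (y - z)) + L / 2 * `|y - z| ^+ 2.
    by rewrite yE /l; field.
  rewrite (le_trans (ler_normD _ _))//.
  rewrite (ger0_norm (_ : 0 <= L / 2 * `|y - z| ^+ 2)); last first.
    by apply: mulr_ge0; [apply: divr_ge0|apply: sqr_ge0].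
  have t : L / 2 * `|y - z| ^+ 2 <= eps / 2 * `|y - z|.
    rewrite expr2 mulrA ler_wpM2r//.
    have : (L + 1) * `|y - z| <= eps by rewrite mulrC -ler_pdivlMr// ltW.
    have := normr_ge0 (y - z); lra.
  lra.
have [|t /andP[t0 t1]] := mean_value_frechet 0 x fr.
  by move=> z a u; rewrite /l !(ipZr ipP) mulrDr mulrN mulrCA.
rewrite !subr0 add0r normr0 expr0n mulr0 addr0 /l (ipZl ipP) (ipxx ipP).
have h1 := ler_norm (ip (F (t *: x) - F 0) x).
have h2 := cauchy_schwarz ipP (F (t *: x) - F 0) x.
have h3 := ler_norm (ip (F 0) x); have h4 := cauchy_schwarz ipP (F 0) x.
have h5 : `|F (t *: x) - F 0| * `|x| <= L * (t * `|x|) * `|x|.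
  by rewrite ler_wpM2r// (le_trans (FL _ _))// subr0 normrZ gtr0_norm.
rewrite (ipBl ipP) in h1; rewrite (ipBl ipP) in h2; lra.
Qed.

Lemma density_ge0 x : 0 <= density x. Proof. exact: expR_ge0. Qed.

(** The margin A - L absorbs the linear term 2 |F 0| |x| by Young's inequality, at the cost of the
    constant |F 0|^2 / (A - L). *)
Lemma density_le A x : L < A ->
  density x <= expR (- 2 * V 0 + `|F 0| ^+ 2 / (A - L)) * expR (A * `|x| ^+ 2).
Proof.
move=> LA; rewrite /density -expRD ler_expR.
have AL : 0 < A - L by rewrite subr_gt0.
have h := potential_ge x.
have : 2 * `|F 0| * `|x| <= `|F 0| ^+ 2 / (A - L) + (A - L) * `|x| ^+ 2.
  rewrite -subr_ge0.
  have -> : `|F 0| ^+ 2 / (A - L) + (A - L) * `|x| ^+ 2 - 2 * `|F 0| * `|x|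
      = (`|F 0| - (A - L) * `|x|) ^+ 2 / (A - L) by field; rewrite gt_eqF.
  by rewrite divr_ge0 ?sqr_ge0 ?ltW.
lra.
Qed.

(** The factor 1 + exp t suits t = - 2 (V y - V x): multiplied by [density x] it becomes
    [density x + density y], and both densities are controlled. *)
Lemma expR_taylor2 (t : R) : `|expR t - 1 - t| <= t ^+ 2 * (1 + expR t).
Proof.
have h1 := expR_ge1Dx t; have h2 := expR_ge1Dx (- t).
rewrite ger0_norm; last by lra.
have e0 := expR_gt0 t.
have h3 : expR t * (1 - t) <= 1.
  by have := ler_wpM2l (ltW e0) h2; rewrite expRxMexpNx_1.
have [t0|t0] := leP 0 t; nra.
Qed.

Lemma density_taylor K A x y (n W : R) : 0 <= K ->
  (forall u, density u <= K * expR (A * `|u| ^+ 2)) ->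
  (forall u, `|F u| <= K * (1 + `|u|)) ->
  1 + `|x| <= n -> 1 + `|y| <= n ->
  expR (A * `|x| ^+ 2) <= W -> expR (A * `|y| ^+ 2) <= W ->
  `|density y - density x - 2 * density x * ip (F x) (y - x)|
  <= (8 * K * (K + 2 * L) ^+ 2 + 2 * K * L) * n ^+ 2 * W * `|y - x| ^+ 2.
Proof.
move=> K0 dK FK xn yn xW yW; set r := `|y - x|.
have n1 : 1 <= n by apply: le_trans xn; rewrite lerDl.
have W0 : 0 <= W by apply: le_trans xW; exact: expR_ge0.
have r0 : 0 <= r by exact: normr_ge0.
have rn : r <= 2 * n.
  by apply: (le_trans (ler_normB y x)); have := normr_ge0 x; lra.
have Fn : `|F x| <= K * n by rewrite (le_trans (FK x))// ler_wpM2l.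
have xKW : density x <= K * W by rewrite (le_trans (dK x))// ler_wpM2l.
have yKW : density y <= K * W by rewrite (le_trans (dK y))// ler_wpM2l.
set g := ip (F x) (y - x).
have gn : `|g| <= K * n * r.
  by apply: (le_trans (cauchy_schwarz ipP _ _)); rewrite ler_wpM2r.
have tay : `|V y - V x + g| <= L * r ^+ 2 by exact: potential_taylor.
pose t := - 2 * (V y - V x).
have dE : density y = density x * expR t.
  by rewrite /density -expRD /t; congr expR; ring.
have tg : `|t - 2 * g| <= 2 * L * r ^+ 2.
  have -> : t - 2 * g = - (2 * (V y - V x + g)) by rewrite /t; ring.
  by rewrite normrN normrM ger0_norm// -mulrA ler_wpM2l.
have t1 : `|t| <= 2 * (K + 2 * L) * n * r.
  have -> : t = (t - 2 * g) + 2 * g by ring.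
  rewrite (le_trans (ler_normD _ _))// normrM (ger0_norm (_ : 0 <= 2))//.
  have Lr : L * r * r <= L * r * (2 * n) by rewrite ler_wpM2l// mulr_ge0.
  lra.
have t2 : t ^+ 2 <= (2 * (K + 2 * L) * n * r) ^+ 2.
  by rewrite -real_normK ?num_real// ler_pXn2r// nnegrE (le_trans _ t1).
have -> : density y - density x - 2 * density x * g
    = density x * (expR t - 1 - t) + density x * (t - 2 * g).
  by rewrite dE; ring.
rewrite (le_trans (ler_normD _ _))// !normrM (ger0_norm (density_ge0 x)).
have b1 : density x * `|expR t - 1 - t| <= 2 * K * W * (2 * (K + 2 * L) * n * r) ^+ 2.
  apply: (@le_trans _ _ (density x * (t ^+ 2 * (1 + expR t)))).
    by rewrite ler_wpM2l ?density_ge0//; exact: expR_taylor2.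
  have -> : density x * (t ^+ 2 * (1 + expR t)) = (density x + density y) * t ^+ 2.
    by rewrite dE; ring.
  apply: ler_pM => //; [by rewrite addr_ge0 ?density_ge0|exact: sqr_ge0|lra].
have b2 : density x * `|t - 2 * g| <= K * W * (2 * L * r ^+ 2 * n ^+ 2).
  apply: ler_pM => //; first exact: density_ge0.
  apply: (le_trans tg); rewrite ler_peMr// ?mulr_ge0 ?sqr_ge0//.
  by rewrite exprn_ege1.
lra.
Qed.

Lemma density_continuous : continuous density.
Proof.
move=> x; apply: continuous_comp; last exact: continuous_expR.
apply: continuousM; first exact: cst_continuous.
exact: differentiable_continuous.
Qed.

End Density.

(** * Integrability derived from one exponential moment *)

Section Moments.
Context (R : realType) (H : completeNormedModType R) (nu : probability (@BH R H) R).
Context (B : R).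
Hypothesis B0 : 0 < B.
Hypothesis exp_moment : itg nu (fun x => expR (B * `|x : H| ^+ 2)).

Let measurable_norm : measurable_fun setT (fun x : @BH R H => `|x : H|).
Proof. by apply: continuous_measurable_BH; exact: norm_continuous. Qed.

Lemma itg_norm_sqr : itg nu (fun x => `|x : H| ^+ 2).
Proof.
apply: (itg_dom _ _ (itgZ B^-1 exp_moment)) => [|x]; first exact: measurable_funX.
rewrite ger0_norm ?sqr_ge0// ler_pdivlMl//.
by have := expR_ge1Dx (B * `|x : H| ^+ 2); lra.
Qed.

Lemma itg_norm : itg nu (fun x => `|x : H|).
Proof.
apply: (itg_dom _ _ (itgD (itg_cst nu 1) itg_norm_sqr)) => [|x]; first exact: measurable_norm.
by rewrite normr_id; have := sqr_ge0 (`|x : H| - 1); have := sqr_ge0 `|x : H|; lra.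
Qed.

(** The gap B - A is cut into six equal parts eps, one for each factor 1 + |x|, which is at most k
    exp (eps |x|^2) with k = 2 + 1 / eps. *)
Lemma itg_poly_exp A : A < B ->
  itg nu (fun x => (1 + `|x : H|) ^+ 6 * expR (A * `|x : H| ^+ 2)).
Proof.
move=> AB; pose eps := (B - A) / 6.
have eps0 : 0 < eps by rewrite divr_gt0// subr_gt0.
pose k := 2 + eps^-1.
have k0 : 0 < k by rewrite addr_gt0// invr_gt0.
apply: (itg_dom _ _ (itgZ (k ^+ 6) exp_moment)) => [|x].
  apply: measurable_funM.
    by apply: measurable_funX; apply: measurable_funD => //; exact: measurable_norm.
  apply: measurableT_comp; first exact: measurable_expR.
  apply: measurable_funM => //.
  by apply: measurable_funX; exact: measurable_norm.
set t : R := `|x : H|; have t0 : 0 <= t by exact: normr_ge0.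
have -> : B * t ^+ 2 = 6%:R * (eps * t ^+ 2) + A * t ^+ 2 by rewrite /eps; field.
rewrite expRD expRM_natl mulrA -exprMn ger0_norm; last first.
  by rewrite mulr_ge0 ?expR_ge0// exprn_ge0// addr_ge0.
rewrite ler_wpM2r ?expR_ge0// ler_pXn2r//; last 2 first.
- by rewrite nnegrE addr_ge0.
- by rewrite nnegrE mulr_ge0 ?expR_ge0// ltW.
have h1 := expR_ge1Dx (eps * t ^+ 2).
apply: (@le_trans _ _ (k * (1 + eps * t ^+ 2))); last by rewrite ler_wpM2l// ltW.
have -> : k * (1 + eps * t ^+ 2) = 2 + eps^-1 + 2 * (eps * t ^+ 2) + t ^+ 2.
  by rewrite /k; field; rewrite gt_eqF.
have h2 : 0 <= eps * t ^+ 2 by rewrite mulr_ge0 ?sqr_ge0// ltW.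
have h3 : 0 <= eps^-1 by rewrite invr_ge0 ltW.
by have := sqr_ge0 (t - 1); lra.
Qed.

Lemma dominant_itg A : A < B -> itg (nu \x nu)%E (dominant A).
Proof.
move=> AB; have i1 := itg_poly_exp AB.
have m1 : measurable_fun setT (fun z : @BH R H * @BH R H => `|z.1 : H|).
  exact: (measurableT_comp measurable_norm measurable_fst).
have m2 : measurable_fun setT (fun z : @BH R H * @BH R H => `|z.2 : H|).
  exact: (measurableT_comp measurable_norm measurable_snd).
apply: (itg_dom _ _ (itg_mul i1 i1)) => [|z].
  apply: measurable_funM.
    by apply: measurable_funX; do 2?apply: measurable_funD.
  apply: measurableT_comp; first exact: measurable_expR.
  apply: measurable_funM => //.
  by apply: measurable_funD; exact: measurable_funX.
rewrite /dominant /size2 /weight2 mulrDr expRD.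
set s : R := `|z.1 : H|; set t : R := `|z.2 : H|.
have s0 : 0 <= s by exact: normr_ge0.
have t0 : 0 <= t by exact: normr_ge0.
have l0 : 0 <= 1 + s + t by rewrite !addr_ge0.
rewrite ger0_norm; last by rewrite !mulr_ge0 ?expR_ge0 ?exprn_ge0.
have -> : (1 + s) ^+ 6 * expR (A * s ^+ 2) * ((1 + t) ^+ 6 * expR (A * t ^+ 2))
  = ((1 + s) * (1 + t)) ^+ 6 * (expR (A * s ^+ 2) * expR (A * t ^+ 2)).
  by rewrite exprMn; ring.
(* This splits the joint size into a product, so that [dominant] lies below a tensor product of
   integrable functions. *)
have st : 1 + s + t <= (1 + s) * (1 + t) by have := mulr_ge0 s0 t0; lra.
rewrite ler_wpM2r ?mulr_ge0 ?expR_ge0// ler_pXn2r// nnegrE//.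
exact: le_trans st.
Qed.

End Moments.

(** * The invariant law of the Euler chain *)

Section InvariantLaw.
Context (R : realType) (H : completeNormedModType R) (ip : H -> H -> R) (e : nat -> H).
Hypothesis ipP : is_inner_product ip.
Hypothesis onb : is_onb ip e.
Context (nu mu : probability (@BH R H) R) (Phi : H -> H) (tau r : R).
Hypothesis nu1 : itg nu (fun x => `|x : H|).
Hypothesis r0 : 0 <= r.
Hypothesis r1 : r < 1.
Hypothesis Phi_lip : forall x y, `|Phi y - Phi x| <= r * `|y - x|.
Hypothesis inv : forall A : set (@BH R H), measurable A ->
  mu A = (\int[mu]_y nu [set z : @BH R H | A (Phi y + tau *: (z : H))%R])%E.

Local Notation HH := (@BH R H * @BH R H)%type.

Definition noisy_step (z : HH) : @BH R H := Phi z.1 + tau *: (z.2 : H).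

Let measurable_noisy_step : measurable_fun setT noisy_step.
Proof.
apply: (measurable_BH_D ipP onb); last first.
  by apply: (measurable_BH_Z ipP onb); exact: measurable_snd.
have Phi_cont : continuous Phi by exact: lipschitz_continuous Phi_lip.
exact: (measurableT_comp (continuous_measurable_BHBH Phi_cont) measurable_fst).
Qed.

Lemma noisy_step_law A : measurable A -> mu A = (mu \x nu)%E (noisy_step @^-1` A).
Proof.
move=> mA; rewrite inv//; apply: eq_integral => y _; congr (nu _).
by apply/seteqP; split => z; rewrite /xsection /= ?inE.
Qed.

(** No moment of the invariant law is given. Truncation makes the integrals finite, so that
    invariance can be used before integrability of the norm is known. *)
Let clip (c M : R) (x : @BH R H) : R := Num.min (c * `|x : H|) M.

Let itg_clip c M : 0 <= c -> 0 <= M -> itg mu (clip c M).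
Proof.
move=> c0 M0; apply: (@itg_bounded _ _ _ _ _ M) => [|x].
  apply: measurable_minr => //; apply: measurable_funM => //.
  by apply: continuous_measurable_BH; exact: norm_continuous.
rewrite ger0_norm; first by rewrite ge_min lexx orbT.
by rewrite le_min M0 mulr_ge0.
Qed.

Let C : R := `|Phi 0| + `|tau| * Rintegral nu setT (fun x => `|x : H|).

(** One step reduces the slope: min (s + t, M) <= min (s, M) + t for t >= 0, with s = c r |x| and t
    the contribution of [Phi 0] and the noise. *)
Let clip_step c M : 0 <= c -> 0 <= M ->
  Rintegral mu setT (clip c M) <= Rintegral mu setT (clip (c * r) M) + c * C.
Proof.
move=> c0 M0; have ic := itg_clip c0 M0; have icr := itg_clip (mulr_ge0 c0 r0) M0.
rewrite (Rint_transfer measurable_noisy_step noisy_step_law (itg_measurable ic)); last first.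
  exact: (itg_transferV measurable_noisy_step noisy_step_law ic).
pose h (y : @BH R H) : R := c * `|Phi 0| + (c * `|tau|) * `|y : H|.
have ih : itg nu h by apply: itgD; [exact: itg_cst|exact: itgZ].
have hE : Rintegral nu setT h = c * C.
  rewrite (RintD (itg_cst nu _) (itgZ (c * `|tau|) nu1)) (RintZ _ nu1).
  by rewrite (Rint_cst nu (c * `|Phi 0|)) /C; ring.
have i1 : itg (mu \x nu)%E (fun z : HH => clip (c * r) M z.1 * 1).
  exact: (itg_mul icr (itg_cst nu 1)).
have i2 : itg (mu \x nu)%E (fun z : HH => 1 * h z.2).
  exact: (itg_mul (itg_cst mu 1) ih).
have E1 : Rintegral (mu \x nu)%E setT (fun z : HH => clip (c * r) M z.1 * 1)
    = Rintegral mu setT (clip (c * r) M).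
  by rewrite (Rint_mul icr (itg_cst nu 1)) (Rint_cst nu 1) mulr1.
have E2 : Rintegral (mu \x nu)%E setT (fun z : HH => 1 * h z.2) = c * C.
  by rewrite (Rint_mul (itg_cst mu 1) ih) (Rint_cst mu 1) mul1r.
rewrite -E2 -E1 -(RintD i1 i2); apply: Rint_le.
- exact: (itg_transferV measurable_noisy_step noisy_step_law ic).
- exact: itgD.
move=> z; rewrite /= mulr1 mul1r /clip.
have zn : c * `|noisy_step z : H| <= c * r * `|z.1 : H| + h z.2.
  have -> : c * r * `|z.1 : H| + h z.2
    = c * ((r * `|z.1 : H| + `|Phi 0|) + `|tau| * `|z.2 : H|) by rewrite /h; ring.
  rewrite ler_wpM2l// (le_trans (ler_normD _ _))// normrZ lerD2r.
  have := Phi_lip 0 z.1; rewrite subr0 => lip.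
  by rewrite -[Phi z.1](subrK (Phi 0)) (le_trans (ler_normD _ _))// lerD2r.
have h0 : 0 <= h z.2 by rewrite addr_ge0 ?mulr_ge0.
have [le_M|lt_M] := leP (c * r * `|z.1 : H|) M.
  by rewrite (le_trans _ zn)// ge_min lexx.
by rewrite (le_trans (_ : _ <= M))// ?ge_min ?lexx ?orbT// lerDl.
Qed.

(** With M fixed the slopes r^n tend to 0 and the truncated integral vanishes, while the added costs
    r^k C sum to C / (1 - r), independently of M. *)
Let clip_le M : 0 <= M -> Rintegral mu setT (clip 1 M) <= C / (1 - r).
Proof.
move=> M0; have r1' : 0 < 1 - r by rewrite subr_gt0.
have iter n : Rintegral mu setT (clip 1 M)
    <= Rintegral mu setT (clip (r ^+ n) M) + C * ((1 - r ^+ n) / (1 - r)).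
  elim: n => [|n IH]; first by rewrite expr0 subrr mul0r mulr0 addr0.
  apply: (le_trans IH); have := clip_step (exprn_ge0 n r0) M0.
  rewrite -exprSr => h.
  have -> : C * ((1 - r ^+ n.+1) / (1 - r))
    = r ^+ n * C + C * ((1 - r ^+ n) / (1 - r)) by rewrite exprS; field; rewrite gt_eqF.
  by rewrite addrA lerD2r.
have C0 : 0 <= C.
  rewrite addr_ge0// mulr_ge0//; apply: Rintegral_ge0 => x _; exact: normr_ge0.
have lim : Rintegral mu setT (clip (r ^+ n) M) @[n --> \oo] --> Rintegral mu setT (cst 0 : @BH R H -> R).
  apply: (@Rint_dct _ _ _ _ _ _ (cst M)).
  - by move=> n; exact: itg_measurable (itg_clip (exprn_ge0 n r0) M0).
  - exact: itg_cst.
  - move=> n x; rewrite ger0_norm /clip ?ge_min ?lexx ?orbT// le_min M0 mulr_ge0//.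
    exact: exprn_ge0.
  move=> x; have h : r ^+ n * `|x : H| @[n --> \oo] --> 0.
    rewrite -[X in _ --> X](mul0r `|x : H|); apply: cvgM; last exact: cvg_cst.
    by apply: cvg_expr; rewrite ger0_norm.
  apply: (squeeze_cvgr _ (cvg_cst 0) h); near=> n.
  rewrite /clip le_min M0 mulr_ge0//= ?ge_min ?lexx//; exact: exprn_ge0.
rewrite (Rint_cst mu 0) in lim.
have lim2 : Rintegral mu setT (clip (r ^+ n) M) + C / (1 - r) @[n --> \oo] --> C / (1 - r).
  by rewrite -[X in _ --> X]add0r; apply: cvgD => //; exact: cvg_cst.
rewrite -(cvg_lim _ lim2)//; apply: limr_ge; first exact: cvgP lim2.
near=> n; apply: (le_trans (iter n)); rewrite lerD2l ler_wpM2l//.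
by rewrite ler_pdivrMr// mulVf ?gt_eqF// gerBl exprn_ge0.
Unshelve. all: by end_near. Qed.

Lemma itg_norm_invariant : itg mu (fun x => `|x : H|).
Proof.
have mn : measurable_fun setT (fun x : @BH R H => `|x : H|).
  by apply: continuous_measurable_BH; exact: norm_continuous.
apply/integrableP; split; first exact/measurable_EFinP.
pose g (n : nat) (x : @BH R H) := (clip 1 n%:R x)%:E.
have gE x : (fun n => g n x) @ \oo --> (`|x : H|)%:E.
  apply: cvg_near_cst; near=> n; rewrite /g /clip mul1r min_l//.
  by near: n; exact: nbhs_infty_ger.
have mono := @cvg_monotone_convergence _ _ _ mu setT measurableT g.
apply: (@le_lt_trans _ _ (C / (1 - r))%:E); last exact: ltry.
rewrite (eq_integral (fun x => limn (g ^~ x))) => [|x _]; last first.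
  by rewrite (cvg_lim _ (gE x))//= normr_id.
have {mono}lim : (\int[mu]_x g n x)%E @[n --> \oo] --> (\int[mu]_x limn (g ^~ x))%E.
  apply: mono => [n|n x _|x _ m n mn_].
  - exact/measurable_EFinP/itg_measurable/itg_clip.
  - by rewrite lee_fin /clip le_min mul1r normr_ge0 ler0n.
  - rewrite lee_fin /clip le_min ge_min lexx/= ge_min; apply/orP; right.
    by rewrite ler_nat.
rewrite -(cvg_lim _ lim)//; apply: lime_le; first exact: cvgP lim.
near=> n; rewrite -(EFin_Rint (itg_clip ler01 (ler0n _ n))) lee_fin.
exact: clip_le.
Unshelve. all: by end_near. Qed.

Lemma C11_itg_invariant psi d a b : C11 psi d a b -> itg mu psi.
Proof.
move=> Cp; apply: (itg_dom (C11_measurable Cp) (C11_growth Cp)).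
by apply: itgD; [exact: itg_cst|exact: (itgZ a itg_norm_invariant)].
Qed.

Lemma Rint_invariant_kernel psi d a b : C11 psi d a b ->
  Rintegral mu setT psi = Rintegral mu setT (kernel nu Phi tau psi).
Proof.
move=> Cp; have ipsi := C11_itg_invariant Cp.
rewrite (Rint_transfer measurable_noisy_step noisy_step_law (itg_measurable ipsi)); last first.
  exact: (itg_transferV measurable_noisy_step noisy_step_law ipsi).
have i2 := itg_transferV measurable_noisy_step noisy_step_law ipsi.
by have [_ ->] := Rint_fubini i2 (fun x => kernel_itg ipP onb nu1 (Phi x) tau Cp).
Qed.

End InvariantLaw.

(** * From the one-step error to the error of the invariant law *)

Section ErgodicError.
Context (R : realType) (H : completeNormedModType R).
Context (m s : (H -> R) -> R) (P : (H -> R) -> H -> R).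
Context (P' : (H -> H -> R) -> H -> H -> R) (kappa dt M T D : R).
Hypothesis kappa01 : 0 < kappa <= 1.
Hypothesis dt01 : 0 < dt <= 1.
Hypothesis M0 : 0 <= M.
Hypothesis T0 : 0 <= T.
Hypothesis contract : forall psi d a b, C11 psi d a b ->
  C11 (P psi) (P' d) (a * (1 - kappa * dt)) (b * (1 - kappa * dt) ^+ 2 + a * (dt * M)).
Hypothesis invariant : forall psi d a b, C11 psi d a b -> m (P psi) = m psi.
Hypothesis consistent : forall psi d a b, C11 psi d a b ->
  `|s (P psi) - s psi| <= (a + b) * (dt ^+ 2 * T).
Hypothesis close : forall psi d a b, C11 psi d a b -> `|m psi - s psi| <= a * D.

(* [a + b + M / kappa * a] decreases by at least [kappa * dt * (a + b)] under [contract]. *)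
Let ergodic_error_iter n psi d a b : C11 psi d a b ->
  `|m psi - s psi| <= a * ((1 - kappa * dt) ^+ n * D)
                      + (a + b + M / kappa * a) * (T / kappa * dt).
Proof.
have [/andP[k0 k1] /andP[t0 t1]] := (kappa01, dt01).
have Mk : 0 <= M / kappa by rewrite divr_ge0// ltW.
have Tk : 0 <= T / kappa * dt by rewrite mulr_ge0 ?divr_ge0// ltW.
have kt : 0 < kappa * dt <= 1 by rewrite mulr_gt0// mulr_ile1// ltW.
elim: n psi d a b => [|n IH] psi d a b C; have [[a0 b0] _ _ _] := C.
  rewrite expr0 mul1r (le_trans (close C))// lerDl mulr_ge0//.
  by rewrite !addr_ge0// mulr_ge0.
have := IH _ _ _ _ (contract C); rewrite (invariant C) => h1.
have h2 := consistent C.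
set r := 1 - kappa * dt in h1 *.
have r01 : 0 <= r <= 1 by rewrite /r; move: kt => /andP[? ?]; apply/andP; split; lra.
have -> : m psi - s psi = (m psi - s (P psi)) + (s (P psi) - s psi) by ring.
rewrite (le_trans (ler_normD _ _))// (le_trans (lerD h1 h2))// (exprS r n).
have -> : a * r * (r ^+ n * D) = a * (r * r ^+ n * D) by ring.
rewrite -[leLHS]addrA lerD2l.
have -> : (a + b) * (dt ^+ 2 * T) = (kappa * dt * (a + b)) * (T / kappa * dt).
  by field; rewrite gt_eqF.
rewrite -mulrDl ler_wpM2r//.
have -> : a * r + (b * r ^+ 2 + a * (dt * M)) + M / kappa * (a * r) + kappa * dt * (a + b)
    = (a + b + M / kappa * a) - b * (1 - kappa * dt - r ^+ 2).
  by rewrite /r; field; rewrite gt_eqF.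
rewrite gerBl mulr_ge0// -/r expr2.
by move: r01 => /andP[r0 r1]; have := ler_wpM2l r0 r1; lra.
Qed.

(** The a priori bound [D] occurs only with the factor (1 - kappa dt)^n and disappears in the limit,
    so the final constant depends neither on the invariant law nor on the step size. *)
Lemma ergodic_error psi d a b : C11 psi d a b ->
  `|m psi - s psi| <= (a + b + M / kappa * a) * (T / kappa * dt).
Proof.
move=> C; set U := (_ + _) * _; have [/andP[k0 k1] /andP[t0 t1]] := (kappa01, dt01).
have kt : 0 < kappa * dt <= 1 by rewrite mulr_gt0// mulr_ile1// ltW.
have lim : a * ((1 - kappa * dt) ^+ n * D) + U @[n --> \oo] --> a * (0 * D) + U.
  apply: cvgD; last exact: cvg_cst.
  apply: cvgM; first exact: cvg_cst.
  apply: cvgM; last exact: cvg_cst.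
  by apply: cvg_expr; rewrite ger0_norm; move: kt => /andP[? ?]; lra.
have <- : a * (0 * D) + U = U by rewrite mul0r mulr0 add0r.
rewrite -(cvg_lim _ lim)//; apply: limr_ge; first exact: cvgP lim.
by near=> n; exact: ergodic_error_iter C.
Unshelve. all: by end_near. Qed.

End ErgodicError.

(** * Integrals against the Gibbs measure *)

Section GibbsMeasure.
Context (R : realType) (H : completeNormedModType R) (ip : H -> H -> R).
Context (e : nat -> H) (q : nat -> R) (V : H -> R) (F : H -> H) (L : R).
Context (nu : probability (@BH R H) R).
Hypothesis ipP : is_inner_product ip.
Hypothesis onb : is_onb ip e.
Hypothesis q0 : forall k, 0 < q k.
Hypothesis qdec : forall k, q k.+1 <= q k.
Hypothesis qsum : cvgn (series q).
Hypothesis nuP : gaussian_cov ip e q (2^-1) nu.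
Hypothesis V_diff : forall x, differentiable V x.
Hypothesis VF : forall x h, 'd V x h = - ip (F x) h.
Hypothesis L0 : 0 <= L.
Hypothesis Lq : L < (q 0%N)^-1.
Hypothesis FL : forall x y, `|F y - F x| <= L * `|y - x|.

(** A and B divide the interval from L to 1 / q_1 into thirds. The gap between L and A absorbs the
    linear part of V, the gap between A and B the polynomial factors, and B < 1 / q_1 gives the
    Gaussian exponential moment. *)
Let A := (2 * L + (q 0%N)^-1) / 3.
Let B := (L + 2 * (q 0%N)^-1) / 3.

Let LA : L < A. Proof. by move: Lq; rewrite /A; move: (q 0%N)^-1 => l; lra. Qed.
Let AB : A < B. Proof. by move: Lq; rewrite /A /B; move: (q 0%N)^-1 => l; lra. Qed.
Let A0 : 0 <= A. Proof. by rewrite ltW// (le_lt_trans L0 LA). Qed.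
Let B0 : 0 < B. Proof. exact: le_lt_trans A0 AB. Qed.

Let exp_moment : itg nu (fun x => expR (B * `|x : H| ^+ 2)).
Proof.
apply: (gaussian_exp_moment ipP onb q0 qdec qsum nuP B0).
by rewrite -ltr_pdivlMr// mul1r; move: Lq; rewrite /B; move: (q 0%N)^-1 => l; lra.
Qed.

Lemma gaussian_itg_norm : itg nu (fun x => `|x : H|).
Proof. exact: itg_norm B0 exp_moment. Qed.

Let rho := density V.

Let measurable_density : measurable_fun setT (rho : @BH R H -> R).
Proof. by apply: continuous_measurable_BH; exact: density_continuous. Qed.

Lemma itg_density_growth (g : @BH R H -> R) (c : R) : measurable_fun setT g ->
  (forall x, `|g x| <= c * (1 + `|x : H|)) -> itg nu (fun x => rho x * g x).
Proof.
move=> mg gc; set K := expR (- 2 * V 0 + `|F 0| ^+ 2 / (A - L)).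
have i := itgZ (K * c) (itg_poly_exp exp_moment AB).
apply: (itg_dom _ _ i) => [|x].
  exact: measurable_funM.
rewrite normrM (ger0_norm (density_ge0 V x)).
have n1 : 1 <= 1 + `|x : H| by rewrite lerDl.
have c0 : 0 <= c.
  by rewrite -(pmulr_lge0 _ (lt_le_trans ltr01 n1)) (le_trans _ (gc x)).
have h : rho x <= K * expR (A * `|x : H| ^+ 2) by exact: (density_le ipP V_diff VF L0 FL).
have g6 : `|g x| <= c * (1 + `|x : H|) ^+ 6.
  by rewrite (le_trans (gc x))// ler_wpM2l// ler_eXnr.
have -> : K * c * ((1 + `|x : H|) ^+ 6 * expR (A * `|x : H| ^+ 2))
  = K * expR (A * `|x : H| ^+ 2) * (c * (1 + `|x : H|) ^+ 6) by ring.
by apply: ler_pM => //; exact: density_ge0.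
Qed.

Lemma itg_density_C11 psi d a b : C11 psi d a b -> itg nu (fun x => rho x * psi x).
Proof.
move=> C; apply: (itg_density_growth (c := `|psi 0| + a) (C11_measurable C)) => x.
have [[a0 _] _ _ _] := C; apply: (le_trans (C11_growth C x)).
by have := mulr_ge0 (normr_ge0 (psi 0)) (normr_ge0 (x : H)); lra.
Qed.

Lemma itg_density : itg nu rho.
Proof.
have := @itg_density_growth (cst 1) 1; rewrite /=.
move=> /(_ (measurable_cst _)); under eq_fun do rewrite mulr1.
by apply => x; rewrite mul1r normr1 lerDl.
Qed.

Let Z := Rintegral nu setT rho.

(** Jensen's inequality by a tangent: exp u >= exp m (1 + u - m), with m the mean of - 2 V,
    integrates to Z >= exp m. *)
Lemma partition_function_gt0 : 0 < Z.
Proof.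
have iV : itg nu V.
  have i := itgD (itgD (itg_cst nu `|V 0|) (itgZ `|F 0| gaussian_itg_norm))
                 (itgZ L (itg_norm_sqr B0 exp_moment)).
  apply: itg_dom i => [|x].
    apply: continuous_measurable_BH => x; exact: differentiable_continuous.
  have := potential_taylor ipP V_diff VF L0 FL 0 x; rewrite subr0 => h.
  have h2 := cauchy_schwarz ipP (F 0) x.
  have -> : V x = (V x - V 0 + ip (F 0) x) + V 0 - ip (F 0) x by ring.
  rewrite (le_trans (ler_normB _ _))// (le_trans (lerD (ler_normD _ _) (lexx _)))//.
  lra.
pose mV := Rintegral nu setT (fun x => - 2 * V x).
have i2 := itgD (itg_cst nu (expR mV * (1 - mV))) (itgZ (expR mV) (itgZ (- 2) iV)).
have : Rintegral nu setT (fun x => expR mV * (1 - mV) + expR mV * (- 2 * V x)) <= Z.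
  apply: (Rint_le i2 itg_density) => x.
  rewrite /rho /density -[- 2 * V x](subrK mV) [X in _ <= expR X]addrC expRD.
  have -> : expR mV * (1 - mV) + expR mV * (- 2 * V x - mV + mV)
    = expR mV * (1 + (- 2 * V x - mV)) by ring.
  by rewrite ler_wpM2l ?expR_ge0//; exact: expR_ge1Dx.
rewrite (RintD (itg_cst nu _) (itgZ (expR mV) (itgZ (- 2) iV))) (Rint_cst nu).
rewrite (RintZ _ (itgZ (- 2) iV)) -/mV -mulrDr subrK mulr1.
exact: lt_le_trans (expR_gt0 _).
Qed.

Lemma int_mu_starE psi : int_mu_star nu V psi = Rintegral nu setT (fun x => rho x * psi x) / Z.
Proof. by congr (_ / _); apply: Rint_eq => x; rewrite mulrC. Qed.

Let pairingE psi d a b : C11 psi d a b ->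
  pairing nu rho psi = Rintegral nu setT (fun x => rho x * psi x).
Proof.
move=> C; have i := itg_density_C11 C; rewrite /pairing.
transitivity (mean2 nu (fun z => (rho z.1 * psi z.1) * 1)).
  by apply: Rint_eq => z; rewrite mulr1.
by rewrite /mean2 (Rint_mul i (itg_cst nu 1)) (Rint_cst nu 1) mulr1.
Qed.

(** Both functionals have total mass 1, so psi may be replaced by psi - psi 0, which is bounded by a
    |x|. [D] may depend on [mu], since [ergodic_error] removes it. *)
Lemma mu_star_close (mu : probability (@BH R H) R) : itg mu (fun x => `|x : H|) ->
  exists D : R, forall psi d a b, C11 psi d a b ->
    `|Rintegral mu setT psi - int_mu_star nu V psi| <= a * D.
Proof.
move=> mu1; have in1 : itg nu (fun x => rho x * `|x : H|).
  apply: (itg_density_growth (c := 1)) => [|x].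
    by apply: continuous_measurable_BH; exact: norm_continuous.
  by rewrite normr_id mul1r lerDr.
exists (Rintegral mu setT (fun x => `|x : H|)
  + Rintegral nu setT (fun x => rho x * `|x : H|) / Z) => psi d a b C.
have [[a0 _] lip _ _] := C; have Z0 := partition_function_gt0.
have g (x : @BH R H) : `|psi x - psi 0| <= a * `|x : H|.
  by have := lip 0 x; rewrite subr0.
have mp : measurable_fun setT (psi : @BH R H -> R) by exact: C11_measurable C.
have mp0 : measurable_fun setT (fun x : @BH R H => psi x - psi 0) by exact: measurable_funB.
have ipsi : itg mu psi.
  apply: (itg_dom mp (C11_growth C)).
  by apply: itgD; [exact: itg_cst|exact: (itgZ a mu1)].
have ir := itg_density_C11 C.
have e1 : Rintegral mu setT (fun x => psi x - psi 0) = Rintegral mu setT psi - psi 0.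
  by rewrite (RintB ipsi (itg_cst mu (psi 0))) (Rint_cst mu).
have e2 : Rintegral nu setT (fun x => rho x * psi x - psi 0 * rho x)
    = Rintegral nu setT (fun x => rho x * psi x) - psi 0 * Z.
  by rewrite (RintB ir (itgZ (psi 0) itg_density)) (RintZ _ itg_density).
have b1 : `|Rintegral mu setT psi - psi 0| <= a * Rintegral mu setT (fun x => `|x : H|).
  by rewrite -e1 -(RintZ a mu1); apply: (Rint_abs_le mp0 (itgZ a mu1)).
have b2 : `|Rintegral nu setT (fun x => rho x * psi x) - psi 0 * Z|
    <= a * Rintegral nu setT (fun x => rho x * `|x : H|).
  rewrite -e2 -(RintZ a in1); apply: Rint_abs_le (itgZ a in1) _ => [|x].
    exact: itg_measurable (itgB ir (itgZ (psi 0) itg_density)).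
  rewrite [psi 0 * _]mulrC -mulrBr normrM (ger0_norm (density_ge0 V x)) mulrCA.
  by rewrite ler_wpM2l ?density_ge0.
rewrite int_mu_starE; set I := Rintegral nu _ (fun x => rho x * psi x) in b2 *.
have -> : Rintegral mu setT psi - I / Z
    = (Rintegral mu setT psi - psi 0) - (I - psi 0 * Z) / Z by field; rewrite gt_eqF.
rewrite (le_trans (ler_normB _ _))// mulrDr lerD// normrM normfV (gtr0_norm Z0) mulrA.
by rewrite ler_pM2r ?invr_gt0.
Qed.

Lemma euler_consistent (G' : H -> H -> H) (M1 M2 : R) : 0 <= M1 -> 0 <= M2 ->
  (forall x a u v, G' x (a *: u + v) = a *: G' x u + G' x v) ->
  (forall x h, `|G' x h| <= M1 * `|h|) ->
  (forall x y, `|drift ip e q F y - drift ip e q F x - G' x (y - x)| <= M2 * `|y - x| ^+ 2) ->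
  exists2 T : R, 0 <= T & forall h sig psi d a b d1 a1 b1,
    let P := kernel nu (fun x => x + h *: drift ip e q F x) sig in
    C11 psi d a b -> C11 (P psi) d1 a1 b1 ->
    0 < h <= 1 -> 0 <= sig -> sig ^+ 2 = 2 * h ->
    `|int_mu_star nu V (P psi) - int_mu_star nu V psi| <= (a + b) * (h ^+ 2 * T).
Proof.
move=> M10 M20 linG' boundG' tayG; have Z0 := partition_function_gt0.
pose f x := Qop ip e q (F x); pose df x h := G' x h + h.
have fE x : f x = drift ip e q F x + x by rewrite /drift addrAC addNr add0r.
have q00 : 0 <= q 0%N by rewrite ltW.
have f_lip x y : `|f y - f x| <= q 0%N * L * `|y - x|.
  rewrite /f -(QopB ipP onb q0 qsum) -mulrA.
  rewrite (le_trans (norm_Qop ipP onb q0 qdec qsum _))//.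
  by rewrite ler_wpM2l.
have F_growth u : `|F u| <= (`|F 0| + L) * (1 + `|u|).
  have := FL 0 u; rewrite subr0 => h.
  rewrite -[F u](subrK (F 0)) (le_trans (ler_normD _ _))//.
  by have := mulr_ge0 (normr_ge0 (F 0)) (normr_ge0 u); have := L0; lra.
pose K1 := expR (- 2 * V 0 + `|F 0| ^+ 2 / (A - L)).
have K10 : 0 <= K1 by exact: expR_ge0.
(* One constant has to serve all bounds of [euler_consistency]. The Taylor constant of the density
   is itself built from [K2], hence the second stage [K]. *)
pose K2 := 1 + K1 + (`|F 0| + L) + q 0%N * (`|F 0| + L) + (M1 + 1) + M2.
have FL0 : 0 <= `|F 0| + L by rewrite addr_ge0.
have qFL0 : 0 <= q 0%N * (`|F 0| + L) by rewrite mulr_ge0.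
have K20 : 0 <= K2 by rewrite /K2; lra.
pose K := K2 + (8 * K2 * (K2 + 2 * L) ^+ 2 + 2 * K2 * L).
have K2K : K2 <= K.
  rewrite lerDl addr_ge0//; first exact: mulr_ge0 (mulr_ge0 (ler0n _ 8) K20) (sqr_ge0 _).
  exact: mulr_ge0 (mulr_ge0 (ler0n _ 2) K20) L0.
have rhoK2 u : rho u <= K2 * expR (A * `|u| ^+ 2).
  rewrite (le_trans (density_le ipP V_diff VF L0 FL u LA))// ler_wpM2r ?expR_ge0//.
  by rewrite /K2 -/K1; lra.
have FK2 u : `|F u| <= K2 * (1 + `|u|).
  rewrite (le_trans (F_growth u))// ler_wpM2r ?addr_ge0//; rewrite /K2; lra.
have up c w : c <= K2 -> 0 <= w -> c * w <= K * w.
  by move=> cK w0; rewrite ler_wpM2r// (le_trans cK).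
have iD := dominant_itg exp_moment AB.
have D0 : 0 <= mean2 nu (dominant A).
  apply: Rintegral_ge0 => z _; rewrite mulr_ge0 ?expR_ge0// exprn_ge0// !addr_ge0//.
exists (81 * (K ^+ 3 * mean2 nu (dominant A)) / Z) => [|h sig psi d a b d1 a1 b1 P C C1 h01 sig0 sigE].
  apply: divr_ge0; last exact: ltW.
  exact: mulr_ge0 (ler0n _ 81) (mulr_ge0 (exprn_ge0 3 (le_trans K20 K2K)) D0).
rewrite !int_mu_starE -mulrBl -(pairingE C) -(pairingE C1).
rewrite normrM normfV (gtr0_norm Z0).
have -> : (a + b) * (h ^+ 2 * (81 * (K ^+ 3 * mean2 nu (dominant A)) / Z))
  = 81 * (a + b) * h ^+ 2 * (K ^+ 3 * mean2 nu (dominant A)) / Z by ring.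
rewrite ler_pM2r ?invr_gt0//.
apply: (@euler_consistency _ _ _ _ _ ipP onb q0 qsum _ nuP gaussian_itg_norm
  (itg_norm_sqr B0 exp_moment) rho F f df K A _ A0 _ _ _ _ _ _ _ _ _ _ _ _ iD
  _ _ _ _ _ _ _ _ _ _ C C1 h01 sig0 sigE).
- by rewrite (le_trans _ K2K)// /K2; lra.
- exact: density_continuous.
- exact: lipschitz_continuous FL.
- by apply: lipschitz_continuous f_lip; rewrite mulr_ge0.
- exact: density_ge0.
- by move=> u; rewrite (le_trans (rhoK2 u))// up// expR_ge0.
- by move=> u; rewrite (le_trans (FK2 u))// up// addr_ge0.
- move=> u; apply: (le_trans (norm_Qop ipP onb q0 qdec qsum _)).
  apply: (@le_trans _ _ (q 0%N * (`|F 0| + L) * (1 + `|u|))).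
    by rewrite -mulrA ler_wpM2l.
  by apply: up; [rewrite /K2; lra|rewrite addr_ge0].
- by [].
- by move=> x c u v; rewrite /df linG' scalerDr addrACA.
- move=> x k; apply: (@le_trans _ _ ((M1 + 1) * `|k|)).
    by rewrite (le_trans (ler_normD _ _))// mulrDl mul1r lerD2r.
  by apply: up => //; rewrite /K2; lra.
- move=> x y; have -> : f y - f x - df x (y - x)
      = drift ip e q F y - drift ip e q F x - G' x (y - x).
    rewrite !fE /df; move: (drift _ _ _ _ _) (drift _ _ _ _ _) (G' _ _) => u v w.
    have -> : v + y - (u + x) = (v - u) + (y - x) by rewrite opprD addrACA.
    by rewrite (opprD w) addrACA subrr addr0.
  by rewrite (le_trans (tayG x y))// up ?sqr_ge0// /K2; lra.
- move=> x y n W xn yn xW yW.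
  have n1 : 0 <= n by apply: le_trans xn; rewrite addr_ge0.
  have W0 : 0 <= W by apply: le_trans xW; exact: expR_ge0.
  apply: (le_trans (density_taylor ipP V_diff VF L0 FL K20 rhoK2 FK2 xn yn xW yW)).
  apply: ler_wpM2r; first exact: sqr_ge0.
  apply: ler_wpM2r; first exact: W0.
  apply: ler_wpM2r; first exact: sqr_ge0.
  by rewrite /K lerDr.
- by move=> x; rewrite /drift scalerDr scalerN scalerBl scale1r addrA.
Qed.

End GibbsMeasure.

Theorem theorem4p5 (R : realType) (H : completeNormedModType R)
  (ip : H -> H -> R) (e : nat -> H) (q : nat -> R)
  (V : H -> R) (D2V : H -> H -> H -> R) (F : H -> H)
  (D2G : H -> H -> H -> H) (nu : probability (@BH R H) R)
  (phi : H -> R) (D2phi : H -> H -> H -> R) :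
  (* H is a real Hilbert space with orthonormal basis (e_k) *)
  is_inner_product ip -> is_onb ip e ->
  (* q_k > 0, non-increasing, summable *)
  (forall k, 0 < q k) -> (forall k, q k.+1 <= q k) -> cvgn (series q) ->
  (* V is C^2 with bounded second derivative, F = - DV *)
  is_second_deriv V D2V -> D2_continuous D2V ->
  (exists M : R, forall x h k, `|D2V x h k| <= M * `|h| * `|k|) ->
  (forall x h, 'd V x h = - ip (F x) h) ->
  (* nu = N(0, Q/2) *)
  gaussian_cov ip e q (2^-1) nu ->
  (* Lip(F) < lambda_1 = 1 / q_1 *)
  (exists L : R, L < (q 0%N)^-1 /\
     forall x y, `|F x - F y| <= L * `|x - y|) ->
  (* G = -x + Q F(x) is twice Frechet differentiable, bounded DG and D^2G *)
  is_second_deriv (drift ip e q F) D2G ->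
  (exists M : R, forall x h, `|'d (drift ip e q F) x h| <= M * `|h|) ->
  (exists M : R, forall x h k, `|D2G x h k| <= M * `|h| * `|k|) ->
  (* phi twice Frechet differentiable, sup|Dphi| + sup||D^2 phi|| <= 1 *)
  is_second_deriv phi D2phi ->
  (exists A B : R, A + B <= 1 /\
     (forall y h, `|'d phi y h| <= A * `|h|) /\
     (forall y h k, `|D2phi y h k| <= B * `|h| * `|k|)) ->
  exists C : R, 0 < C /\
    forall dt : R, 0 < dt <= 1 ->
    forall (gam mu : probability (@BH R H) R),
      (* gam = law of dW^Q_n = N(0, dt Q) *)
      gaussian_cov ip e q dt gam ->
      (* mu = mu^dt, the invariant law of the explicit Euler scheme *)
      euler_invariant (drift ip e q F) dt gam mu ->
      `| Rintegral mu setT phi - int_mu_star nu V phi | <= C * dt.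
Proof.
move=> ipP onb q0 qdec qsum [V_diff _ _ _ _] _ _ VF nuP [L' [L'q FL']] G2 [M1' GM1] [M2' GM2].
move=> phi2 [a' [b' [_ [phiA phiB]]]].
(* The given constants carry no sign condition; replacing them by their positive parts keeps the
   bounds. *)
pose L := Num.max 0 L'; pose M1 := Num.max 0 M1'; pose M2 := Num.max 0 M2'.
pose a := Num.max 0 a'; pose b := Num.max 0 b'.
have max0 (c : R) : 0 <= Num.max 0 c by rewrite le_max lexx.
have upm (c w z : R) : 0 <= w -> z <= c * w -> z <= Num.max 0 c * w.
  by move=> w0 /le_trans; apply; rewrite ler_wpM2r// le_max lexx orbT.
have q00 : 0 < q 0%N by [].
have L0 : 0 <= L by exact: max0.
have Lq : L < (q 0%N)^-1 by rewrite gt_max invr_gt0 q00.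
have FL x y : `|F y - F x| <= L * `|y - x| by apply: upm.
set G := drift ip e q F in G2 GM1 GM2 *.
have ipRDZ (c x y z : R) : (c *: x + y) * z = c * (x * z) + y * z by rewrite mulrDl mulrA.
have ipRxx (x : R) : x * x = `|x| ^+ 2 by rewrite real_normK ?num_real.
have ipRle (x y : R) : `|x * y| <= `|x| * `|y| by rewrite normrM.
have ipDZ c x y z : ip (c *: x + y) z = c * ip x z + ip y z by exact: (ipDZl ipP).
have Cphi : C11 phi (fun x h => 'd phi x h) a b.
  have [dphi _ _ _ _] := phi2.
  have phiA' x h : `|'d phi x h| <= a * `|h| by apply: upm.
  have phiB' x h k : `|D2phi x h k| <= b * `|h| * `|k|.
    by rewrite -mulrA upm ?mulr_ge0// mulrA.
  split=> [|x y|x c u v|x y]; first by split; exact: max0.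
  - exact: (lipschitz_of_diff (ipW := fun u v : R => u * v) ipRDZ ipRxx ipRle dphi phiA').
  - by rewrite linearP.
  - apply: (diff_lipschitz_taylor (ipW := fun u v : R => u * v) ipRDZ ipRxx ipRle (max0 _) dphi).
    exact: (second_deriv_lipschitz (ipW := fun u v : R => u * v) ipRDZ ipRxx ipRle phi2 phiB').
have GM1' x h : `|'d G x h| <= M1 * `|h| by apply: upm.
have GM2' x h k : `|D2G x h k| <= M2 * `|h| * `|k|.
  by rewrite -mulrA upm ?mulr_ge0// mulrA.
have linG x c u v : 'd G x (c *: u + v) = c *: 'd G x u + 'd G x v by rewrite linearP.
have tayG x y : `|G y - G x - 'd G x (y - x)| <= M2 * `|y - x| ^+ 2.
  have [dG _ _ _ _] := G2.
  apply: (diff_lipschitz_taylor ipDZ (ipxx ipP) (cauchy_schwarz ipP) (max0 _) dG).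
  exact: (second_deriv_lipschitz ipDZ (ipxx ipP) (cauchy_schwarz ipP) G2 GM2').
have nu1 := gaussian_itg_norm ipP onb q0 qdec qsum nuP L0 Lq.
have [T T0 cons] := euler_consistent ipP onb q0 qdec qsum nuP V_diff VF L0 Lq FL
  (max0 _) (max0 _) linG GM1' tayG.
(* An Euler step moves a difference k to (1 - dt) k plus dt Q of the difference of F, of norm at
   most (1 - dt + dt q_1 L) |k|. *)
pose kappa := 1 - q 0%N * L.
have qL : q 0%N * L < 1 by rewrite mulrC -ltr_pdivlMr// mul1r.
have k0 : 0 < kappa by rewrite subr_gt0.
have k1 : kappa <= 1 by rewrite gerBl mulr_ge0// ltW.
have X0 : 0 <= (a + b + M2 / kappa * a) * (T / kappa).
  by rewrite mulr_ge0 ?divr_ge0// ?(ltW k0)// !addr_ge0 ?max0// mulr_ge0 ?divr_ge0 ?max0// ltW.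
(* The summand 1 makes the constant strictly positive even when a = 0 and b = 0. *)
exists ((a + b + M2 / kappa * a) * (T / kappa) + 1); split; first by rewrite ltr_wpDl.
move=> dt dt01 gam mu gamP muP; have /andP[t0 t1] := dt01.
(* As nu has covariance Q / 2, the noise of covariance dt Q is sqrt (2 dt) times a sample of nu. *)
pose tau := Num.sqrt (2 * dt); pose Phi x := x + dt *: G x.
have tauE : tau ^+ 2 = 2 * dt by rewrite sqr_sqrtr// mulr_ge0// ltW.
have tau0 : 0 <= tau by exact: sqrtr_ge0.
have gam_nu A : measurable A -> gam A = nu ((fun x : @BH R H => tau *: (x : H) : @BH R H) @^-1` A).
  move=> mA; apply: (gaussian_scaling ipP onb q0 qsum _ nuP _ mA); first by rewrite invr_ge0.
  by rewrite tauE mulrAC divff ?mul1r.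
have inv A : measurable A ->
    mu A = (\int[mu]_y nu [set z : @BH R H | A (Phi y + tau *: (z : H))%R])%E.
  move=> mA; rewrite (muP A mA); apply: eq_integral => y _; rewrite gam_nu//.
  have := measurable_shift ipP onb (Phi y) 1 measurableT mA.
  by rewrite setTI /preimage; under eq_fun do rewrite scale1r.
pose r := 1 - kappa * dt.
have kt0 : 0 < kappa * dt by exact: mulr_gt0.
have kt1 : kappa * dt <= 1 by rewrite mulr_ile1// ltW.
have r0 : 0 <= r by rewrite subr_ge0.
have r1 : r < 1 by rewrite gtrBl.
have PhiB x y : Phi y - Phi x = (y - x) + dt *: (G y - G x).
  by rewrite /Phi opprD addrACA scalerBr.
have Phi_lip x y : `|Phi y - Phi x| <= r * `|y - x|.
  have -> : Phi y - Phi x = (1 - dt) *: (y - x) + dt *: Qop ip e q (F y - F x).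
    have GB : G y - G x = - (y - x) + Qop ip e q (F y - F x).
      by rewrite (QopB ipP onb q0 qsum) /G /drift [RHS]addrC opprD opprK addrACA addrC opprB [x - y]addrC.
    by rewrite PhiB GB; move: (y - x) => k; rewrite scalerDr scalerN addrA scalerBl scale1r.
  have d1 : 0 <= 1 - dt by rewrite subr_ge0.
  rewrite (le_trans (ler_normD _ _))// !normrZ (ger0_norm d1) (gtr0_norm t0).
  have h1 : `|Qop ip e q (F y - F x)| <= q 0%N * L * `|y - x|.
    by rewrite (le_trans (norm_Qop ipP onb q0 qdec qsum _))// -mulrA ler_wpM2l// ltW.
  by have := ler_wpM2l (ltW t0) h1; rewrite /r /kappa; lra.
pose J x k := k + dt *: 'd G x k.
have linJ x c u v : J x (c *: u + v) = c *: J x u + J x v.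
  by rewrite /J linG !scalerDr !scalerA [dt * c]mulrC addrACA.
have tayPhi x y : `|Phi y - Phi x - J x (y - x)| <= dt * M2 * `|y - x| ^+ 2.
  have -> : Phi y - Phi x - J x (y - x) = dt *: (G y - G x - 'd G x (y - x)).
    by rewrite PhiB /J; move: (y - x) => k; rewrite (opprD k) addrACA subrr add0r -scalerBr.
  by rewrite normrZ (gtr0_norm t0) -mulrA ler_wpM2l// ltW.
have contract psi d c1 c2 : C11 psi d c1 c2 ->
    C11 (kernel nu Phi tau psi) (kernel_diff nu Phi J tau d) (c1 * r) (c2 * r ^+ 2 + c1 * (dt * M2)).
  move=> C; apply: (kernel_C11 ipP onb nu1 tau C r0 _ Phi_lip linJ tayPhi).
  by rewrite mulr_ge0 ?max0// ltW.
have mu1 := itg_norm_invariant ipP onb nu1 r0 r1 Phi_lip inv.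
have [D close] := mu_star_close ipP onb q0 qdec qsum nuP V_diff VF L0 Lq FL mu1.
have mu_inv psi d c1 c2 : C11 psi d c1 c2 ->
    Rintegral mu setT (kernel nu Phi tau psi) = Rintegral mu setT psi.
  by move=> C; symmetry; exact: (Rint_invariant_kernel ipP onb nu1 r0 r1 Phi_lip inv C).
have consistent psi d c1 c2 : C11 psi d c1 c2 ->
    `|int_mu_star nu V (kernel nu Phi tau psi) - int_mu_star nu V psi|
    <= (c1 + c2) * (dt ^+ 2 * T).
  by move=> C; exact: (cons _ _ _ _ _ _ _ _ _ C (contract _ _ _ _ C) dt01 tau0 tauE).
have kappa01 : 0 < kappa <= 1 by rewrite k0.
have err := ergodic_error (m := fun psi => Rintegral mu setT psi)
  kappa01 dt01 (max0 _) T0 contract mu_inv consistent close Cphi.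
by apply: (le_trans err); rewrite mulrA ler_wpM2r ?lerDl// ltW.
Qed.
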